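(* Let $G$ be a compact, connected, semi-simple Lie group, $\mathfrak p\subset\mathfrak g^{\mathbb C}$ a parabolic subalgebra, and $(\mathfrak g_i)_{i\in\mathbb Z}$ the second canonical series associated to $\mathfrak p$. Put $$\mathfrak h=\mathfrak g\cap\bigoplus_{i\in\mathbb Z}\mathfrak g_{3i},\qquad \mathfrak m^+=\bigoplus_{i\in\mathbb Z}\mathfrak g_{3i+1},\qquad \mathfrak m^-=\bigoplus_{i\in\mathbb Z}\mathfrak g_{3i+2},\qquad \mathfrak m=\mathfrak g\cap(\mathfrak m^+\oplus\mathfrak m^-),$$ and let $H$ be the subgroup of $G$ corresponding to the subalgebra $\mathfrak h$. Then the homogeneous space $G/H$ is a 3-symmetric space with canonical almost complex structure represented by $\mathfrak m^+\subset\mathfrak m^{\mathbb C}$.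
   Context: Second canonical series: let $\mathfrak l^+$ be the nilradical of $\mathfrak p$, $\mathfrak k=\mathfrak p\cap\mathfrak g$, $\mathfrak l_1=\mathfrak l^+$, $\mathfrak l_{i+1}=[\mathfrak l_1,\mathfrak l_i]$. For $i\ge1$, $\mathfrak g_i$ is the orthogonal complement of $\mathfrak l_{i+1}$ in $\mathfrak l_i$ for the Hermitian product $-B(X,\overline Y)$ ($B$ the Killing form, bar the conjugation with respect to $\mathfrak g$); $\mathfrak g_0=\mathfrak k^{\mathbb C}$ and $\mathfrak g_{-i}=\overline{\mathfrak g_i}$. Known (Burstall–Rawnsley): $\mathfrak g^{\mathbb C}=\bigoplus_i\mathfrak g_i$ and $[\mathfrak g_i,\mathfrak g_j]\subset\mathfrak g_{i+j}$, so $\mathfrak h$ is a subalgebra. ''Subgroup corresponding to $\mathfrak h$'' means the connected subgroup with Lie algebra $\mathfrak h$. 3-symmetric space: a homogeneous space $G/H$ such that $G$ has an automorphism $s$ of order 3 ($s^3=\mathrm{Id}$) with $G^s_0\subset H\subset G^s$, where $G^s$ is the fixed point set and $G^s_0$ its identity component. Its canonical almost complex structure is the invariant one whose $(1,0)$-space is the eigenspace of $s_*$ on $\mathfrak g^{\mathbb C}$ for the eigenvalue $e^{2\pi i/3}$. *)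

(* Defs.v *)
From HB Require Import structures.
From mathcomp Require Import all_boot all_order all_algebra.
From mathcomp Require Import complex.
From mathcomp Require Import all_classical all_reals all_analysis.

Set Implicit Arguments.
Unset Strict Implicit.
Unset Printing Implicit Defensive.

Import Order.TTheory GRing.Theory Num.Theory.
Import numFieldNormedType.Exports.

Local Open Scope classical_set_scope.
Local Open Scope complex_scope.
Local Open Scope ring_scope.

Section LieAlgebra.
Variables (F : fieldType) (n : nat).
Local Notation V := 'rV[F]_n.
Variable br : V -> V -> V.

(* As [br] is bilinear for the Lie algebras considered, brackets of basis
   vectors span the same space as all brackets. *)
Definition lie_brv (U W : {vspace V}) : {vspace V} :=
  <<[seq br x y | x <- vbasis U, y <- vbasis W]>>%VS.

Definition lie_subalgebra (U : {vspace V}) : Prop := (lie_brv U U <= U)%VS.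

Definition lie_ideal (I U : {vspace V}) : Prop :=
  (I <= U)%VS /\ (lie_brv U I <= I)%VS.

Definition lie_solvable (U : {vspace V}) : Prop :=
  exists k, iter k (fun W => lie_brv W W) U = 0%VS.

(* U = l_1, [U, U] = l_2, ...; the value at index 0 is irrelevant. *)
Definition lower_central (U : {vspace V}) (i : nat) : {vspace V} :=
  iter i.-1 (lie_brv U) U.

Definition lie_nilpotent (U : {vspace V}) : Prop :=
  exists i, lower_central U i = 0%VS.

Definition lie_semisimple : Prop :=
  forall I : {vspace V}, lie_ideal I fullv -> lie_solvable I -> I = 0%VS.

Definition lie_borel (b : {vspace V}) : Prop :=
  [/\ lie_subalgebra b, lie_solvable b &
      forall b' : {vspace V}, lie_subalgebra b' -> lie_solvable b' ->
        (b <= b')%VS -> b' = b].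

Definition lie_parabolic (p : {vspace V}) : Prop :=
  lie_subalgebra p /\ exists2 b, lie_borel b & (b <= p)%VS.

Definition lie_nilradical (N p : {vspace V}) : Prop :=
  [/\ lie_ideal N p, lie_nilpotent N &
      forall I : {vspace V}, lie_ideal I p -> lie_nilpotent I -> (I <= N)%VS].

Definition killing (x y : V) : F := \tr (lin1_mx (br x) *m lin1_mx (br y)).

End LieAlgebra.

Section Complexification.
Variables (R : realType) (n : nat).
Local Notation VR := 'rV[R]_n.
Local Notation VC := 'rV[R[i]]_n.

(* Spelled out, since 'i in ring_scope is an abstract square root of -1. *)
Definition iC : R[i] := 0 +i* 1.

Definition toC (u : VR) : VC := map_mx (real_complex R) u.
Definition reV (X : VC) : VR := map_mx (@complex.Re R) X.
Definition imV (X : VC) : VR := map_mx (@complex.Im R) X.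
Definition conjV (X : VC) : VC := map_mx (fun z : R[i] => conjc z) X.

Definition cplx_set (A : set VR) : set VC := [set X | A (reV X) /\ A (imV X)].

Definition cplx_map (f : VR -> VR) (X : VC) : VC :=
  toC (f (reV X)) + iC *: toC (f (imV X)).

Definition cplx_br (br : VR -> VR -> VR) (X Y : VC) : VC :=
  toC (br (reV X) (reV Y) - br (imV X) (imV Y))
  + iC *: toC (br (reV X) (imV Y) + br (imV X) (reV Y)).

Definition sum_set (A B : set VC) : set VC :=
  [set Z | exists X Y, [/\ A X, B Y & Z = X + Y]].

(* The sum of a family of subspaces indexed by the integers. *)
Definition int_sum (W : int -> set VC) : set VC :=
  [set X | exists (s : seq int) (f : int -> VC),
     [/\ uniq s, forall i, W i (f i) & X = \sum_(i <- s) f i]].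

(* Real vectors belonging to a complex subspace: g n W inside g^C. *)
Definition real_points (W : set VC) : set VR := [set u | W (toC u)].

End Complexification.

Section CanonicalSeries.
Variables (R : realType) (n : nat) (br : 'rV[R]_n -> 'rV[R]_n -> 'rV[R]_n).
Local Notation VC := 'rV[R[i]]_n.
Variables (p lplus : {vspace VC}).

Definition herm (X Y : VC) : R[i] := - killing (cplx_br br) X (conjV Y).

Definition series_pos (i : nat) : set VC :=
  [set X | X \in lower_central (cplx_br br) lplus i /\
     forall Y, Y \in lower_central (cplx_br br) lplus i.+1 -> herm X Y = 0].

Definition second_series (z : int) : set VC :=
  match z with
  | Posz 0 => cplx_set (real_points [set` p])
  | Posz i => series_pos i
  | Negz i => @conjV R n @` series_pos i.+1
  end.

Definition hC : set VC := int_sum (fun i => second_series (3 * i)).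
Definition mplus : set VC := int_sum (fun i => second_series (3 * i + 1)).
Definition mminus : set VC := int_sum (fun i => second_series (3 * i + 2)).

Definition hR : set 'rV[R]_n := real_points hC.
Definition mR : set 'rV[R]_n := real_points (sum_set mplus mminus).

End CanonicalSeries.

Section Smooth.
Variables (R : realType) (V W : normedModType R).

(* For V finite-dimensional and A open this is the usual C^k: all iterated
   directional derivatives of order at most k exist and are continuous. *)
Fixpoint Ck_on (k : nat) (A : set V) (f : V -> W) : Prop :=
  (forall x, A x -> {for x, continuous f}) /\
  match k with
  | 0 => True
  | k'.+1 => forall v : V,
      (forall x, A x -> derivable f x v) /\ Ck_on k' A (fun x => 'D_v f x)
  end.

Definition smooth_on (A : set V) (f : V -> W) : Prop := forall k, Ck_on k A f.

End Smooth.

#[short(type="topGroupType")]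
HB.structure Definition TopGroup := {G of Topological G & Group G}.

(* A homeomorphism from an open set [cdom] onto an open subset of R^n;
   [cmap] and [cinv] are only meaningful on [cdom] and [cimg]. *)
Record chart (R : realType) (n : nat) (M : topologicalType) := Chart {
  cdom : set M ;
  cmap : M -> 'rV[R]_n ;
  cinv : 'rV[R]_n -> M ;
  cimg := cmap @` cdom ;
  cdom_open : open cdom ;
  cimg_open : open cimg ;
  cmapK : forall x, cdom x -> cinv (cmap x) = x ;
  cmap_continuous : forall x, cdom x -> {for x, continuous cmap} ;
  cinv_continuous : forall y, cimg y -> {for y, continuous cinv}
}.

Section SmoothMaps.
Variables (R : realType) (m n k : nat) (L M N : topologicalType).

Definition smooth_in_charts (c : chart R m M) (d : chart R n N) (f : M -> N) :=
  smooth_on (cmap c @` (cdom c `&` f @^-1` cdom d))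
            (fun y => cmap d (f (cinv c y))).

Definition smooth2_in_charts (b : chart R k L) (c : chart R m M)
    (d : chart R n N) (f : L -> M -> N) :=
  smooth_on [set z : 'rV[R]_k * 'rV[R]_m |
               [/\ cimg b z.1, cimg c z.2 &
                   cdom d (f (cinv b z.1) (cinv c z.2))]]
            (fun z => cmap d (f (cinv b z.1) (cinv c z.2))).

End SmoothMaps.

Local Open Scope group_scope.

Record lieGroup (R : realType) (n : nat) := LieGroup {
  lg_sort :> topGroupType ;
  atlas : set (chart R n lg_sort) ;
  lg_hausdorff : hausdorff_space lg_sort ;
  lg_second_countable : @second_countable lg_sort ;
  atlas_cover : forall x : lg_sort, exists2 c, atlas c & cdom c x ;
  atlas_smooth : forall c d, atlas c -> atlas d ->
    smooth_in_charts c d (@id lg_sort) ;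
  lg_mul_continuous : continuous (fun z : lg_sort * lg_sort => z.1 * z.2) ;
  lg_inv_continuous : continuous (fun x : lg_sort => x^-1) ;
  lg_mul_smooth : forall b c d, atlas b -> atlas c -> atlas d ->
    smooth2_in_charts b c d (fun x y : lg_sort => x * y) ;
  lg_inv_smooth : forall c d, atlas c -> atlas d ->
    smooth_in_charts c d (fun x : lg_sort => x^-1)
}.

Definition lg_smooth (R : realType) (m n : nat) (L : lieGroup R m)
    (G : lieGroup R n) (f : L -> G) : Prop :=
  continuous f /\
  forall c d, atlas (l := L) c -> atlas (l := G) d -> smooth_in_charts c d f.

(* A chart [c] with [cdom c 1] identifies T_1 G with R^n, so that the Lie
   algebra of G is R^n with the bracket [lie_br c]. *)

(* The differential at the unit of a map f with f 1 = 1. *)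
Definition diff1 (R : realType) (m n : nat) (L : lieGroup R m)
    (G : lieGroup R n) (d : chart R m L) (c : chart R n G) (f : L -> G)
    (v : 'rV[R]_m) : 'rV[R]_n :=
  'D_v (fun y => cmap c (f (cinv d y))) (cmap d 1).

Section LieAlgebraOfGroup.
Variables (R : realType) (n : nat) (G : lieGroup R n) (c : chart R n G).

Definition Ad (x : G) : 'rV[R]_n -> 'rV[R]_n :=
  diff1 c c (fun y : G => x * y * x^-1).

(* [u, v] = ad(u) v, where ad is the differential of Ad at the unit. *)
Definition lie_br (u v : 'rV[R]_n) : 'rV[R]_n :=
  'D_u (fun x => Ad (cinv c x) v) (cmap c 1).

(* H is the connected (immersed, not necessarily closed) Lie subgroup of G
   with Lie algebra h. Connectedness refers to the Lie group topology of H,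
   which may be finer than the one induced by G. *)
Definition connected_lie_subgroup (H : set G) (h : set 'rV[R]_n) : Prop :=
  exists (m : nat) (L : lieGroup R m) (d : chart R m L) (iota : L -> G),
    [/\ atlas d, cdom d 1 & connected [set: L]] /\
    [/\ lg_smooth iota, {morph iota : x y / x * y}, injective iota &
        injective (diff1 d c iota)] /\
    range iota = H /\ range (diff1 d c iota) = h.

End LieAlgebraOfGroup.

Section ThreeSymmetric.
Variables (R : realType) (n : nat) (G : lieGroup R n).

Definition is_subgroup (H : set G) : Prop :=
  [/\ H 1, forall x y, H x -> H y -> H (x * y) & forall x, H x -> H x^-1].

Definition fixed_points (s : G -> G) : set G := [set x | s x = x].

Definition lg_automorphism (s : G -> G) : Prop :=
  [/\ {morph s : x y / x * y}, bijective s, lg_smooth s &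
      forall t : G -> G, cancel s t -> cancel t s -> lg_smooth t].

(* G/H is 3-symmetric, with automorphism s. As usual, s = id (so that
   G/H is a point when G is connected) is not excluded. *)
Definition three_symmetric (H : set G) (s : G -> G) : Prop :=
  [/\ is_subgroup H /\ closed H,
      lg_automorphism s,
      forall x, s (s (s x)) = x,
      connected_component (fixed_points s) 1 `<=` H &
      H `<=` fixed_points s].

Variables (c : chart R n G) (H : set G).

(* m is an Ad(H)-stable complement of h in g: it represents the tangent
   space of G/H at the base point. *)
Definition reductive_complement (h m : set 'rV[R]_n) : Prop :=
  [/\ forall u, exists a b, [/\ h a, m b & u = (a + b)%R],
      forall u, h u -> m u -> u = 0%R &
      forall x u, H x -> m u -> m (Ad c x u)].

Variable m : set 'rV[R]_n.

(* A G-invariant almost complex structure on G/H, given by its value J on the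
   tangent space m at the base point. *)
Definition invariant_acs (J : {linear 'rV[R]_n -> 'rV[R]_n}) : Prop :=
  [/\ forall u, m u -> m (J u),
      forall u, m u -> J (J u) = (- u)%R &
      forall x u, H x -> m u -> J (Ad c x u) = Ad c x (J u)].

Definition acs_space10 (J : 'rV[R]_n -> 'rV[R]_n) : set 'rV[R[i]]_n :=
  [set X | cplx_set m X /\ cplx_map J X = (iC R *: X)%R].

Definition omega3 : R[i] := (cos (2 * pi / 3) +i* sin (2 * pi / 3))%R.

Definition canonical_acs (s : G -> G) (J : {linear 'rV[R]_n -> 'rV[R]_n}) :=
  invariant_acs J /\
  acs_space10 J = [set X | cplx_map (diff1 c c s) X = (omega3 *: X)%R].

End ThreeSymmetric.

(* Main.v *)
(** The Killing form of a compact semisimple G is negative definite: Ad (G) is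
    bounded, so ad u has imaginary eigenvalues and no nilpotent part. Hence
    -B(X, conj Y) is a positive Hermitian product. By Lie's theorem and this
    positivity the nilradical of p is its Killing orthogonal, the orthogonal
    complements of the lower central series grade g^C, and the degree
    derivation is inner: [xi, X] = i k X for X in g_k, for some real xi.

    With u = (2 pi / 3) xi, let g0 be a cluster point of the powers
    (c^-1 (u / N))^N. Then Ad g0 acts as exp (ad u), i.e. as omega^k on g_k, so
    h, m^+ and m^- are its eigenspaces for 1, omega and omega^2, and s is the
    conjugation by g0. A homomorphism from a connected Lie group is determined
    by its differential at the unit, whence s^3 = 1 and H <= G^s. As m contains
    no vector fixed by Ad g0, the group H is open in G^s. Finally
    J = (2 Ad g0 + 1) / sqrt 3 on m. *)

Require Import Defs.
From HB Require Import structures.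
From mathcomp Require Import all_boot all_order all_algebra spectral ring lra zify.
From mathcomp Require Import complex.
From mathcomp Require Import all_classical all_reals all_analysis.

Set Implicit Arguments.
Unset Strict Implicit.
Unset Printing Implicit Defensive.

Import Order.TTheory GRing.Theory Num.Theory.
Import numFieldNormedType.Exports.

Local Open Scope ring_scope.

(** * Functions of a triangularisable matrix *)

(** The argument uses neither root systems nor an exponential map. On the algebra side everything
    rests on one fact about a Borel subalgebra b, namely that its Killing orthogonal lies in [b, b].
    It comes from maximality of b together with Cartan's device of replacing ad y by the operator
    that has the conjugate eigenvalues. The grading then comes from a single adjointness relation:
    for the Hermitian product, the adjoint of ad a is -ad (conj a).

    On the group side only Ad g0 is ever computed. The cube of g0 may be a nontrivial central
    element, so the relations for s are proved on the Lie algebra and lifted by connectedness. The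
    bracket, being a derivative of Ad, is at first only a Leibniz bracket; semisimplicity makes it
    skew. The subgroup H is merely immersed: that it is closed is a consequence of its being open in
    the closed group G^s. For this openness, elements of G near 1 are factored as an element of H
    times a small displacement transverse to h. *)

Section Trigonal.
Variable F : numClosedFieldType.

Lemma trig_mul n (A B : 'M[F]_n) : is_trig_mx A -> is_trig_mx B ->
  is_trig_mx (A *m B) /\ forall i, (A *m B) i i = A i i * B i i.
Proof.
move=> /is_trig_mxP tA /is_trig_mxP tB; split.
  apply/is_trig_mxP => i j ij; rewrite mxE big1 // => k _.
  case: (ltnP i k) => [/tA->|ki]; first by rewrite mul0r.
  by rewrite (tB k j) ?mulr0 // (leq_ltn_trans ki).
move=> i; rewrite mxE (bigD1 i) //= big1 ?addr0 // => k; rewrite -val_eqE /=.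
by case: ltngtP => // [ki|ki] _; [rewrite (tB _ _ ki) mulr0|rewrite (tA _ _ ki) mul0r].
Qed.

Lemma trigonal_form n (A : 'M[F]_n) : exists2 P : 'M[F]_n,
  P \in unitmx & is_trig_mx (P *m A *m invmx P).
Proof.
case: n A => [|n] A.
  by exists 1%:M; [exact: unitmx1|apply/is_trig_mxP => -[]].
have [P /unitarymx_unit uP] := Schur A (ltn0Sn _).
rewrite /similar_to /= conjumx // => tP; by exists P.
Qed.

Lemma mxtrace_conj n (P A : 'M[F]_n) : P \in unitmx ->
  \tr (P *m A *m invmx P) = \tr A.
Proof. by move=> uP; rewrite mxtrace_mulC mulmxA mulVmx // mul1mx. Qed.

Lemma expr_conj n (P A : 'M[F]_n) k : P \in unitmx ->
  (P *m A *m invmx P) ^+ k = P *m A ^+ k *m invmx P.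
Proof.
move=> uP; elim: k => [|k IH]; first by rewrite !expr0 mulmx1 mulmxV.
by rewrite !exprS IH /GRing.mul/= !mulmxA mulmxKV.
Qed.

Lemma trig_expr n (A : 'M[F]_n) k : is_trig_mx A ->
  is_trig_mx (A ^+ k) /\ forall i, (A ^+ k) i i = A i i ^+ k.
Proof.
move=> tA; elim: k => [|k [t d]].
  rewrite expr0; split; first exact: scalar_mx_is_trig.
  by move=> i; rewrite mxE eqxx.
have [t' d'] := trig_mul tA t; rewrite exprS; split => // i.
by rewrite d' d exprS.
Qed.

Lemma mxtrace_nilpotent n (A : 'M[F]_n) k : A ^+ k = 0 -> \tr A = 0.
Proof.
move=> Ak; have [P uP tP] := trigonal_form A.
rewrite -(mxtrace_conj A uP); apply: big1 => i _.
have [_ /(_ i)] := trig_expr k tP.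
rewrite expr_conj // Ak mulmx0 mul0mx mxE => /esym/eqP.
by rewrite expf_eq0 => /andP[_ /eqP].
Qed.

Lemma trig_diag0_nilpotent n (A : 'M[F]_n) :
  is_trig_mx A -> (forall i, A i i = 0) -> A ^+ n = 0.
Proof.
move=> /is_trig_mxP tA dA.
(* [is_trig_mx] means lower triangular; each further factor moves the zero region one diagonal
   down. *)
have H k : forall i j : 'I_n, (i < j + k)%N -> (A ^+ k) i j = 0.
  elim: k => [|k IH] i j.
    by rewrite addn0 expr0 !mxE => ij; rewrite (negbTE (_ : i != j)) // -val_eqE /= ltn_eqF.
  move=> ij; rewrite exprS mxE big1 // => l _.
  case: (ltngtP i l) => [/tA->|li|/val_inj <-]; rewrite ?mul0r //.
    by rewrite IH ?mulr0 //; move: ij; rewrite addnS ltnS; apply: leq_trans.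
  by rewrite dA mul0r.
by apply/matrixP => i j; rewrite H ?mxE // ltn_addl.
Qed.

End Trigonal.

(** * Semisimple part with conjugated eigenvalues *)

Section ConjugatePart.
Variable F : numClosedFieldType.

(** Chinese remainders for the pairwise coprime powers of 'X - k. Evaluated at a matrix, [q] acts as
    the scalar [c k] on vectors killed by the N-th power belonging to k. *)
Lemma poly_chinese (c : F -> F) N (s : seq F) : uniq s ->
  exists q : {poly F}, forall k, k \in s -> ('X - k%:P) ^+ N %| q - (c k)%:P.
Proof.
elim: s => [|k0 s IH] /=; first by exists 0.
move=> /andP[k0s /IH[q Hq]].
pose p := \prod_(k <- s) ('X - k%:P) ^+ N.
have cop : coprimep (('X - k0%:P) ^+ N) p.
  rewrite /p big_seq; elim/big_rec: _ => [|k r ks IHr]; first exact: coprimep1.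
  rewrite coprimepMr IHr andbT coprimep_expl // coprimep_expr //.
  rewrite coprimep_XsubC root_XsubC.
  by apply: contraNneq k0s => <-.
have [[a b] /= uvE] := Bezout_eq1_coprimepP _ _ cop.
exists (q + b * p * ((c k0)%:P - q)) => k; rewrite inE => /predU1P[->|ks].
  have -> : q + b * p * ((c k0)%:P - q) - (c k0)%:P
     = (q - (c k0)%:P) * (a * ('X - k0%:P) ^+ N).
    have -> : b * p = 1 - a * ('X - k0%:P) ^+ N by rewrite -uvE addrAC subrr add0r.
    by ring.
  by rewrite dvdp_mull // dvdp_mull.
rewrite addrAC dvdp_add ?Hq //; apply: dvdp_mulr; apply: dvdp_mull.
by rewrite /p (perm_big _ (perm_to_rem ks)) big_cons dvdp_mulr.
Qed.

(** Primary decomposition turned into an induction principle: by Bezout a vector killed by the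
    product is a sum of vectors killed by single factors. *)
Lemma geig_ind n (A : 'M[F]_n.+1) N (s : seq F) (Q : 'rV[F]_n.+1 -> Prop) :
  uniq s -> Q 0 -> (forall u v, Q u -> Q v -> Q (u + v)) ->
  (forall k v, k \in s -> v *m horner_mx A (('X - k%:P) ^+ N) = 0 -> Q v) ->
  forall v, v *m horner_mx A (\prod_(k <- s) ('X - k%:P) ^+ N) = 0 -> Q v.
Proof.
move=> us Q0 QD; elim: s us => [|k0 s IH] /=.
  by move=> _ _ v; rewrite big_nil rmorph1 mulmx1 => ->.
move=> /andP[k0s /IH{}IH] Qk v; rewrite big_cons => vp.
set p := \prod_(k <- s) _ in vp IH.
have cop : coprimep (('X - k0%:P) ^+ N) p.
  rewrite /p big_seq; elim/big_rec: _ => [|k r ks IHr]; first exact: coprimep1.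
  rewrite coprimepMr IHr andbT coprimep_expl // coprimep_expr //.
  rewrite coprimep_XsubC root_XsubC.
  by apply: contraNneq k0s => <-.
have [[a b] /= ab] := Bezout_eq1_coprimepP _ _ cop.
have -> : v = v *m horner_mx A (a * ('X - k0%:P) ^+ N) + v *m horner_mx A (b * p).
  by rewrite -mulmxDr -rmorphD /= ab rmorph1 mulmx1.
have hM p1 p2 : v *m horner_mx A p1 *m horner_mx A p2 = v *m horner_mx A (p1 * p2).
  by rewrite rmorphM -mulmxA.
have killed p1 : v *m horner_mx A (('X - k0%:P) ^+ N * p * p1) = 0.
  by rewrite -hM vp mul0mx.
apply: QD.
  apply: IH; first by move=> k w ks; apply: Qk; rewrite inE ks orbT.
  rewrite hM -[RHS](killed a); congr (_ *m horner_mx A _); ring.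
apply: (Qk k0); first by rewrite inE eqxx.
by rewrite hM -[RHS](killed b); congr (_ *m horner_mx A _); ring.
Qed.

Lemma trig_horner n (A : 'M[F]_n.+1) (q : {poly F}) : is_trig_mx A ->
  is_trig_mx (horner_mx A q) /\ forall i, (horner_mx A q) i i = q.[A i i].
Proof.
move=> tA; elim/poly_ind: q => [|q c [t d]].
  rewrite rmorph0; split; first exact: mx0_is_trig.
  by move=> i; rewrite mxE horner0.
have [t' d'] := trig_mul t tA.
rewrite rmorphD rmorphM /= horner_mx_X horner_mx_C; split.
  apply/is_trig_mxP => i j ij; rewrite mxE (is_trig_mxP t') // mxE.
  by rewrite (negbTE (_ : i != j)) ?addr0 // -val_eqE /= ltn_eqF.
by move=> i; rewrite mxE d' d mxE eqxx hornerMXaddC.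
Qed.

(* If A has the generalised eigenspaces V_k, then S acts on V_k as the
   conjugate of k; it is a polynomial in A without constant term. *)
Lemma conjugate_part n (A : 'M[F]_n) : exists S : 'M[F]_n,
  [/\ forall D U : {vspace 'rV[F]_n}, (D <= U)%VS ->
        (forall u, u \in U -> u *m A \in D) ->
        (forall u, u \in U -> u *m S \in D),
      forall f : 'rV[F]_n -> 'rV[F]_n -> 'rV[F]_n,
        (forall x, linear (f x)) -> (forall y, linear (f^~ y)) ->
        (forall x y, f x y *m A = f (x *m A) y + f x (y *m A)) ->
        (forall x y, f x y *m S = f (x *m S) y + f x (y *m S)) &
      \tr (A *m S) = 0 -> A ^+ n = 0].
Proof.
case: n A => [|n] A.
  exists 0; split => //.
  - by move=> D U _ _ u _; rewrite mulmx0 mem0v.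
  - by move=> f *; apply/rowP => -[].
  - by move=> _; apply/matrixP => -[].
have [P uP tP] := trigonal_form A; set T := P *m A *m invmx P in tP.
pose eigs := [seq T i i | i : 'I_n.+1].
(* The point 0 makes [q] divisible by 'X. The sums are where [f] sends pairs of generalised
   eigenspaces, and [q] must have the right value there too. *)
pose s := undup (0 :: eigs ++ [seq x + y | x <- eigs, y <- eigs]).
have us : uniq s by exact: undup_uniq.
(* The exponent is doubled because [f x y] is only killed by the sum of the exponents that kill x
   and y. *)
have [q Hq] := poly_chinese (fun z => z^*) (n.+1 + n.+1) us.
have qE k : k \in s -> q.[k] = k^*.
  move=> /Hq /dvdpP[r /(congr1 (fun p => p.[k]))].
  rewrite hornerD hornerN hornerC hornerM horner_exp hornerXsubC subrr expr0n mulr0 => /eqP.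
  by rewrite subr_eq0 => /eqP.
have se k : k \in eigs -> k \in s by move=> ke; rewrite mem_undup inE mem_cat ke orbT.
have hT p : P *m horner_mx A p *m invmx P = horner_mx T p.
  by rewrite /T horner_mx_uconj.
have charA : horner_mx A (\prod_(k <- undup eigs) ('X - k%:P) ^+ n.+1) = 0.
  have H : horner_mx A (char_poly T) = 0.
    have := Cayley_Hamilton T; rewrite -hT => /(congr1 (fun M => invmx P *m M *m P)).
    by rewrite mulmx0 mul0mx !mulmxA mulVmx // mul1mx mulmxKV.
  have : char_poly T %| \prod_(k <- undup eigs) ('X - k%:P) ^+ n.+1.
    rewrite (char_poly_trig tP).
    have -> : \prod_(i < n.+1) ('X - (T i i)%:P) = \prod_(k <- eigs) ('X - k%:P).
      by rewrite big_map big_enum.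
    rewrite -big_undup_iterop_count /=.
    have : forall k, (count_mem k eigs <= n.+1)%N.
      by move=> k; rewrite (leq_trans (count_size _ _)) // size_map -cardE card_ord.
    elim: (undup eigs) => [|k r IH] Hc; first by rewrite !big_nil.
    by rewrite !big_cons dvdp_mul ?IH // -/(GRing.exp _ _) dvdp_exp2l.
  by move=> /dvdpP[r ->]; rewrite rmorphM /= H mulr0.
exists (horner_mx A q); split.
- have [r rE] : exists r, q = r * 'X.
    apply/dvdpP; rewrite -['X]subr0 dvdp_XsubCl; apply/eqP.
    by rewrite qE ?conjC0 // mem_undup inE eqxx.
  move=> D U DU UD u uU.
  rewrite rE mulrC rmorphM /= horner_mx_X -[_ * _]/(_ *m _) mulmxA.
  have {uU} : u *m A \in D by exact: UD.
  move: (u *m A) => {u} w wD.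
  elim/poly_ind: r {rE} => [|r c IH]; first by rewrite rmorph0 mulmx0 mem0v.
  rewrite rmorphD rmorphM /= horner_mx_X horner_mx_C mulmxDr rpredD //.
    by rewrite -[_ * _]/(_ *m _) mulmxA UD // (subvP DU).
  by rewrite mul_mx_scalar rpredZ.
- move=> f fr fl fA.
  have frD x y z : f x (y + z) = f x y + f x z by rewrite -{1}(scale1r y) fr scale1r.
  have fr0 x : f x 0 = 0 by rewrite -[LHS](addrK (f x 0)) -frD addr0 subrr.
  have frZ a x y : f x (a *: y) = a *: f x y by rewrite -{1}(addr0 (a *: y)) fr fr0 addr0.
  have flD x y z : f (x + y) z = f x z + f y z by rewrite -{1}(scale1r x) fl scale1r.
  have fl0 x : f 0 x = 0 by rewrite -[LHS](addrK (f 0 x)) -flD addr0 subrr.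
  have flZ a x y : f (a *: x) y = a *: f x y by rewrite -{1}(addr0 (a *: x)) fl fl0 addr0.
  pose B k := A - k%:M.
  have BE k N : horner_mx A (('X - k%:P) ^+ N) = B k ^+ N.
    by rewrite rmorphXn rmorphB /= horner_mx_X horner_mx_C.
  have eigS k N (v : 'rV_n.+1) : (N <= n.+1 + n.+1)%N -> k \in s -> v *m B k ^+ N = 0 ->
      v *m horner_mx A q = k^* *: v.
    move=> HN ks vB; have /dvdpP[r rE] := Hq k ks.
    have -> : q = r * ('X - k%:P) ^+ (n.+1 + n.+1) + (k^*)%:P by rewrite -rE subrK.
    rewrite rmorphD /= horner_mx_C mulmxDr mul_mx_scalar.
    rewrite mulrC rmorphM /= BE -(subnKC HN) exprD -mulrA.
    by rewrite -[B k ^+ N * _]/(_ *m _) mulmxA vB mul0mx add0r.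
  (* [B (k + l)] acts on [f x y] by the Leibniz rule through [B k] on x and [B l] on y; hence the
     induction on i + j. *)
  have addB k l i j x y : x *m B k ^+ i = 0 -> y *m B l ^+ j = 0 ->
      f x y *m B (k + l) ^+ (i + j) = 0.
    have step x' y' : f x' y' *m B (k + l) = f (x' *m B k) y' + f x' (y' *m B l).
      by rewrite /B !mulmxBr fA !mul_mx_scalar -!scaleNr flD frD flZ frZ addrACA -scalerDl -opprD.
    have [m] := ubnP (i + j); elim: m i j x y => // m IH i j x y.
    rewrite ltnS => ijm xi yj; case: i ijm xi => [|i] ijm xi.
      by rewrite (_ : x = 0) ?fl0 ?mul0mx // -xi expr0 mulmx1.
    case: j ijm yj => [|j] ijm yj.
      by rewrite (_ : y = 0) ?fr0 ?mul0mx // -yj expr0 mulmx1.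
    rewrite addSn exprS -[_ * _]/(_ *m _) mulmxA step mulmxDl.
    have xi' : x *m B k *m B k ^+ i = 0 by rewrite -mulmxA -[B k *m _]exprS.
    have yj' : y *m B l *m B l ^+ j = 0 by rewrite -mulmxA -[B l *m _]exprS.
    rewrite (IH i j.+1) // add0r addnS -addSn (IH i.+1 j) //.
    by rewrite addSnnS.
  pose Q1 x := forall y, f x y *m horner_mx A q
       = f (x *m horner_mx A q) y + f x (y *m horner_mx A q).
  suff : forall x, Q1 x by [].
  move=> x; apply: (@geig_ind _ A n.+1 (undup eigs) Q1) (undup_uniq _) _ _ _ _ _.
  - by move=> y; rewrite mul0mx !fl0 mul0mx addr0.
  - by move=> u v Hu Hv y; rewrite mulmxDl !flD mulmxDl Hu Hv addrACA.
  - move=> k u; rewrite mem_undup => ke; rewrite BE => uk y.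
    pose Q2 y := f u y *m horner_mx A q
       = f (u *m horner_mx A q) y + f u (y *m horner_mx A q).
    apply: (@geig_ind _ A n.+1 (undup eigs) Q2) (undup_uniq _) _ _ _ _ _.
    + by rewrite /Q2 mul0mx !fr0 mul0mx addr0.
    + by move=> v w; rewrite /Q2 mulmxDl !frD mulmxDl => -> ->; rewrite addrACA.
    + move=> l v; rewrite mem_undup => le; rewrite BE => vl; rewrite /Q2.
      have kls : k + l \in s.
        by rewrite mem_undup inE mem_cat; apply/orP; right; apply/orP; right; apply/allpairsP; exists (k, l).
      rewrite (eigS k n.+1 u) ?se ?leq_addl // (eigS l n.+1 v) ?se ?leq_addl //.
      rewrite (eigS (k + l) (n.+1 + n.+1)%N) ?addB //.
      by rewrite flZ frZ rmorphD /= scalerDl.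
    + by rewrite charA mulmx0.
  - by rewrite charA mulmx0.
(* In triangular form the trace of A S is the sum of the squared moduli of the eigenvalues of A. *)
- move=> tr0; have : \tr (T *m horner_mx T q) = 0.
    by rewrite -hT /T !mulmxA mulmxKV // -(mulmxA P) mxtrace_conj.
  have [tq dq] := trig_horner q tP; have [tm dm] := trig_mul tP tq.
  rewrite /mxtrace; under eq_bigr => i _.
    rewrite dm dq qE; last by apply: se; apply: map_f; rewrite mem_enum.
    rewrite -normCK; over.
  move=> /psumr_eq0P H; have dT i : T i i = 0.
    have /eqP := H (fun i _ => exprn_ge0 2 (normr_ge0 (T i i))) i isT.
    by rewrite expf_eq0 /= normr_eq0 => /eqP.
  have := trig_diag0_nilpotent tP dT; rewrite /T expr_conj // => /(congr1 (fun M => invmx P *m M *m P)).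
  by rewrite mulmx0 mul0mx -!mulmxA mulVmx // mulmx1 mulmxA mulVmx // mul1mx.
Qed.

End ConjugatePart.

(** * Solvable Lie algebras *)

Definition lie_bracket (F : fieldType) n (br : 'rV[F]_n -> 'rV[F]_n -> 'rV[F]_n) :=
  [/\ forall x, linear (br x), forall y, linear (br^~ y),
      forall x y, br x y = - br y x &
      forall x y z, br x (br y z) = br (br x y) z + br y (br x z)].

Section LieBasics.
Variables (F : fieldType) (n : nat).
Local Notation V := 'rV[F]_n.
Variable br : V -> V -> V.
Hypothesis brL : lie_bracket br.

Lemma lie_brDr x y z : br x (y + z) = br x y + br x z.
Proof. by case: brL => brr _ _ _; rewrite -{1}(scale1r y) brr scale1r. Qed.

Lemma lie_brDl x y z : br (x + y) z = br x z + br y z.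
Proof. by case: brL => _ brl _ _; rewrite -{1}(scale1r x) brl scale1r. Qed.

Lemma lie_br0 x : br x 0 = 0.
Proof. by rewrite -[LHS](addrK (br x 0)) -lie_brDr addr0 subrr. Qed.

Lemma lie_0br x : br 0 x = 0.
Proof. by rewrite -[LHS](addrK (br 0 x)) -lie_brDl addr0 subrr. Qed.

Lemma lie_brZr a x y : br x (a *: y) = a *: br x y.
Proof. by case: brL => brr _ _ _; rewrite -{1}(addr0 (a *: y)) brr lie_br0 addr0. Qed.

Lemma lie_brZl a x y : br (a *: x) y = a *: br x y.
Proof. by case: brL => _ brl _ _; rewrite -{1}(addr0 (a *: x)) brl lie_0br addr0. Qed.

Lemma lie_brC x y : br x y = - br y x.
Proof. by case: brL. Qed.

Lemma lie_brNl x y : br (- x) y = - br x y.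
Proof. by rewrite -scaleN1r lie_brZl scaleN1r. Qed.

Lemma lie_brNr x y : br x (- y) = - br x y.
Proof. by rewrite -scaleN1r lie_brZr scaleN1r. Qed.

Lemma lie_jacobi x y z : br x (br y z) = br (br x y) z + br y (br x z).
Proof. by case: brL. Qed.

Lemma lie_br_sumr I (r : seq I) (P : pred I) (f : I -> V) x :
  br x (\sum_(i <- r | P i) f i) = \sum_(i <- r | P i) br x (f i).
Proof. by elim/big_rec2: _ => [|i u v _ <-]; rewrite ?lie_br0 ?lie_brDr. Qed.

Lemma lie_br_suml I (r : seq I) (P : pred I) (f : I -> V) x :
  br (\sum_(i <- r | P i) f i) x = \sum_(i <- r | P i) br (f i) x.
Proof. by elim/big_rec2: _ => [|i u v _ <-]; rewrite ?lie_0br ?lie_brDl. Qed.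

(** Vectors are rows and matrices act on the right, so products of adjoint matrices occur in reverse
    order, as in [adm_br]. *)
Definition adm x : 'M[F]_n := lin1_mx (br x).

Lemma mul_adm v x : v *m adm x = br x v.
Proof.
case: brL => brr _ _ _.
pose bx := HB.pack_for {linear V -> V} (br x) (GRing.isLinear.Build _ _ _ _ _ (brr x)).
exact: (mul_rV_lin1 bx).
Qed.

Lemma admD x y : adm (x + y) = adm x + adm y.
Proof. by apply/row_matrixP => i; rewrite raddfD /= !rowE !mul_adm lie_brDl. Qed.

Lemma admZ a x : adm (a *: x) = a *: adm x.
Proof. by apply/row_matrixP => i; rewrite linearZ /= !rowE !mul_adm lie_brZl. Qed.

Lemma adm_br x y : adm (br x y) = adm y *m adm x - adm x *m adm y.
Proof.
apply/row_matrixP => i; rewrite raddfB /= !rowE !mulmxA !mul_adm.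
by rewrite lie_jacobi addrK.
Qed.

Lemma adm0 : adm 0 = 0.
Proof. by apply/row_matrixP => i; rewrite !rowE mul_adm lie_0br mulmx0. Qed.

Lemma lie_brvP (U W X : {vspace V}) :
  (lie_brv br U W <= X)%VS <-> forall u w, u \in U -> w \in W -> br u w \in X.
Proof.
split=> [/subvP H u w uU wW|H].
  rewrite (coord_vbasis uU) (coord_vbasis wW) lie_br_suml rpred_sum // => i _.
  rewrite lie_br_sumr rpred_sum // => j _; rewrite lie_brZl lie_brZr !rpredZ //.
  apply/H/memv_span/allpairsP; exists ((vbasis U)`_i, (vbasis W)`_j).
  by split=> //=; apply: mem_nth; rewrite size_tuple.
apply/span_subvP => _ /allpairsP[[u w] /= [uU wW ->]].
by apply: H; apply: vbasis_mem.
Qed.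

Lemma lie_brv_ind (U W X : {vspace V}) u x :
  (forall a b, a \in U -> b \in W -> br u (br a b) \in X) ->
  x \in lie_brv br U W -> br u x \in X.
Proof.
move=> H; have lS : linear (br u) by case: brL.
pose f := linfun (HB.pack_for {linear V -> V} (br u) (GRing.isLinear.Build _ _ _ _ _ lS)).
have : (lie_brv br U W <= f @^-1: X)%VS.
  by apply/lie_brvP => a b aU bW; rewrite -memv_preim lfunE H.
by move=> /subvP K /K; rewrite -memv_preim lfunE.
Qed.

Lemma mem_lie_brv (U W : {vspace V}) u w :
  u \in U -> w \in W -> br u w \in lie_brv br U W.
Proof. by move=> uU wW; apply: (lie_brvP U W _).1 => //. Qed.

Lemma lie_brvS (U U' W W' : {vspace V}) : (U <= U')%VS -> (W <= W')%VS ->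
  (lie_brv br U W <= lie_brv br U' W')%VS.
Proof.
move=> /subvP UU /subvP WW; apply/lie_brvP => u w uU wW.
by apply: mem_lie_brv; [apply: UU|apply: WW].
Qed.

Lemma lie_solvableS (U W : {vspace V}) :
  (U <= W)%VS -> lie_solvable br W -> lie_solvable br U.
Proof.
move=> UW [k Wk]; exists k; apply/eqP; rewrite -subv0 -Wk.
by elim: k {Wk} => //= k IH; apply: lie_brvS.
Qed.

Lemma lie_solvable_derived (U : {vspace V}) :
  lie_solvable br (lie_brv br U U) -> lie_solvable br U.
Proof. by move=> [k Uk]; exists k.+1; rewrite iterSr. Qed.

Lemma lie_solvable_neq (U : {vspace V}) :
  lie_solvable br U -> (U <= lie_brv br U U)%VS -> U = 0%VS.
Proof.
move=> [k Uk] UD; apply/eqP; rewrite -subv0 -Uk.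
elim: k {Uk} => //= k IH; apply: subv_trans UD _; exact: lie_brvS.
Qed.

End LieBasics.

Section SemisimpleLeibniz.
Variables (F : fieldType) (n : nat).
Local Notation V := 'rV[F]_n.
Variable br : V -> V -> V.

(* The left centre of a Leibniz algebra is an abelian ideal, and it contains
   all the symmetrised brackets. *)
Lemma lie_bracket_of_leibniz :
  (forall x, linear (br x)) -> (forall y, linear (br^~ y)) ->
  (forall u v w, br u (br v w) = br (br u v) w + br v (br u w)) ->
  lie_semisimple br -> lie_bracket br.
Proof.
move=> lr ll lie_br_leibniz ss.
pose mx u : 'M[F]_n := lin1_mx (br u).
have mxbr u v : v *m mx u = br u v.
  pose f := HB.pack_for {linear V -> V} (br u) (GRing.isLinear.Build _ _ _ _ _ (lr u)).
  exact: (mul_rV_lin1 f).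
have lmx : linear mx.
  move=> s u v; apply/row_matrixP => i; rewrite !rowE mulmxDr -scalemxAr !mxbr; exact: ll.
pose fm := linfun (HB.pack_for {linear V -> 'M[F]_n} mx (GRing.isLinear.Build _ _ _ _ _ lmx)).
pose Z := lker fm.
have ZP z : reflect (forall y, br z y = 0) (z \in Z).
  rewrite memv_ker lfunE /=; apply: (iffP eqP) => [E y|H]; first by rewrite -mxbr E mulmx0.
  by apply/row_matrixP => i; rewrite rowE mxbr H row0.
have br0 x : br x 0 = 0.
  pose f := HB.pack_for {linear V -> V} (br x) (GRing.isLinear.Build _ _ _ _ _ (lr x)).
  exact: (linear0 f).
have Z0 : Z = 0%VS.
  apply: ss.
    split; first exact: subvf.
    apply/span_subvP => _ /allpairsP[[x z] /= [_ /vbasis_mem/ZP zZ ->]].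
    apply/ZP => y; have := lie_br_leibniz x z y.
    by rewrite !zZ br0 addr0 => /esym.
  exists 1%N => /=; apply/eqP; rewrite -subv0; apply/span_subvP.
  move=> _ /allpairsP[[x z] /= [/vbasis_mem/ZP xZ _ ->]].
  by rewrite xZ mem0v.
split=> // x y.
apply/eqP; rewrite -addr_eq0 -memv0 -Z0; apply/ZP => z.
have -> : br (br x y + br y x) z = br (br x y) z + br (br y x) z.
  by have := ll z 1 (br x y) (br y x); rewrite /= !scale1r.
have := lie_br_leibniz y x z; rewrite (lie_br_leibniz x y z) addrA.
by move=> /esym/(canRL (addrK _)); rewrite subrr addrC.
Qed.

End SemisimpleLeibniz.

(** * Lie's theorem *)

Section CommonEigenvector.
Variables (F : numClosedFieldType) (n : nat).
Local Notation V := 'rV[F]_n.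
Variable br : V -> V -> V.
Hypothesis brL : lie_bracket br.

(* The trace of a commutator vanishes on the span of w, wA, wA^2, ..., on which
   [A, rho y] acts with the single eigenvalue lam. *)
Lemma commutator_eigenvalue0 m (A : 'M[F]_m) (w : 'rV[F]_m) (T : Type)
    (rho : T -> 'M[F]_m) (lam : T -> F) (b : T -> T) :
  w != 0 -> (forall y, w *m rho y = lam y *: w) ->
  (forall y, rho (b y) = rho y *m A - A *m rho y) ->
  forall y, lam (b y) = 0.
Proof.
move=> w0 wlam rhob y.
pose N := fix N (i : nat) : 'M[F]_m := if i is j.+1 then (N j + w *m A ^+ j)%MS else 0.
have NS i : (N i <= N i.+1)%MS by exact: addsmxSl.
have wN i : (w *m A ^+ i <= N i.+1)%MS by exact: addsmxSr.
have NA i : (N i *m A <= N i.+1)%MS.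
  elim: i => [|i IH]; first by rewrite mul0mx sub0mx.
  rewrite /= addsmxMr addsmx_sub (submx_trans IH) ?addsmxSl //=.
  by rewrite -mulmxA -[_ *m A]exprSr addsmxSr.
(* In the generators w, wA, wA^2, ... every [rho x] is triangular with [lam x] all along the
   diagonal. *)
have NP i x (v : 'rV[F]_m) : (v <= N i.+1)%MS -> (v *m (rho x - (lam x)%:M) <= N i)%MS.
  elim: i x v => [|i IH] x v.
    rewrite /= adds0mx expr0 mulmx1 => /sub_rVP[a ->].
    by rewrite -scalemxAl mulmxBr wlam mul_mx_scalar subrr scaler0 sub0mx.
  move=> /sub_addsmxP[[u1 u2] /= ->]; rewrite mulmxDl addmx_sub //.
    by apply: submx_trans (NS i); apply: IH; rewrite submxMl.
  have [a ->] : exists a, u2 *m (w *m A ^+ i.+1) = a *: (w *m A ^+ i.+1).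
    by exists (u2 0 0); rewrite {1}[u2]mx11_scalar mul_scalar_mx.
  rewrite -scalemxAl scalemx_sub // exprSr -[A ^+ i * A]/(A ^+ i *m A).
  set u := w *m A ^+ i; rewrite mulmxA -/u.
  have -> : u *m A *m (rho x - (lam x)%:M)
     = u *m (rho x - (lam x)%:M) *m A - (u *m (rho (b x) - (lam (b x))%:M)
         + lam (b x) *: u).
    rewrite [in u *m (_ - (lam (b x))%:M)]mulmxBr mul_mx_scalar subrK rhob.
    rewrite !mulmxBr !mulmxBl !mul_mx_scalar -!scalemxAl !mulmxA.
    by rewrite opprB [RHS]addrC addrA subrK.
  have H z : (u *m (rho z - (lam z)%:M) <= N i)%MS by apply: IH; exact: wN.
  rewrite -[(N i + u)%MS]/(N i.+1) addmx_sub //.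
    by apply: submx_trans (NA i); rewrite submxMr.
  rewrite eqmx_opp addmx_sub ?scalemx_sub ?wN //.
  exact: submx_trans (H _) (NS _).
(* The increasing ranks are bounded by m, so the chain becomes stationary. *)
have [i Ni] : exists i, (N i.+1 <= N i)%MS.
  have [/existsP[i Ni]|/existsPn H] := boolP [exists i : 'I_m.+1, (N i.+1 <= N i)%MS].
    by exists i.
  have : forall i, (i <= m.+1)%N -> (i <= \rank (N i))%N.
    elim=> // i IH im; apply: leq_ltn_trans (IH (ltnW im)) _.
    rewrite ltn_neqAle mxrankS // andbT; apply: contraNneq (H (Ordinal im)) => /= e.
    by rewrite -(mxrank_leqif_sup (NS i)).2 e.
  by move=> /(_ _ (leqnn _)); rewrite leqNgt ltnS rank_leq_row.
have Nst z : stablemx (N i) (rho z).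
  rewrite -[rho z](subrK (lam z)%:M) mulmxDr addmx_sub ?mul_mx_scalar ?scalemx_sub //.
  case: i Ni => [|i] Ni; first by rewrite mul0mx sub0mx.
  by apply/row_subP => k; rewrite row_mul (submx_trans _ (NS _)) // NP ?row_sub.
have NstA : stablemx (N i) A by exact: submx_trans (NA i) Ni.
have N0 : \rank (N i) != 0.
  rewrite mxrank_eq0; apply: contraNneq w0 => Ni0.
  have : (w <= N i)%MS.
    apply: submx_trans Ni; elim: i {Ni0 Nst NstA} => [|i IH].
      by rewrite /= expr0 mulmx1 addsmxSr.
    exact: submx_trans IH (NS _).
  by rewrite Ni0 submx0.
have [k [E [pE [k0 EN pEK pE1]]]] : exists k (E : 'M[F]_(k, m)) (pE : 'M[F]_(m, k)),
    [/\ k != 0, (E <= N i)%MS, forall X, stablemx (N i) X -> E *m X *m pE *m E = E *m X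
     & E *m pE = 1%:M].
  exists (\rank (N i)), (row_base (N i)), (pinvmx (row_base (N i))); split => //.
  - by rewrite eq_row_base.
  - by move=> X NX; rewrite mulmxKpV // stablemx_row_base.
  - by rewrite -[LHS]mul1mx mulmxA mulmxKp // row_base_free.
pose r X := E *m X *m pE.
have rM X Y : stablemx (N i) X -> r (X *m Y) = r X *m r Y.
  by move=> NX; rewrite /r !mulmxA pEK.
have tr0 : \tr (r (rho (b y))) = 0.
  rewrite (_ : r (rho (b y)) = r (rho y) *m r A - r A *m r (rho y)); last first.
    by rewrite -!rM // /r rhob mulmxBr mulmxBl.
  by rewrite raddfB /= mxtrace_mulC subrr.
(* [C] is nilpotent on the stationary span, so the trace of [rho (b y)] there is also k times
   [lam (b y)], where k is the nonzero dimension. *)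
pose C := rho (b y) - (lam (b y))%:M.
have NC : stablemx (N i) C.
  by rewrite mulmxBr addmx_sub ?eqmx_opp ?mul_mx_scalar ?scalemx_sub ?Nst.
have rC j : r (C ^+ j) = r C ^+ j.
  elim: j => [|j IH]; last by rewrite !exprS -IH; exact: rM.
  by rewrite !expr0 /r mulmx1.
have Ck : r C ^+ i = 0.
  rewrite -rC /r (_ : E *m C ^+ i = 0) ?mul0mx //; apply/eqP; rewrite -submx0.
  elim: (i) (k) (E) EN => [|j IH] k' X XN.
    by rewrite expr0 mulmx1.
  rewrite exprS -[_ * _]/(C *m C ^+ j) mulmxA IH //.
  by apply/row_subP => l; rewrite row_mul NP // (submx_trans _ XN) ?row_sub.
have := mxtrace_nilpotent Ck.
have -> : r C = r (rho (b y)) - (lam (b y))%:M.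
  by rewrite /r mulmxBr mulmxBl mul_mx_scalar -scalemxAl pE1 scalemx1.
rewrite raddfB /= tr0 sub0r mxtrace_scalar => /eqP; rewrite oppr_eq0 -mulr_natr.
by rewrite mulf_eq0 pnatr_eq0 (negbTE k0) orbF => /eqP.
Qed.

(** Induction on the dimension of b. An ideal of codimension one has a common eigenvector; its
    weight space is stable under the missing vector x because the weight vanishes on all [x, y], and
    x has an eigenvector inside it. The order of the products in the hypothesis on [rho] is that of
    right actions. *)
Lemma lie_common_eigenvector m (rho : V -> 'M[F]_m) (b : {vspace V}) :
  (0 < m)%N -> lie_subalgebra br b -> lie_solvable br b -> linear rho ->
  (forall x y, x \in b -> y \in b ->
    rho (br x y) = rho y *m rho x - rho x *m rho y) ->
  exists2 w : 'rV[F]_m, w != 0 & forall x, x \in b -> exists a, w *m rho x = a *: w.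
Proof.
move=> m0 + + lrho; have [d] := ubnP (\dim b); elim: d b => // d IH b.
have rhoD x y : rho (x + y) = rho x + rho y by rewrite -{1}(scale1r x) lrho scale1r.
have rho0 : rho 0 = 0 by rewrite -[LHS](addrK (rho 0)) -rhoD addr0 subrr.
have rhoZ a x : rho (a *: x) = a *: rho x by rewrite -{1}(addr0 (a *: x)) lrho rho0 addr0.
rewrite ltnS => bd bb bs brho.
have [b0|/eqP bn0] := eqVneq b 0%VS.
  exists (delta_mx 0 (Ordinal m0)).
    by apply/eqP => /matrixP/(_ 0 (Ordinal m0)); rewrite !mxE !eqxx => /eqP; rewrite oner_eq0.
  by move=> x; rewrite b0 memv0 => /eqP ->; exists 0; rewrite rho0 mulmx0 scale0r.
pose c := lie_brv br b b.
have /subvPn[x xb xc] : ~~ (b <= c)%VS by apply/negP => /(lie_solvable_neq brL bs).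
(* [b0] is a hyperplane of b that contains [b, b] and misses x, hence an ideal. *)
pose e := (b :\: (c + <[x]>))%VS; pose b0 := (c + e)%VS.
have b0b : (b0 <= b)%VS by rewrite subv_add bb diffvSl.
have cxb : (c + <[x]> <= b)%VS by rewrite subv_add bb -memvE.
have xb0 : x \notin b0.
  apply: contra xc => /memv_addP[u uc [v ve xE]].
  have : v \in (e :&: (c + <[x]>))%VS.
    rewrite memv_cap ve -[v](addKr u) -xE addrC memvB ?(subvP (addvSr _ _) x) ?memv_line //.
    by rewrite (subvP (addvSl _ _) u).
  by rewrite capv_diff memv0 => /eqP v0; rewrite xE v0 addr0.
have bE : b = (b0 + <[x]>)%VS.
  rewrite -[LHS](addv_diff_cap b (c + <[x]>)) -/e (capv_idPr cxb).
  by rewrite /b0 addvA [(e + c)%VS]addvC.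
have cb0 : (c <= b0)%VS by exact: addvSl.
have b0sub : lie_subalgebra br b0 by apply: subv_trans cb0; exact: lie_brvS.
have db0 : (\dim b0 < d)%N.
  apply: leq_trans bd; rewrite ltn_neqAle dimvS // andbT.
  by apply: contra xb0; rewrite (dimv_leqif_sup b0b).2 => /subvP; apply.
have brho0 y z : y \in b0 -> z \in b0 -> rho (br y z) = rho z *m rho y - rho y *m rho z.
  by move=> /(subvP b0b) yb /(subvP b0b) zb; exact: brho.
have [w0 w0n w0e] := IH b0 db0 b0sub (lie_solvableS brL b0b bs) brho0.
have [i w0i] : exists i, w0 0 i != 0.
  apply/existsP; apply: contraNT w0n => /existsPn H; apply/eqP/rowP => i.
  by rewrite mxE; apply/eqP; have := H i; rewrite negbK.
(* Reading the weight off a nonzero coordinate of [w0] defines it on all of V and makes it visibly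
   linear. *)
pose lam y := (w0 *m rho y) 0 i / w0 0 i.
have lamE y : y \in b0 -> w0 *m rho y = lam y *: w0.
  by move=> /w0e[a E]; rewrite /lam E mxE mulfK.
have bxb0 y : y \in b0 -> br x y \in b0.
  by move=> /(subvP b0b) yb; apply: (subvP cb0); exact: mem_lie_brv.
have lam0 y : y \in b0 -> lam (br x y) = 0.
  (* [commutator_eigenvalue0] needs an operation y -> [x, y] on its whole index type, hence the
     subtype of vectors of [b0]. *)
  move=> yb0; pose T := {y | y \in b0}.
  pose bx (t : T) : T := exist _ (br x (sval t)) (bxb0 _ (svalP t)).
  have := @commutator_eigenvalue0 m (rho x) w0 T (fun t => rho (sval t))
    (fun t => lam (sval t)) bx w0n (fun t => lamE _ (svalP t)) _ (exist _ y yb0).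
  by apply=> -[z zb]; rewrite /= brho // (subvP b0b).
pose W := (\bigcap_(i < \dim b0) eigenspace (rho (vbasis b0)`_i) (lam (vbasis b0)`_i))%MS.
have lamD y z : lam (y + z) = lam y + lam z.
  by rewrite /lam rhoD mulmxDr mxE mulrDl.
have lamZ a y : lam (a *: y) = a * lam y.
  by rewrite /lam rhoZ -scalemxAr mxE mulrA.
have WP (v : 'rV_m) : (v <= W)%MS <-> forall y, y \in b0 -> v *m rho y = lam y *: v.
  split=> [/sub_bigcapmxP vW y yb0|H].
    rewrite (coord_vbasis yb0).
    elim/big_rec: _ => [|j z _ IHz].
      by rewrite /lam rho0 !mulmx0 mxE mul0r scale0r.
    rewrite rhoD mulmxDr IHz lamD scalerDl rhoZ -scalemxAr lamZ -scalerA.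
    by congr (_ *: _ + _); apply/eigenspaceP/vW.
  apply/sub_bigcapmxP => j _; apply/eigenspaceP/H/vbasis_mem/mem_nth.
  by rewrite size_tuple.
have Wx : stablemx W (rho x).
  apply/row_subP => j; rewrite row_mul; apply/WP => y yb0.
  have vW : (row j W <= W)%MS by exact: row_sub.
  have /WP vWP := vW.
  have := brho x y xb (subvP b0b _ yb0) => /(congr1 (mulmx (row j W))).
  rewrite mulmxBr (vWP (br x y)) ?bxb0 // lam0 // scale0r !mulmxA vWP //.
  by rewrite -scalemxAl => /esym/eqP; rewrite subr_eq0 => /eqP.
have W0 : (0 < \rank W)%N.
  rewrite lt0n mxrank_eq0; apply: contraNneq w0n => W0.
  have : (w0 <= W)%MS by apply/WP => y yb; exact: lamE.
  by rewrite W0 submx0.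
have [a /eigenvalueP[v vE vn]] := eigenvalue_closed (restrictmx W (rho x)) W0.
exists (v *m row_base W); first by rewrite mulmx_free_eq0 ?row_base_free.
have vW : (v *m row_base W <= W)%MS by rewrite mulmx_sub // eq_row_base.
move=> y; rewrite bE => /memv_addP[u ub0 [_ /vlineP[k ->] ->]].
exists (lam u + k * a); rewrite rhoD rhoZ mulmxDr -scalemxAr scalerDl.
congr (_ + _); first by move/WP: vW; apply.
have rbW : row_base W *m rho x *m pinvmx (row_base W) *m row_base W = row_base W *m rho x.
  by rewrite mulmxKpV // stablemx_row_base.
rewrite -scalerA; congr (_ *: _).
by rewrite -mulmxA -rbW mulmxA -[row_base W *m _ *m pinvmx _]/(conjmx (row_base W) (rho x)) vE -scalemxAl.
Qed.

End CommonEigenvector.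

Section RelativeLie.
Variables (F : numClosedFieldType) (n : nat).
Local Notation V := 'rV[F]_n.
Variable br : V -> V -> V.
Hypothesis brL : lie_bracket br.

(** Lie's theorem for the b-module W / U. The quotient is modelled by coordinates on a complement
    [W1], with [E] the inclusion and [P] the projection; compressing ad y to it is compatible with
    products because U and W are b-stable. *)
Lemma lie_relative_eigenvector (b U W : {vspace V}) :
  lie_subalgebra br b -> lie_solvable br b ->
  (U <= W)%VS -> ~~ (W <= U)%VS ->
  (lie_brv br b U <= U)%VS -> (lie_brv br b W <= W)%VS ->
  exists2 X, X \in W & X \notin U /\
    forall y, y \in b -> exists a, br y X - a *: X \in U.
Proof.
move=> bb bs UW WU /(lie_brvP brL) bU /(lie_brvP brL) bW.
pose W1 := (W :\: U)%VS.
have W1U : (W1 :&: U = 0)%VS by exact: capv_diff.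
have W1Ue : (W1 + U)%VS = W by rewrite addv_diff; apply/addv_idPl.
have m0 : (0 < \dim W1)%N by rewrite lt0n dimv_eq0 diffv_eq0.
pose B := vbasis W1; pose E : 'M[F]_(\dim W1, n) := \matrix_i B`_i.
pose prj w : 'rV[F]_(\dim W1) := \row_i coord B i (daddv_pi W1 U w).
have lprj : linear prj.
  by move=> a u v; apply/rowP => i; rewrite !mxE !linearP.
pose pr := HB.pack_for {linear V -> 'rV[F]_(\dim W1)} prj (GRing.isLinear.Build _ _ _ _ _ lprj).
pose P := lin1_mx pr; have PE w : w *m P = prj w by exact: mul_rV_lin1 pr w.
have embE z : z *m E = \sum_i z 0 i *: B`_i.
  by rewrite mulmx_sum_row; apply: eq_bigr => i _; rewrite rowK.
have EW1 z : z *m E \in W1.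
  by rewrite embE rpred_sum // => i _; rewrite rpredZ // vbasis_mem // mem_nth // size_tuple.
have P_U u : u \in U -> u *m P = 0.
  move=> uU; rewrite PE; apply/rowP => i; rewrite !mxE.
  have : daddv_pi W1 U u \in (W1 :&: U)%VS.
    rewrite memv_cap memv_pi -[X in X \in _](addrK (daddv_pi U W1 u)).
    rewrite daddv_pi_add ?memvB ?memv_pi //.
    by rewrite W1Ue (subvP UW).
  by rewrite W1U memv0 => /eqP ->; rewrite linear0.
have EP : E *m P = 1%:M.
  apply/row_matrixP => i; rewrite row_mul rowK PE row1; apply/rowP => j.
  rewrite !mxE daddv_pi_id //; last by rewrite vbasis_mem // mem_nth // size_tuple.
  by rewrite coord_free ?(basis_free (vbasisP _)) // eq_sym.
have PEW w : w \in W -> w *m P *m E - w \in U.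
  rewrite -W1Ue => wW; have wE := daddv_pi_add W1U wW.
  set p := daddv_pi W1 U w in wE; set q := daddv_pi U W1 w in wE.
  have pW1 : p \in W1 by exact: memv_pi.
  have qU : q \in U by exact: memv_pi.
  have pE : p *m P *m E = p.
    rewrite PE embE [RHS](coord_vbasis pW1).
    by apply: eq_bigr => i _; rewrite mxE daddv_pi_id.
  by rewrite -wE !mulmxDl (P_U q) // mul0mx addr0 pE opprD addNKr memvN.
pose rho y := E *m adm br y *m P.
have lrho : linear rho.
  move=> a x y; rewrite /rho (admD brL) (admZ brL) mulmxDr mulmxDl.
  by rewrite -scalemxAr -scalemxAl.
have Eb y z : y \in b -> z *m E *m adm br y \in W.
  move=> yb; rewrite (mul_adm brL) bW //.
  by rewrite (subvP (diffvSl _ U) _ (EW1 z)).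
have rhoM x y : x \in b -> y \in b -> rho y *m rho x = E *m adm br y *m adm br x *m P.
  move=> xb yb; apply/row_matrixP => i; rewrite !rowE /rho !mulmxA.
  set w := delta_mx 0 i *m E *m adm br y.
  apply/eqP; rewrite -subr_eq0 -!mulmxBl; apply/eqP/P_U.
  by rewrite (mul_adm brL) bU // PEW // Eb.
have brho x y : x \in b -> y \in b -> rho (br x y) = rho y *m rho x - rho x *m rho y.
  move=> xb yb; rewrite !rhoM // /rho (adm_br brL).
  by rewrite mulmxBr mulmxBl !mulmxA.
have [w w0 we] := lie_common_eigenvector brL m0 bb bs lrho brho.
exists (w *m E); first by rewrite (subvP (diffvSl _ U)) ?EW1.
split.
  apply: contra w0 => wU; have := P_U _ wU.
  by rewrite -mulmxA EP mulmx1 => ->.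
move=> y yb; have [a ya] := we y yb; exists a.
have -> : a *: (w *m E) = w *m E *m adm br y *m P *m E.
  by rewrite scalemxAl -ya /rho !mulmxA.
rewrite -(mul_adm brL) -opprB memvN PEW //; exact: Eb.
Qed.

Lemma lie_derived_ideal (b : {vspace V}) : lie_subalgebra br b ->
  (lie_brv br b (lie_brv br b b) <= lie_brv br b b)%VS.
Proof. by move=> bb; exact: lie_brvS. Qed.

(* By Lie's theorem b stabilises a full flag, which [b, b] lowers. *)
Lemma lie_derived_nil (b : {vspace V}) :
  lie_subalgebra br b -> lie_solvable br b ->
  exists k, iter k (lie_brv br (lie_brv br b b)) fullv = 0%VS.
Proof.
move=> bb bs; set T := lie_brv br (lie_brv br b b).
(* U is a b-stable subspace on which iterated brackets with [b, b] already vanish. It is enlarged by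
   one relative eigenvector at a time until it is everything. *)
suff H (U : {vspace V}) : (lie_brv br b U <= U)%VS -> (exists k, iter k T U = 0%VS) ->
    exists k, iter k T fullv = 0%VS.
  apply: (H 0%VS); last by exists 0.
  by apply/(lie_brvP brL) => u w _; rewrite memv0 => /eqP ->; rewrite lie_br0 ?mem0v.
have [d] := ubnP (\dim (U^C)%VS); elim: d U => // d IH U.
rewrite ltnS => dU bU [k Uk]; have [fU|fU] := boolP (fullv <= U)%VS.
  by exists k; rewrite (_ : fullv = U) //; apply/eqP; rewrite eqEsubv fU subvf.
have [|X _ [XU Xe]] := lie_relative_eigenvector bb bs (subvf U) fU bU.
  exact: subvf.
pose U' := (U + <[X]>)%VS.
have UU' : (U <= U')%VS by exact: addvSl.
have XU' : X \in U' by rewrite (subvP (addvSr _ _)) ?memv_line.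
have bU' : (lie_brv br b U' <= U')%VS.
  apply/(lie_brvP brL) => y _ yb /memv_addP[u uU [_ /vlineP[a ->] ->]].
  rewrite lie_brDr // lie_brZr // memvD ?rpredZ //.
    by rewrite (subvP UU') // (subvP bU) // mem_lie_brv.
  have [c yX] := Xe y yb; rewrite -(subrK (c *: X) (br y X)) memvD ?rpredZ //.
  exact: (subvP UU').
apply: (IH U') => //.
  apply: leq_trans dU; rewrite !dimv_compl ltn_sub2l //.
    rewrite ltn_neqAle dimvS ?subvf // andbT; apply: contra fU => /eqP e.
    by rewrite -(dimv_leqif_sup (subvf U)).2 e.
  rewrite ltn_neqAle dimvS // andbT (dimv_leqif_sup UU').2.
  by apply: contra XU => /subvP/(_ _ XU').
exists k.+1; rewrite iterSr; apply/eqP; rewrite -subv0 -Uk.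
have iterT Y Z : (Y <= Z)%VS -> (iter k T Y <= iter k T Z)%VS.
  by move=> YZ; elim: (k) => //= j IHj; apply: lie_brvS (subvv _) _.
apply: iterT; apply/(lie_brvP brL) => z _ zD /memv_addP[u uU [_ /vlineP[a ->] ->]].
have bUu y w : y \in b -> w \in U -> br y w \in U.
  by move=> yb wU; rewrite (subvP bU) // mem_lie_brv.
have zb : z \in b by exact: (subvP bb).
rewrite lie_brDr // lie_brZr // memvD ?rpredZ ?(bUu _ u) //.
rewrite (lie_brC brL) memvN; apply: (lie_brv_ind brL) zD => x y xb yb.
rewrite (lie_brC brL) memvN.
have -> : br (br x y) X = br x (br y X) - br y (br x X) by rewrite lie_jacobi ?addrK.
(* Modulo U both x and y act on X by scalars, and these commute, so [x, y] sends X into U. *)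
have [p pU] := Xe x xb; have [q qU] := Xe y yb.
set u1 := br x X - p *: X in pU; set u2 := br y X - q *: X in qU.
have -> : br x (br y X) - br y (br x X) = br x u2 - br y u1 + (q *: u1 - p *: u2).
  rewrite /u1 /u2 !(lie_brDr brL) !(lie_brNr brL) !(lie_brZr brL) !scalerBr !scalerA.
  rewrite [p * q]mulrC; move: (br x (br y X)) (br y (br x X)) (q *: _) (p *: _) ((q * p) *: X).
  by move=> A B C D' E; apply/rowP => i; rewrite !mxE; ring.
by rewrite memvD ?memvB ?rpredZ ?bUu.
Qed.

End RelativeLie.

(** * Parabolic subalgebras of a compact form *)

Section KillingForm.
Variables (F : fieldType) (n : nat).
Local Notation V := 'rV[F]_n.
Variable br : V -> V -> V.
Hypothesis brL : lie_bracket br.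
Local Notation B := (killing br).

Lemma killingE x y : B x y = \tr (adm br x *m adm br y). Proof. by []. Qed.

Lemma killingC x y : B x y = B y x.
Proof. by rewrite !killingE mxtrace_mulC. Qed.

Lemma killingDl x y z : B (x + y) z = B x z + B y z.
Proof. by rewrite !killingE admD // mulmxDl raddfD. Qed.

Lemma killingZl a x y : B (a *: x) y = a * B x y.
Proof. by rewrite !killingE admZ // -scalemxAl linearZ. Qed.

Lemma killing0l x : B 0 x = 0.
Proof. by rewrite -(scale0r 0) killingZl mul0r. Qed.

Lemma killingNl x y : B (- x) y = - B x y.
Proof. by rewrite -scaleN1r killingZl mulN1r. Qed.

Lemma killingDr x y z : B x (y + z) = B x y + B x z.
Proof. by rewrite ![B x _]killingC killingDl. Qed.

Lemma killingZr a x y : B x (a *: y) = a * B x y.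
Proof. by rewrite ![B x _]killingC killingZl. Qed.

Lemma killing_inv x y z : B (br x y) z = B x (br y z).
Proof.
rewrite !killingE !adm_br // mulmxBl mulmxBr !raddfB /=.
by rewrite [in X in X - _]mxtrace_mulC !mulmxA; congr (_ - _); rewrite mxtrace_mulC mulmxA.
Qed.

(** The functional B (-, y) is written as multiplication by a column, so that orthogonals are
    intersections of kernels and hence of type [{vspace V}]. *)
Definition killing_ann (y : V) : {vspace V} :=
  lker (linfun (mulmxr (\col_j B (delta_mx 0 j) y)) : 'Hom(V, 'M[F]_1)).

Definition kperp (U : {vspace V}) : {vspace V} :=
  (\bigcap_(i < \dim U) killing_ann (nth 0%R (vbasis U) i))%VS.

Lemma killing_coord x y : x *m (\col_j B (delta_mx 0 j) y) = (B x y)%:M.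
Proof.
apply/rowP => i; rewrite ord1 !mxE eqxx mulr1n.
rewrite [in RHS](row_sum_delta x); elim/big_rec2: _ => [|j u v _ ->].
  by rewrite killing0l.
by rewrite mxE killingDl killingZl.
Qed.

Lemma kperpP (U : {vspace V}) x :
  reflect (forall y, y \in U -> B x y = 0) (x \in kperp U).
Proof.
apply: (iffP idP) => [xU y yU|H].
  rewrite (coord_vbasis yU); elim/big_rec: _ => [|i z _ IH].
    by rewrite killingC killing0l.
  rewrite killingDr killingZr IH addr0.
  have /subv_bigcapP/(_ i isT) : (<[x]> <= kperp U)%VS by rewrite -memvE.
  rewrite -memvE memv_ker lfunE /= killing_coord => /eqP/(congr1 (fun M : 'M[F]_1 => M 0 0)).
  by rewrite !mxE eqxx mulr1n => ->; rewrite mulr0.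
rewrite memvE; apply/subv_bigcapP => i _; rewrite -memvE memv_ker lfunE /=.
rewrite killing_coord H ?raddf0 //; apply/vbasis_mem/mem_nth; by rewrite size_tuple.
Qed.

Lemma kperpS (U W : {vspace V}) : (U <= W)%VS -> (kperp W <= kperp U)%VS.
Proof.
move=> /subvP UW; apply/subvP => x /kperpP H; apply/kperpP => y /UW; exact: H.
Qed.

Lemma kperp_stable (p U : {vspace V}) :
  (lie_brv br p U <= U)%VS -> (lie_brv br p (kperp U) <= kperp U)%VS.
Proof.
move=> /(lie_brvP brL) pU; apply/(lie_brvP brL) => y x yp /kperpP xU.
apply/kperpP => u uU.
by rewrite lie_brC // killingNl killing_inv xU ?oppr0 // pU.
Qed.

(** Nondegeneracy represents the functional y -> tr (S ad y) as B (z, y). The difference E of S and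
    ad z is a derivation with tr (E ad y) = 0 for all y. Since ad (E x) is a commutator of ad x and
    E, B (E x, w) equals tr (E ad [x, w]) = 0. *)
Lemma derivation_inner (S : 'M[F]_n) :
  (forall x, (forall y, B x y = 0) -> x = 0) ->
  (forall x y, br x y *m S = br (x *m S) y + br x (y *m S)) ->
  exists z, S = adm br z.
Proof.
move=> nondeg dS.
pose K : 'M[F]_n := \matrix_(i, j) B (delta_mx 0 i) (delta_mx 0 j).
have KE (x : V) j : (x *m K) 0 j = B x (delta_mx 0 j).
  have := killing_coord x (delta_mx 0 j) => /matrixP/(_ 0 0).
  by rewrite !mxE eqxx mulr1n => <-; apply: eq_bigr => i _; rewrite !mxE.
have uK : K \in unitmx.
  rewrite -row_free_unit -kermx_eq0; apply/eqP/row_matrixP => i; rewrite row0.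
  apply: nondeg => y; rewrite (row_sum_delta y).
  elim/big_rec: _ => [|j u _ IH]; first by rewrite killingC killing0l.
  rewrite killingDr killingZr IH addr0 -KE -row_mul mulmx_ker row0 mxE mulr0 //.
pose f : V := \row_j \tr (S *m adm br (delta_mx 0 j)).
pose z := f *m invmx K.
have zE y : B z y = \tr (S *m adm br y).
  rewrite (row_sum_delta y); elim/big_rec: _ => [|j u _ IH].
    by rewrite killingC killing0l adm0 // mulmx0 raddf0.
  rewrite killingDr killingZr IH admD // admZ // mulmxDr -scalemxAr raddfD /= mxtraceZ.
  by rewrite -KE /z mulmxKV // mxE.
exists z; set E := S - adm br z.
have trE y : \tr (E *m adm br y) = 0.
  by rewrite mulmxBl raddfB /= -zE subrr.
have dE x y : br x y *m E = br (x *m E) y + br x (y *m E).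
  rewrite !mulmxBr dS !mul_adm // lie_jacobi // (lie_brDl brL) (lie_brDr brL).
  by rewrite (lie_brNl brL) (lie_brNr brL) opprD addrACA.
suff : E = 0 by move/eqP; rewrite subr_eq0 => /eqP.
move: E trE dE => E trE dE.
have aE y : adm br (y *m E) = adm br y *m E - E *m adm br y.
  apply/row_matrixP => i; rewrite !rowE mulmxBr !mulmxA !mul_adm // dE.
  by rewrite addrK.
apply/row_matrixP => i; rewrite row0 rowE; apply: nondeg => w.
rewrite killingE aE mulmxBl raddfB /= -mulmxA mxtrace_mulC -mulmxA -[in X in _ - X]mulmxA.
by rewrite -raddfB /= -mulmxBr -adm_br.
Qed.

End KillingForm.

Lemma lie_brxx (F : numFieldType) n (br : 'rV[F]_n -> 'rV[F]_n -> 'rV[F]_n) :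
  lie_bracket br -> forall x, br x x = 0.
Proof.
move=> brL x; have /eqP := lie_brC brL x x; rewrite -subr_eq0 opprK -mulr2n.
by rewrite -scaler_nat scaler_eq0 pnatr_eq0 => /eqP.
Qed.

Section Parabolic.
Variables (F : numClosedFieldType) (n : nat).
Local Notation V := 'rV[F]_n.
Variable br : V -> V -> V.
Hypothesis brL : lie_bracket br.
Local Notation B := (killing br).
Local Notation cj := (map_mx Num.conj).

Hypothesis cj_br : forall x y : V, cj (br x y) = br (cj x) (cj y).
Hypothesis herm_gt0 : forall x : V, x != 0 -> 0 < - B x (cj x).

Lemma cjK (x : V) : cj (cj x) = x.
Proof. by apply/rowP => i; rewrite !mxE conjCK. Qed.

Lemma cjD (x y : V) : cj (x + y) = cj x + cj y.
Proof. by apply/rowP => i; rewrite !mxE rmorphD. Qed.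

Lemma cjZ a (x : V) : cj (a *: x) = a^* *: cj x.
Proof. by apply/rowP => i; rewrite !mxE rmorphM. Qed.

Lemma cj0 : cj (0 : V) = 0.
Proof. by apply/rowP => i; rewrite !mxE conjC0. Qed.

Lemma adm_cj x : adm br (cj x) = map_mx Num.conj (adm br x).
Proof.
apply/row_matrixP => i; rewrite !rowE mul_adm //.
have -> : (delta_mx 0 i : V) *m map_mx Num.conj (adm br x) = cj ((delta_mx 0 i : V) *m adm br x).
  rewrite map_mxM; congr (_ *m _); apply/rowP => j.
  by rewrite !mxE rmorph_nat.
rewrite mul_adm // cj_br; congr (br _ _); apply/rowP => j; by rewrite !mxE rmorph_nat.
Qed.

Lemma killing_cj x y : B (cj x) (cj y) = (B x y)^*.
Proof.
rewrite !killingE !adm_cj -map_mxM /mxtrace rmorph_sum.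
by apply: eq_bigr => i _; rewrite mxE.
Qed.

Lemma killing_nondeg x : (forall y, B x y = 0) -> x = 0.
Proof.
move=> H; apply/eqP; apply: contraT => /herm_gt0.
by rewrite H oppr0 ltxx.
Qed.

Lemma killing_cj_eq0 x : B x (cj x) = 0 -> x = 0.
Proof.
move=> H; apply/eqP; apply: contraT => /herm_gt0.
by rewrite H oppr0 ltxx.
Qed.

Definition cjv (U : {vspace V}) : {vspace V} := <<[seq cj u | u <- vbasis U]>>%VS.

Lemma mem_cjv (U : {vspace V}) x : (x \in cjv U) = (cj x \in U).
Proof.
have H (W : {vspace V}) y : y \in cjv W -> cj y \in W.
  move=> /coord_span ->; elim/big_rec: _ => [|i z _ IH]; first by rewrite cj0 mem0v.
  rewrite cjD cjZ memvD ?rpredZ //.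
  have /mapP[u uW ->] : (map_tuple cj (vbasis W))`_i \in [seq cj u | u <- vbasis W].
    by apply: mem_nth; rewrite size_tuple.
  by rewrite cjK vbasis_mem.
apply/idP/idP; first exact: H.
move=> xU; rewrite -[x]cjK; move: (cj x) xU => {}x /coord_vbasis ->.
elim/big_rec: _ => [|i z _ IH]; first by rewrite cj0 mem0v.
rewrite cjD cjZ memvD ?rpredZ //; apply/memv_span/map_f/mem_nth; by rewrite size_tuple.
Qed.

(** The orthogonal for the Hermitian product, obtained as the Killing orthogonal of the conjugate
    subspace. *)
Definition hperp (U : {vspace V}) := kperp br (cjv U).

Lemma hperpP (U : {vspace V}) x :
  reflect (forall y, y \in U -> B x (cj y) = 0) (x \in hperp U).
Proof.
apply: (iffP (kperpP brL _ _)) => H y yU; last by rewrite -[y]cjK H // -mem_cjv.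
by apply: H; rewrite mem_cjv cjK.
Qed.

Lemma capv_hperp (U : {vspace V}) : (U :&: hperp U = 0)%VS.
Proof.
apply/eqP; rewrite -subv0; apply/subvP => x; rewrite memv_cap memv0 => /andP[xU /hperpP H].
by rewrite (killing_cj_eq0 (H x xU)).
Qed.

(** The intersection is trivial by positivity, and [hperp U] is the kernel of a map into a space of
    dimension at most that of U. *)
Lemma addv_hperp (U : {vspace V}) : (U + hperp U = fullv)%VS.
Proof.
apply/eqP; rewrite eqEdim subvf dimv_disjoint_sum ?capv_hperp //.
rewrite /hperp /kperp; set W := cjv U.
have dW : (\dim W <= \dim U)%N.
  by rewrite (leq_trans (dim_span _)) // size_map size_tuple.
pose f := linfun (mulmxr (\matrix_(j < n, i < \dim W) B (delta_mx 0 j) (nth 0%R (vbasis W) i))) : 'Hom(V, 'rV[F]_(\dim W)).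
have <- : lker f = (\bigcap_(i < \dim W) killing_ann br (nth 0%R (vbasis W) i))%VS.
  apply/vspaceP => x; apply/idP/idP.
    rewrite memv_ker lfunE /= => /eqP H; rewrite memvE; apply/subv_bigcapP => i _.
    rewrite -memvE memv_ker lfunE /=; apply/eqP/rowP => j; rewrite ord1.
    move/rowP/(_ i): H; rewrite !mxE => H.
    by rewrite -[RHS]H; apply: eq_bigr => k _; rewrite !mxE.
  rewrite memvE => /subv_bigcapP H; rewrite memv_ker lfunE /=; apply/eqP/rowP => i.
  have := H i isT; rewrite -memvE memv_ker lfunE /= => /eqP/rowP/(_ 0).
  by rewrite !mxE => {}H; rewrite -[RHS]H; apply: eq_bigr => k _; rewrite !mxE.
have := limg_ker_dim f fullv; rewrite capfv => <-.
rewrite addnC leq_add2r; apply: leq_trans dW.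
by rewrite (leq_trans (dimvS (subvf _))) // dimvf /dim /= mul1n.
Qed.

(** Write x = u + w with u in U and w Hermitian-orthogonal to U. Then conj w is Killing-orthogonal
    to U, hence to x and to u, so B (w, conj w) = 0 and w = 0. *)
Lemma kperpK (U : {vspace V}) : kperp br (kperp br U) = U.
Proof.
apply/eqP; rewrite eqEsubv; apply/andP; split; apply/subvP => x xU; last first.
  by apply/(kperpP brL) => y /(kperpP brL) H; rewrite killingC H.
have /memv_addP[u uU [w wU xE]] : x \in (U + hperp U)%VS by rewrite addv_hperp memvf.
suff w0 : w = 0 by rewrite xE w0 addr0.
apply: killing_cj_eq0; have cw : cj w \in kperp br U.
  by apply/(kperpP brL) => y yU; rewrite -[y]cjK killing_cj (hperpP _ _ wU) ?conjC0.
have wE : w = x - u by rewrite xE addrC addKr.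
have H1 : B x (cj w) = 0 by exact: (kperpP brL _ _ xU).
have H2 : B u (cj w) = 0 by rewrite killingC (kperpP brL _ _ cw).
by rewrite {1}wE (killingDl brL) (killingNl brL) H1 H2 subr0.
Qed.

(** * The Killing orthogonal of a Borel subalgebra *)

Section Borel.
Variable b : {vspace V}.
Hypotheses (bb : lie_subalgebra br b) (bs : lie_solvable br b).
Local Notation D := (lie_brv br b b).

(** The iterated brackets of [b, b] with the whole algebra form a b-stable filtration ending at 0,
    and ad z lowers it. So the product with ad x is nilpotent and has trace 0. *)
Lemma killing_solvable x z : x \in b -> z \in D -> B x z = 0.
Proof.
move=> xb zD; have [k Tk] := lie_derived_nil brL bb bs.
apply: (@mxtrace_nilpotent _ _ _ k); apply/row_matrixP => i; rewrite row0 rowE.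
have bT : (lie_brv br b (iter k (lie_brv br D) fullv) <= iter k (lie_brv br D) fullv)%VS
   /\ delta_mx 0 i *m (adm br x *m adm br z) ^+ k \in iter k (lie_brv br D) fullv.
  elim: k {Tk} => [|k [IH1 IH2]] /=; first by rewrite subvf memvf.
  split.
    apply/(lie_brvP brL) => y w yb; apply: (lie_brv_ind brL) => d v dD vT.
    rewrite (lie_jacobi brL).
    apply: memvD; apply: mem_lie_brv => //.
      by apply: (subvP (lie_derived_ideal brL bb)); exact: mem_lie_brv.
    by apply: (subvP IH1); exact: mem_lie_brv.
  rewrite exprSr -[_ * _]/(_ *m _) mulmxA mulmxA !mul_adm //.
  by apply: mem_lie_brv => //; apply: (subvP IH1); exact: mem_lie_brv.
by have := bT.2; rewrite Tk memv0 => /eqP.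
Qed.

Lemma lie_brv_kperp : (D <= kperp br b)%VS.
Proof. by apply/subvP => z zD; apply/(kperpP brL) => x xb; rewrite killingC // killing_solvable. Qed.

Hypothesis bmax : forall b' : {vspace V}, lie_subalgebra br b' -> lie_solvable br b' ->
  (b <= b')%VS -> b' = b.

(** The form in which maximality of b is used: enlarge b by one vector. *)
Lemma borel_line X (L := (b + <[X]>)%VS) :
  (forall y, y \in b -> br y X \in L) ->
  (lie_subalgebra br L -> lie_solvable br L) -> X \in b.
Proof.
move=> bX Lsol; have Lsub : lie_subalgebra br L.
  apply/(lie_brvP brL) => _ _ /memv_addP[y yb [_ /vlineP[a ->] ->]] /memv_addP[z zb [_ /vlineP[c ->] ->]].
  rewrite (lie_brDl brL) !(lie_brDr brL) !(lie_brZl brL) !(lie_brZr brL) (lie_brxx brL).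
  rewrite !scaler0 addr0 (lie_brC brL X) !memvD ?rpredZ ?rpredN ?bX //.
  by rewrite (subvP (addvSl _ _)) // (subvP bb) // mem_lie_brv.
by rewrite -(bmax Lsub (Lsol Lsub) (addvSl _ _)) (subvP (addvSr _ _)) // memv_line.
Qed.

(** Otherwise Lie's theorem, relative to the intersection with b, yields X in the orthogonal but
    outside b for which L = b + <X> is a subalgebra. B vanishes on [L, L] x L, and Cartan's
    criterion makes L solvable, against maximality. *)
Lemma borel_kperp : (kperp br b <= b)%VS.
Proof.
pose W := kperp br b; pose U := (b :&: W)%VS.
have bW : (lie_brv br b W <= W)%VS by exact: kperp_stable.
have bU : (lie_brv br b U <= U)%VS.
  rewrite subv_cap (subv_trans _ bW) ?(subv_trans _ bb) //; apply: lie_brvS => //.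
    by exact: capvSl.
  by exact: capvSr.
apply: contraT => Wb.
have WU : ~~ (W <= U)%VS by rewrite subv_cap negb_and Wb.
have [X XW [XU Xe]] := lie_relative_eigenvector brL bb bs (capvSr _ _) WU bU bW.
have Xb : X \notin b by apply: contra XU => Xb; rewrite memv_cap Xb.
case/negP: (Xb); apply: borel_line.
  move=> y yb; have [a ya] := Xe y yb; rewrite -(subrK (a *: X) (br y X)).
  apply: memv_add; last by rewrite rpredZ ?memv_line.
  by apply: (subvP (capvSl b W)).
set L := (b + <[X]>)%VS => Lsub; set D1 := lie_brv br L L.
have bL : (b <= L)%VS by exact: addvSl.
have XL : X \in L by rewrite (subvP (addvSr _ _)) ?memv_line.
have BXb u : u \in b -> B X u = 0 by move=> ub; exact: (kperpP brL _ _ XW).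
have LP : forall y, y \in L -> exists2 u, u \in b & exists a, y = u + a *: X.
  by move=> _ /memv_addP[u ub [_ /vlineP[a ->] ->]]; exists u => //; exists a.
have BL y z w : y \in L -> z \in L -> w \in L -> B (br y z) w = 0.
  move=> /LP[u ub [a ->]] /LP[v vb [c ->]] /LP[t tb [e ->]].
  have uvb : br u v \in b by rewrite (subvP bb) // mem_lie_brv.
  have H1 : B (br u v) t = 0 by rewrite killingC // killing_solvable // mem_lie_brv.
  have H2 : B (br u v) X = 0 by rewrite killingC // BXb.
  have H3 p q : p \in b -> q \in b -> B (br X p) q = 0.
    by move=> pb qb; rewrite (killing_inv brL) BXb // (subvP bb) // mem_lie_brv.
  have H4 p : p \in b -> B (br X p) X = 0.
    by move=> pb; rewrite killingC // -(killing_inv brL) (lie_brxx brL) killing0l.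
  rewrite (lie_brDl brL) !(lie_brDr brL) !(lie_brZl brL) !(lie_brZr brL) (lie_brxx brL).
  rewrite !scaler0 addr0 (lie_brC brL u X) !(killingDl brL, killingDr brL).
  rewrite !(killingZl brL, killingZr brL, killingNl brL) H1 H2 !H4 // !H3 //.
  by rewrite !mulr0 !oppr0 !mulr0 !addr0.
(* Cartan's argument. The conjugate part of ad y is ad z with [z, L] inside [L, L], so B (y, z) = 0
   by invariance. This is a vanishing sum of squared moduli; hence ad y is nilpotent and its
   eigenvalue a on X modulo b is 0. *)
have lam0 y a : y \in b -> y \in D1 -> br y X - a *: X \in U -> a = 0.
  move=> yb yD ya; have [S [SD Sder Str]] := conjugate_part (adm br y).
  have [z Sz] : exists z, S = adm br z.
    apply: (derivation_inner brL killing_nondeg).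
    case: (brL) => l1 l2 _ _; apply: (Sder br l1 l2) => u v.
    by rewrite !mul_adm // lie_jacobi.
  have zL u : u \in L -> br z u \in D1.
    move=> uL; rewrite -mul_adm // -Sz; apply: (SD D1 L) => // v vL.
    by rewrite mul_adm //; apply: mem_lie_brv => //; apply: (subvP bL).
  have Byz : B y z = 0.
    rewrite killingC //; suff : (D1 <= kperp br <[z]>)%VS.
      move=> /subvP/(_ _ yD)/(kperpP brL) H.
      by rewrite killingC // H // memv_line.
    apply/(lie_brvP brL) => u v uL vL; apply/(kperpP brL) => _ /vlineP[c ->].
    rewrite (killingZr brL) (killing_inv brL) (lie_brC brL) killingC // (killingNl brL).
    rewrite (_ : B (br z v) u = 0) ?oppr0 ?mulr0 //.
    have : (D1 <= kperp br L)%VS.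
      by apply/(lie_brvP brL) => p q pL qL; apply/(kperpP brL) => w wL; exact: BL.
    by move=> /subvP/(_ _ (zL v vL))/(kperpP brL); apply.
  have An : adm br y ^+ n = 0 by apply: Str; rewrite Sz.
  have : forall k, X *m adm br y ^+ k - a ^+ k *: X \in b.
    elim=> [|k IH]; first by rewrite !expr0 mulmx1 scale1r subrr mem0v.
    rewrite exprSr -[_ * _]/(_ *m _) mulmxA exprS.
    have -> : X *m adm br y ^+ k *m adm br y - (a * a ^+ k) *: X
      = br y (X *m adm br y ^+ k - a ^+ k *: X) + a ^+ k *: (br y X - a *: X).
      rewrite mul_adm // (lie_brDr brL) (lie_brNr brL) (lie_brZr brL) scalerBr addrA subrK.
      by rewrite scalerA mulrC.
    apply: memvD; first by rewrite (subvP bb) // mem_lie_brv.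
    by rewrite rpredZ // (subvP (capvSl b W)).
  move=> /(_ n); rewrite An mulmx0 sub0r memvN => aX.
  apply/eqP; apply: contraT => a0; case/negP: Xb.
  by rewrite -[X]scale1r -(mulVf (expf_neq0 n a0)) -scalerA rpredZ.
have [DL|] := boolP (D1 <= L)%VS; last by rewrite (Lsub : (lie_brv br L L <= L)%VS).
have cd c d : c \in b -> c \in D1 -> d \in L -> br c d \in b.
  move=> cb cD /LP[u ub [a ->]]; rewrite (lie_brDr brL) (lie_brZr brL) memvD //.
    by rewrite (subvP bb) // mem_lie_brv.
  have [e ce] := Xe c cb; have e0 := lam0 c e cb cD ce; move: ce.
  by rewrite e0 scale0r subr0 memv_cap => /andP[cXb _]; rewrite rpredZ.
apply: lie_solvable_derived; apply: lie_solvable_derived; rewrite -/D1.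
apply: lie_solvableS bs => //; apply/(lie_brvP brL) => d d' dD d'D.
have [u ub [a dE]] := LP d (subvP DL _ dD).
have [u' ub' [a' dE']] := LP d' (subvP DL _ d'D).
have [a0|a0] := eqVneq a 0.
  by apply: cd => //; rewrite ?dE ?a0 ?scale0r ?addr0 // (subvP DL).
(* Modulo b the algebra L is a line, so subtracting a multiple of d moves d' into b without changing
   the bracket. *)
have -> : br d d' = - br (d' - (a' / a) *: d) d.
  by rewrite (lie_brDl brL) (lie_brNl brL) (lie_brZl brL) (lie_brxx brL) scaler0 subr0 lie_brC.
rewrite memvN; apply: cd; last exact: (subvP DL).
  by rewrite dE dE' scalerDr scalerA mulfVK // opprD addrACA subrr addr0 memvB ?rpredZ.
by rewrite memvB ?rpredZ.
Qed.

(** Let w be the component of x Hermitian-orthogonal to [b, b]. Then conj w is Killing-orthogonal to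
    [b, b], so [b, conj w] lies in the orthogonal of b, hence in b, and b + <conj w> is solvable. By
    maximality conj w is in b, so B (w, conj w) = 0. *)
Lemma borel_kperp_derived : (kperp br b <= D)%VS.
Proof.
apply/subvP => x xb; have /memv_addP[z zD [w wD xE]] : x \in (D + hperp D)%VS.
  by rewrite addv_hperp memvf.
have wb : w \in kperp br b.
  have -> : w = x - z by rewrite xE addrC addKr.
  by rewrite memvB // (subvP lie_brv_kperp).
have cwD d : d \in D -> B (cj w) d = 0.
  by move=> dD; rewrite -[d]cjK killing_cj (hperpP _ _ wD) ?conjC0.
have cwb y : y \in b -> br y (cj w) \in b.
  move=> yb; apply: (subvP borel_kperp); apply/(kperpP brL) => u ub.
  by rewrite (lie_brC brL) (killingNl brL) (killing_inv brL) cwD ?oppr0 // mem_lie_brv.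
suff : cj w \in b.
  move=> cw; suff w0 : w = 0 by rewrite xE w0 addr0.
  by apply: killing_cj_eq0; exact: (kperpP brL _ _ wb).
apply: borel_line => [y yb|Lsub]; first by rewrite (subvP (addvSl _ _)) ?cwb.
apply: lie_solvable_derived; apply: lie_solvableS bs => //; apply/(lie_brvP brL).
move=> _ _ /memv_addP[y yb [_ /vlineP[a ->] ->]] /memv_addP[v vb [_ /vlineP[c ->] ->]].
rewrite (lie_brDl brL) !(lie_brDr brL) !(lie_brZl brL) !(lie_brZr brL) (lie_brxx brL).
rewrite !scaler0 addr0 (lie_brC brL (cj w)) !memvD ?rpredZ ?rpredN ?cwb //.
by rewrite (subvP bb) // mem_lie_brv.
Qed.

End Borel.

Variables p lplus : {vspace V}.
Hypothesis p_parabolic : lie_parabolic br p.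
Hypothesis lplus_nilradical : lie_nilradical br lplus p.

Lemma parabolic_kperp : (kperp br p <= p)%VS.
Proof.
have [_ [b [bb bs bmax] bp]] := p_parabolic.
by apply: subv_trans (kperpS brL bp) _; apply: subv_trans bp; exact: borel_kperp.
Qed.

(** The orthogonal of p is an ideal contained in [b, b], which acts nilpotently by Lie's theorem. *)
Lemma kperp_nilradical : (kperp br p <= lplus)%VS.
Proof.
have [pp [b [bb bs bmax] bp]] := p_parabolic.
have [_ _ Nmax] := lplus_nilradical; apply: Nmax.
  by split; [exact: parabolic_kperp|exact: kperp_stable].
have [k Tk] := lie_derived_nil brL bb bs.
have ND : (kperp br p <= lie_brv br b b)%VS.
  by apply: subv_trans (kperpS brL bp) _; exact: borel_kperp_derived.
exists k.+1; apply/eqP; rewrite /lower_central /= -subv0 -Tk.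
elim: k {Tk} => /= [|k IH]; first exact: subvf.
exact: lie_brvS.
Qed.

Lemma nilradical_lcn_ideal i :
  (lie_brv br p (iter i (lie_brv br lplus) lplus) <= iter i (lie_brv br lplus) lplus)%VS.
Proof.
have [[lp pl] _ _] := lplus_nilradical.
elim: i => //= i IH; apply/(lie_brvP brL) => y w yp.
apply: (lie_brv_ind brL) => x v xl vT; rewrite (lie_jacobi brL).
apply: memvD; apply: mem_lie_brv => //.
  by apply: (subvP pl); exact: mem_lie_brv.
by apply: (subvP IH); exact: mem_lie_brv.
Qed.

(** For x in [lplus] and y in p, ad x ad y is nilpotent on the whole algebra. It first descends
    through the orthogonals of the lower central series from the whole space to the orthogonal of
    [lplus], then to that of p. This lies in p, and from there it descends through [lplus] and its
    lower central series to 0. *)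
Lemma nilradical_kperp : lplus = kperp br p.
Proof.
apply/eqP; rewrite eqEsubv kperp_nilradical andbT.
have [pp _] := p_parabolic.
have [[lp pl] [k0 lk0] _] := lplus_nilradical.
have [k lk] : exists k, iter k (lie_brv br lplus) lplus = 0%VS by exists k0.-1.
pose m i := iter i (lie_brv br lplus) lplus.
apply/subvP => x xl; apply/(kperpP brL) => y yp.
rewrite killingC //; apply: (@mxtrace_nilpotent _ _ _ (k.+1 + k.+1)%N).
set M := _ *m _; have ME v : v *m M = br x (br y v) by rewrite mulmxA !mul_adm.
apply/row_matrixP => i; rewrite row0 rowE exprD -[_ * _]/(_ *m _) mulmxA.
have pm j u : u \in m j -> br y u \in m j.
  by move=> uj; apply: (subvP (nilradical_lcn_ideal j)); exact: mem_lie_brv.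
have adj a c d : B (br a c) d = - B c (br a d).
  by rewrite (lie_brC brL) (killingNl brL) killing_inv.
have inv u w : B (br x (br y w)) u = B w (br y (br x u)) by rewrite !adj opprK.
set v := delta_mx 0 i; have fall j : (j <= k)%N -> v *m M ^+ j \in kperp br (m (k - j)%N).
  elim: j => [|j IH] jk.
    rewrite subn0 /m lk; apply/(kperpP brL) => u; rewrite memv0 => /eqP ->.
    by rewrite killingC killing0l.
  rewrite exprSr -[_ * _]/(_ *m _) mulmxA ME; apply/(kperpP brL) => u uj.
  rewrite inv; apply: (kperpP brL _ _ (IH (ltnW jk))).
  by apply: pm; rewrite -(subnSK jk); exact: mem_lie_brv.
have vp : v *m M ^+ k.+1 \in p.
  apply: (subvP parabolic_kperp); rewrite exprSr -[_ * _]/(_ *m _) mulmxA ME.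
  apply/(kperpP brL) => u up; rewrite inv; have := fall k (leqnn k); rewrite subnn.
  move=> /(kperpP brL); apply; apply: (pm 0%N); rewrite (lie_brC brL) memvN.
  by apply: (subvP pl); exact: mem_lie_brv.
have rise j : v *m M ^+ k.+1 *m M ^+ j.+1 \in m j.
  elim: j => [|j IH].
    rewrite expr1 ME (lie_brC brL) memvN (subvP pl) // mem_lie_brv //.
    exact: (subvP pp _ (mem_lie_brv brL yp vp)).
  rewrite [M ^+ j.+2]exprSr -[_ * _]/(_ *m _) mulmxA ME; apply: mem_lie_brv => //.
  exact: pm.
by have := rise k; rewrite /m lk memv0 => /eqP.
Qed.

End Parabolic.

(** * The second canonical series *)

Section Grading.
Variables (F : numClosedFieldType) (n : nat).
Local Notation V := 'rV[F]_n.
Variable br : V -> V -> V.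
Hypothesis brL : lie_bracket br.
Local Notation B := (killing br).
Local Notation cj := (map_mx Num.conj).

Hypothesis cj_br : forall x y : V, cj (br x y) = br (cj x) (cj y).
Hypothesis herm_gt0 : forall x : V, x != 0 -> 0 < - B x (cj x).

Variables p lplus : {vspace V}.
Hypothesis p_parabolic : lie_parabolic br p.
Hypothesis lplus_nilradical : lie_nilradical br lplus p.

Local Notation m i := (iter i (lie_brv br lplus) lplus).

(** Indices are shifted by one: [m i] is the term l_(i+1) and [gpos i] is g_(i+1). *)
Definition gpos i : {vspace V} := (m i :&: hperp br (m i.+1))%VS.

(** In degree 0 the intersection of p with its conjugate is the complexification of its real
    points. *)
Definition gseries (z : int) : {vspace V} :=
  match z with
  | Posz 0 => (p :&: cjv p)%VS
  | Posz i.+1 => gpos i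
  | Negz i => cjv (gpos i)
  end.

Let lp : (lplus <= p)%VS. Proof. by case: lplus_nilradical => -[]. Qed.
Let pp : (lie_brv br p p <= p)%VS. Proof. by case: p_parabolic. Qed.
Let lE : lplus = kperp br p. Proof. exact: nilradical_kperp. Qed.
Let pE : p = kperp br lplus. Proof. by rewrite lE kperpK. Qed.

Let pm i x y : x \in p -> y \in m i -> br x y \in m i.
Proof.
move=> xp yi; have := nilradical_lcn_ideal brL lplus_nilradical i.
by move/subvP; apply; exact: mem_lie_brv.
Qed.

Let mS i : (m i.+1 <= m i)%VS.
Proof. by apply/(lie_brvP brL) => x y /(subvP lp); exact: pm. Qed.

Let mle i j : (i <= j)%N -> (m j <= m i)%VS.
Proof.
by move=> /subnKC <-; elim: (_ - _)%N => [|k IH]; rewrite ?addn0 // addnS (subv_trans (mS _)).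
Qed.

Let ml i x : x \in m i -> x \in lplus.
Proof. by move: x; apply/subvP; exact: (mle (leq0n i)). Qed.

Let kad a c d : B (br a c) d = - B c (br a d).
Proof. by rewrite (lie_brC brL) (killingNl brL) (killing_inv brL). Qed.

(** The Hermitian adjoint of ad a is -ad (conj a). So knowing where ad (conj a) sends the lower
    central series tells what ad a is orthogonal to. *)
Let had a c d : B (br a c) (cj d) = - B c (cj (br (cj a) d)).
Proof. by rewrite kad cj_br cjK. Qed.

Let m_split i x : x \in m i -> exists2 u, u \in gpos i & exists2 w, w \in m i.+1 & x = u + w.
Proof.
move=> xi; have /memv_addP[w wU [u uU xE]] : x \in (m i.+1 + hperp br (m i.+1))%VS.
  by rewrite addv_hperp ?memvf.
exists u; last by exists w => //; rewrite addrC.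
rewrite memv_cap uU andbT; have -> : u = x - w by rewrite xE addrC addKr.
by rewrite memvB // (subvP (mS i)).
Qed.

(** Pairing [u, x] with y in [lplus] gives B (u, [x, y]), which is zero because conj u is orthogonal
    to l_2; and the orthogonal of [lplus] is p. *)
Let gm_l u x : u \in cjv (gpos 0) -> x \in lplus -> br u x \in p.
Proof.
rewrite mem_cjv memv_cap => /andP[_ uh] xl; rewrite pE; apply/(kperpP brL) => y yl.
rewrite (killing_inv brL) -[u]cjK -[br x y]cjK (killing_cj brL cj_br).
rewrite (hperpP brL _ _ uh) ?conjC0 //; exact: mem_lie_brv.
Qed.

Let gm_m i u x : u \in cjv (gpos 0) -> x \in m i.+1 -> br u x \in m i.
Proof.
move=> ug; elim: i x => [|i IH] x; apply: (lie_brv_ind brL) => a b al bi;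
  rewrite (lie_jacobi brL) memvD //.
- by apply: (pm (i := 0)) => //; exact: gm_l.
- rewrite (lie_brC brL) memvN; apply: (pm (i := 0)) => //; exact: gm_l.
- by apply: (pm (i := i.+1)) => //; exact: gm_l.
- by apply: mem_lie_brv => //; exact: IH.
Qed.

Let gp1_gp j u y : u \in gpos 0 -> y \in gpos j -> br u y \in gpos j.+1.
Proof.
move=> ug; have ul : u \in lplus by move: ug; rewrite memv_cap => /andP[].
rewrite !memv_cap => /andP[yj yh]; apply/andP; split; first exact: mem_lie_brv.
apply/(hperpP brL) => z zj; rewrite had (hperpP brL _ _ yh) ?oppr0 //.
by apply: gm_m => //; rewrite mem_cjv cjK.
Qed.

(** Splitting both factors of [l_1, l_i] orthogonally leaves [g_1, g_i] plus terms one level deeper;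
    orthogonality removes the latter. So g_1 generates the positive part, and the bracket relations
    reduce to those with g_1. *)
Let gpS i : (gpos i.+1 <= lie_brv br (gpos 0) (gpos i))%VS.
Proof.
have [sub1 sub2] : (gpos 0 <= lplus)%VS /\ (gpos i <= m i)%VS by split; exact: capvSl.
have H : (m i.+1 <= lie_brv br (gpos 0) (gpos i) + m i.+2)%VS.
  apply/(lie_brvP brL) => a b al bi.
  have [a0 a0g [a1 a1m aE]] := @m_split 0 a al.
  have [b0 b0g [b1 b1m bE]] := m_split bi.
  have -> : br a b = br a0 b0 + (br a0 b1 + br a1 b).
    by rewrite {1}aE (lie_brDl brL) addrA {1}bE (lie_brDr brL).
  apply: memv_add; first exact: mem_lie_brv.
  apply: memvD; first by apply: mem_lie_brv => //; exact: (subvP sub1).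
  rewrite (lie_brC brL) memvN; move: a1m; apply: (lie_brv_ind brL) => c d cl dl.
  rewrite (lie_jacobi brL) memvD //.
    rewrite (lie_brC brL) memvN (lie_brC brL b) (lie_brNr brL) memvN.
    by apply: mem_lie_brv => //; exact: mem_lie_brv.
  apply: mem_lie_brv => //; rewrite (lie_brC brL) memvN; exact: mem_lie_brv.
apply/subvP => x xg; have xm : x \in m i.+1 by move: xg; rewrite memv_cap => /andP[].
have /memv_addP[s sD [t tm xE]] := subvP H _ xm.
have sg : s \in gpos i.+1.
  move: sD; apply/subvP/(lie_brvP brL) => u v; exact: gp1_gp.
have : t \in (m i.+2 :&: hperp br (m i.+2))%VS.
  have tE : t = x - s by rewrite xE addrC addKr.
  rewrite memv_cap tm /= tE memvB //; [move: xg|move: sg];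
  by rewrite memv_cap => /andP[].
by rewrite (capv_hperp brL herm_gt0) memv0 => /eqP t0; rewrite xE t0 addr0.
Qed.

Let gm_gp j u y : u \in cjv (gpos 0) -> y \in gpos j.+1 -> br u y \in gpos j.
Proof.
move=> ug; rewrite !memv_cap => /andP[yj yh]; rewrite gm_m //=.
apply/(hperpP brL) => z zj; rewrite had (hperpP brL _ _ yh) ?oppr0 //.
apply: mem_lie_brv => //; move: ug; rewrite mem_cjv memv_cap => /andP[ul _].
exact: (ml (i := 0)).
Qed.

Let gp_l i x : x \in gpos i -> x \in lplus.
Proof. by rewrite memv_cap => /andP[/ml]. Qed.

Let gm_gp0 u y : u \in cjv (gpos 0) -> y \in gpos 0 -> br u y \in gseries 0.
Proof.
move=> ug yg; rewrite memv_cap gm_l ?(gp_l yg) //= mem_cjv cj_br (lie_brC brL) memvN.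
by apply: gm_l; [rewrite mem_cjv cjK|move: ug; rewrite mem_cjv; exact: gp_l].
Qed.

Let g0_gp i u y : u \in gseries 0 -> y \in gpos i -> br u y \in gpos i.
Proof.
rewrite memv_cap mem_cjv => /andP[up cup]; rewrite !memv_cap => /andP[yi yh].
rewrite pm //=; apply/(hperpP brL) => z zi.
by rewrite had (hperpP brL _ _ yh) ?oppr0 //; exact: (pm (i := i.+1)).
Qed.

Let g0_g0 u y : u \in gseries 0 -> y \in gseries 0 -> br u y \in gseries 0.
Proof.
rewrite !memv_cap !mem_cjv cj_br => /andP[up cup] /andP[yp cyp].
by rewrite !(subvP pp) //; exact: mem_lie_brv.
Qed.

Lemma gseries_cj k x : (x \in gseries k) = (cj x \in gseries (- k)).
Proof.
case: k => [[|i]|i] /=; rewrite ?NegzE ?opprK.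
- by rewrite !memv_cap !mem_cjv cjK andbC.
- by rewrite mem_cjv cjK.
- by rewrite mem_cjv.
Qed.

(** In negative degree this is the conjugate of the statement that g_(-1) lowers positive degrees by
    one. *)
Let raise k u y : u \in gseries 1 -> y \in gseries k -> br u y \in gseries (1 + k).
Proof.
move=> ug; case: k => [[|j]|[|j]] yg.
- by rewrite addr0 (lie_brC brL) memvN; exact: g0_gp.
- by rewrite (_ : 1 + _ = Posz j.+2) //; exact: gp1_gp.
- rewrite (_ : 1 + _ = 0) // (lie_brC brL) memvN; exact: gm_gp0.
- rewrite (_ : 1 + _ = Negz j); last by rewrite !NegzE; lia.
  rewrite /= mem_cjv cj_br; apply: gm_gp; first by rewrite mem_cjv cjK.
  by move: yg; rewrite /= mem_cjv.
Qed.

Let g0_gz k u y : u \in gseries 0 -> y \in gseries k -> br u y \in gseries k.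
Proof.
move=> ug; case: k => [[|j]|j]; [exact: g0_g0|exact: g0_gp|].
rewrite /= !mem_cjv cj_br => yg; apply: g0_gp => //.
by rewrite gseries_cj oppr0 cjK.
Qed.

Let pos_gz i k u y : u \in gpos i -> y \in gseries k -> br u y \in gseries (Posz i.+1 + k).
Proof.
elim: i u y k => [|i IH] u y k ug yg; first exact: raise.
rewrite (lie_brC brL) memvN; move: (subvP (gpS i) _ ug).
apply: (lie_brv_ind brL) => a b a0 bi; rewrite (lie_brC brL) memvN.
have -> : br (br a b) y = br a (br b y) - br b (br a y) by rewrite (lie_jacobi brL) addrK.
apply: memvB.
  by rewrite (_ : Posz i.+2 + k = 1 + (Posz i.+1 + k)) ?raise ?IH //; lia.
by rewrite (_ : Posz i.+2 + k = Posz i.+1 + (1 + k)) ?IH ?raise //; lia.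
Qed.

Lemma gseries_br i k u y : u \in gseries i -> y \in gseries k ->
  br u y \in gseries (i + k).
Proof.
case: i => [[|i]|i]; first by rewrite add0r; exact: g0_gz.
  exact: pos_gz.
rewrite /= mem_cjv => ug; rewrite [y \in _]gseries_cj => yg.
rewrite gseries_cj cj_br (_ : - (Negz i + k) = Posz i.+1 + - k) ?pos_gz //.
by rewrite NegzE; lia.
Qed.

(** Spanning is expressed by an arbitrary W, so that a linear identity can be checked degree by
    degree by taking a kernel for W. The space is p plus the conjugate of [lplus], and p is [lplus]
    plus degree 0. *)
Lemma gseries_full (W : {vspace V}) : (forall k, (gseries k <= W)%VS) -> W = fullv.
Proof.
move=> gW; have [_ [k0 lk0] _] := lplus_nilradical.
have mW (f : V -> V) : (forall x y, f (x + y) = f x + f y) -> f 0 = 0 ->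
    (forall i x, x \in gpos i -> f x \in W) -> forall i x, x \in m i -> f x \in W.
  move=> fD f0 fg i; have [d] := ubnP (k0.-1 - i)%N; elim: d i => // d IH i di x xi.
  have [u ug [w wm ->]] := m_split xi; rewrite fD memvD ?(fg i u) //.
  have [ki|ki] := leqP k0.-1 i; last by apply: (IH i.+1 _ w wm); move: di ki; lia.
  have : w \in m k0.-1 by apply: (subvP (mle _)) wm; rewrite (leq_trans ki).
  by rewrite (lk0 : m k0.-1 = 0%VS) memv0 => /eqP ->; rewrite f0 mem0v.
have lW x : x \in lplus -> x \in W.
  by apply: (mW id _ _ _ 0%N) => // i y; exact: (subvP (gW (Posz i.+1))).
have clW x : x \in lplus -> cj x \in W.
  apply: (mW (fun y => cj y) _ _ _ 0%N); [exact: cjD|exact: cj0|].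
  by move=> i y yg; apply: (subvP (gW (Negz i))); rewrite /= mem_cjv cjK.
apply/eqP; rewrite eqEsubv subvf /=; apply/subvP => x _.
have /memv_addP[y yp [z zh ->]] : x \in (p + hperp br p)%VS by rewrite addv_hperp ?memvf.
rewrite memvD //; last first.
  rewrite -[z]cjK clW // lE; apply/(kperpP brL) => u up.
  by rewrite -[u]cjK (killing_cj brL cj_br) (hperpP brL _ _ zh) ?conjC0.
have /memv_addP[u ul [w wh yE]] : y \in (lplus + hperp br lplus)%VS.
  by rewrite addv_hperp ?memvf.
rewrite yE memvD ?(lW u) //; apply: (subvP (gW 0)); rewrite memv_cap mem_cjv.
apply/andP; split.
  have -> : w = y - u by rewrite yE addrC addKr.
  by rewrite memvB // (subvP lp).
rewrite pE; apply/(kperpP brL) => v vl.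
by rewrite -[v]cjK (killing_cj brL cj_br) (hperpP brL _ _ wh) ?conjC0.
Qed.

Definition hproj (U : {vspace V}) : 'M[F]_n := lin1_mx (daddv_pi U (hperp br U)).

Lemma hproj_id (U : {vspace V}) (x : V) : x \in U -> x *m hproj U = x.
Proof. by move=> xU; rewrite mul_rV_lin1 /= daddv_pi_id // (capv_hperp brL herm_gt0). Qed.

Lemma hproj_0 (U : {vspace V}) (x : V) : x \in hperp br U -> x *m hproj U = 0.
Proof.
move=> xU; have cap0 : (hperp br U :&: U)%VS = 0%VS by rewrite capvC (capv_hperp brL herm_gt0).
have xf : x \in (U + hperp br U)%VS by rewrite addv_hperp ?memvf.
have := daddv_pi_add (capv_hperp brL herm_gt0 U) xf.
by rewrite (daddv_pi_id cap0) // mul_rV_lin1 /= -[RHS]add0r => /addIr.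
Qed.

(** A vector of g_(j+1) lies in [m i] for i <= j and is orthogonal to it for i > j. Summing the
    orthogonal projectors onto the [m i] therefore counts its degree; the conjugate projectors count
    negative degrees. *)
Lemma grading_derivation : exists D : 'M[F]_n,
  forall k x, x \in gseries k -> x *m D = k%:~R *: x.
Proof.
have [_ [k0 lk0] _] := lplus_nilradical; set N := k0.-1.
have mN i x : (N <= i)%N -> x \in m i -> x = 0.
  move=> Ni /(subvP (mle Ni)); rewrite (lk0 : m k0.-1 = 0%VS) memv0 => /eqP //.
exists (\sum_(i < N) (hproj (m i) - hproj (cjv (m i)))) => k x xk.
have l_l u v : u \in lplus -> v \in p -> B u v = 0.
  by move=> ul vp; rewrite lE in ul; exact: (kperpP brL _ _ ul).
have Bcj u v : B (cj u) v = 0 -> B u (cj v) = 0.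
  by move=> H; rewrite -[u]cjK (killing_cj brL cj_br) H conjC0.
have count j : (j <= N)%N -> \sum_(i < N) (if (i < j)%N then 1 else 0 : F) = j%:R.
  move=> jN; rewrite -big_mkcond /= -(big_mkord (fun i => (i < j)%N) (fun=> 1)).
  rewrite (big_cat_nat _ (n := j)) //= [X in _ + X]big1_seq; last first.
    by move=> i /andP[ij]; rewrite mem_index_iota => /andP[ji _]; rewrite ltnNge ji in ij.
  rewrite addr0 big_seq_cond (eq_bigl (fun i => i \in index_iota 0 j)).
    by rewrite -big_seq sumr_const_nat subn0.
  by move=> i; rewrite mem_index_iota /= andbb.
rewrite mulmx_sumr; case: k xk => [[|j]|j] /=.
- rewrite memv_cap mem_cjv => /andP[xp cxp]; rewrite scale0r big1 // => i _.
  rewrite mulmxBr !hproj_0 ?subrr //; apply/(hperpP brL) => y.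
    rewrite mem_cjv => /ml yl; rewrite killingC; exact: l_l.
  by move=> /ml yl; apply: Bcj; rewrite killingC; exact: l_l.
- move=> xj; have xl := gp_l xj; move: xj; rewrite memv_cap => /andP[xj xh].
  have [Nj|jN] := leqP N j; first by rewrite (mN j x) // scaler0 big1 // => i _; rewrite mul0mx.
  rewrite -[j.+1%:~R]/(j.+1%:R) -count // scaler_suml; apply: eq_bigr => i _.
  rewrite mulmxBr [X in _ - X]hproj_0 ?subr0; last first.
    apply/(hperpP brL) => y; rewrite mem_cjv => /ml yl; apply: l_l => //; exact: (subvP lp).
  rewrite ltnS; case: leqP => ij; first by rewrite scale1r hproj_id // (subvP (mle ij)).
  rewrite scale0r hproj_0 //; apply/(hperpP brL) => y /(subvP (mle ij)).
  exact: (hperpP brL _ _ xh).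
- rewrite mem_cjv => xj; have xl := gp_l xj; move: xj; rewrite memv_cap => /andP[xj xh].
  have [Nj|jN] := leqP N j.
    have /(congr1 cj) := mN j _ Nj xj; rewrite cjK cj0 => ->.
    by rewrite scaler0 big1 // => i _; rewrite mul0mx.
  rewrite NegzE rmorphN /= -[j.+1%:~R]/(j.+1%:R) scaleNr -count // scaler_suml -sumrN.
  apply: eq_bigr => i _.
  rewrite mulmxBr [X in X - _]hproj_0 ?sub0r; last first.
    apply/(hperpP brL) => y /ml yl; apply: Bcj; apply: l_l => //; exact: (subvP lp).
  congr (- _); rewrite ltnS; case: leqP => ij.
    by rewrite scale1r hproj_id // mem_cjv (subvP (mle ij)).
  rewrite scale0r hproj_0 //; apply/(hperpP brL) => y; rewrite mem_cjv => /(subvP (mle ij)) yj.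
  by apply: Bcj; rewrite -[y]cjK; exact: (hperpP brL _ _ xh).
Qed.

(* The canonical element of the parabolic subalgebra, times 'i. *)
Lemma canonical_element : exists2 xi : V, cj xi = xi &
  forall k x, x \in gseries k -> br xi x = ('i * k%:~R) *: x.
Proof.
have [D DE] := grading_derivation.
have ext (f g : 'M[F]_n) : (forall k x, x \in gseries k -> x *m f = x *m g) -> f = g.
  move=> fg; apply/eqP; rewrite -subr_eq0; apply/eqP/row_matrixP => i; rewrite row0 rowE.
  have : delta_mx 0 i \in lker (linfun (mulmxr (f - g)) : 'Hom(V, V)).
    rewrite (gseries_full (W := lker _)) ?memvf // => k; apply/subvP => x xk.
    by rewrite memv_ker lfunE /= mulmxBr (fg k) ?subrr.
  by rewrite memv_ker lfunE => /eqP.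
have der1 k x y : x \in gseries k -> br x y *m D = br (x *m D) y + br x (y *m D).
  move=> xk; rewrite -mul_adm // -mulmxA -[in X in _ = _ + X](mul_adm brL) -mulmxA.
  rewrite -(mul_adm brL _ (x *m D)) -mulmxDr.
  congr (_ *m _); apply: ext => j z zj; rewrite mulmxDr !mulmxA !(mul_adm brL).
  rewrite (DE _ _ xk) (DE _ _ zj) (DE _ _ (gseries_br xk zj)) (lie_brZl brL) (lie_brZr brL).
  by rewrite -scalerDl rmorphD.
have der x y : br x y *m D = br (x *m D) y + br x (y *m D).
  pose f := adm br y *m D - D *m adm br y - adm br (y *m D).
  have : f = 0.
    apply: ext => k z zk; rewrite mulmx0 !mulmxBr !mulmxA !(mul_adm brL).
    rewrite ![br _ z](lie_brC brL) !(lie_brC brL _ (z *m D)) mulNmx (der1 k) //.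
    by rewrite !opprK -addrA addNr.
  move=> /(congr1 (mulmx x)); rewrite mulmx0 !mulmxBr !mulmxA !(mul_adm brL).
  rewrite ![br _ x](lie_brC brL) ![br _ (x *m D)](lie_brC brL) mulNmx => /eqP.
  by rewrite !opprK -addrA addrC subr_eq0 eq_sym => /eqP.
have nondeg := killing_nondeg herm_gt0.
have [z zE] := derivation_inner brL nondeg der.
have brz k x : x \in gseries k -> br z x = k%:~R *: x.
  by move=> xk; rewrite -(mul_adm brL) -zE (DE k).
exists ('i *: z); last by move=> k x xk; rewrite (lie_brZl brL) (brz k) // scalerA.
(* Conjugation exchanges g_k and g_(-k), so conj z acts as -z does; multiplying by the imaginary
   unit makes the element real. *)
suff cz : cj z = - z by rewrite cjZ conjCi cz scalerN scaleNr opprK.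
apply/eqP; rewrite -addr_eq0; apply/eqP/nondeg => y.
suff : adm br (cj z + z) = 0 by rewrite killingE => ->; rewrite mul0mx raddf0.
apply: ext => k x xk; rewrite mulmx0 (mul_adm brL) (lie_brDl brL) (brz k) //.
rewrite -[x in br _ x]cjK -cj_br (brz (- k)); last by rewrite -gseries_cj.
by rewrite cjZ cjK rmorph_int rmorphN /= scaleNr addNr.
Qed.

End Grading.

Local Open Scope classical_set_scope.

(** * Differential calculus *)

Section StrictDifferentiability.
Variable R : realType.

(** Coordinates over any finite type, rather than row vectors only: the domains include products of
    row spaces. *)
Definition fdim (V : normedModType R) :=
  exists (I : finType) (e : I -> V) (phi : I -> V -> R),
    [/\ forall i a x y, phi i (a *: x + y) = a * phi i x + phi i y,
        forall i, exists2 K, 0 < K & forall x, `|phi i x| <= K * `|x| &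
        forall x, x = \sum_i phi i x *: e i].

Definition bounded_linear (V W : normedModType R) (L : V -> W) :=
  (forall a x y, L (a *: x + y) = a *: L x + L y) /\
  exists2 K, 0 < K & forall x, `|L x| <= K * `|x|.

(* Strict differentiability of [f] at [a] with differential [L]. *)
Definition sdiff (V W : normedModType R) (f : V -> W) (a : V) (L : V -> W) :=
  bounded_linear L /\
  forall e, 0 < e -> exists2 d, 0 < d & forall x y,
    `|x - a| < d -> `|y - a| < d -> `|f x - f y - L (x - y)| <= e * `|x - y|.

Lemma blinD (V W : normedModType R) (L : V -> W) : bounded_linear L ->
  forall x y, L (x + y) = L x + L y.
Proof. by move=> [lL _] x y; rewrite -{1}(scale1r x) lL scale1r. Qed.

Lemma blin0 (V W : normedModType R) (L : V -> W) : bounded_linear L -> L 0 = 0.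
Proof. by move=> bL; rewrite -[LHS](addrK (L 0)) -blinD // addr0 subrr. Qed.

Lemma blinZ (V W : normedModType R) (L : V -> W) : bounded_linear L ->
  forall a x, L (a *: x) = a *: L x.
Proof. by move=> bL a x; have [lL _] := bL; rewrite -{1}(addr0 (a *: x)) lL blin0 // addr0. Qed.

Lemma blinN (V W : normedModType R) (L : V -> W) : bounded_linear L ->
  forall x, L (- x) = - L x.
Proof. by move=> bL x; rewrite -scaleN1r blinZ // scaleN1r. Qed.

Lemma blinB (V W : normedModType R) (L : V -> W) : bounded_linear L ->
  forall x y, L (x - y) = L x - L y.
Proof. by move=> bL x y; rewrite blinD // blinN. Qed.

Lemma blin_sum (V W : normedModType R) (L : V -> W) : bounded_linear L ->
  forall I (r : seq I) (F : I -> V), L (\sum_(i <- r) F i) = \sum_(i <- r) L (F i).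
Proof.
by move=> bL I r F; elim/big_rec2: _ => [|i u v _ <-]; rewrite ?blin0 ?blinD.
Qed.

Lemma blin_sdiff (V W : normedModType R) (L : V -> W) a :
  bounded_linear L -> sdiff L a L.
Proof.
move=> bL; split => // e e0; exists 1 => // x y _ _.
by rewrite blinB // subrr normr0 mulr_ge0 // ltW.
Qed.

Lemma derive_estimate (V W : normedModType R) (f : V -> W) (a v : V) (l : W) :
  (forall e, 0 < e -> exists2 d, 0 < d & forall t : R, `|t| < d ->
    `|f (t *: v + a) - f a - t *: l| <= e * `|t|) ->
  derivable f a v /\ 'D_v f a = l.
Proof.
move=> H.
have cv : (fun h => h^-1 *: ((f \o shift a) (h *: v) - f a)) @ 0^' --> l.
  apply/cvgrPdist_le => e e0; have [d d0 Hd] := H e e0.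
  near=> t; have t0 : t != 0 by near: t; exact: nbhs_dnbhs_neq.
  have td : `|t| < d by near: t; exact: dnbhs0_lt.
  rewrite /= -[l](scalerK t0) -scalerBr normrZ normfV distrC.
  rewrite ler_pdivrMl ?normr_gt0 // mulrC; exact: Hd.
by split; [apply/cvg_ex; exists l|apply/cvg_lim].
Unshelve. all: by end_near. Qed.

Lemma sdiff_derive (V W : normedModType R) (f : V -> W) a L v :
  sdiff f a L -> derivable f a v /\ 'D_v f a = L v.
Proof.
move=> [bL sL]; apply: derive_estimate => e e0.
have v0 : 0 < `|v| + 1 by rewrite ltr_wpDl.
have [d d0 H] := sL (e / (`|v| + 1)) (divr_gt0 e0 v0).
exists (d / (`|v| + 1)); first exact: divr_gt0.
move=> t td; have tv : `|t *: v| <= `|t| * (`|v| + 1).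
  by rewrite normrZ ler_wpM2l // lerDl.
have := H (t *: v + a) a; rewrite addrK subrr normr0 (blinZ bL) => /(_ _ d0) H'.
apply: le_trans (H' _) _.
  by apply: le_lt_trans tv _; rewrite -ltr_pdivlMr.
by rewrite -mulrA ler_pM2l // ler_pdivrMl // mulrC.
Qed.

Lemma sdiff_lipschitz (V W : normedModType R) (f : V -> W) a L : sdiff f a L ->
  exists2 K, 0 < K & exists2 d, 0 < d & forall x y, `|x - a| < d -> `|y - a| < d ->
    `|f x - f y| <= K * `|x - y|.
Proof.
move=> [[lL [K K0 KL]] sL]; have [d d0 H] := sL 1 ltr01.
exists (1 + K); first exact: addr_gt0.
exists d => // x y xd yd; rewrite -[f x - f y](subrK (L (x - y))).
by rewrite (le_trans (ler_normD _ _)) // mulrDl lerD // H.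
Qed.

Lemma near_dist_lt (V : normedModType R) (a : V) (d : R) : 0 < d ->
  \forall x \near a, `|x - a| < d.
Proof.
by move=> d0; apply/nbhs_ballP; exists d => // y; rewrite -ball_normE /= distrC.
Qed.

Lemma continuous_estimate (V W : normedModType R) (f : V -> W) a :
  (forall e, 0 < e -> exists2 d, 0 < d & forall x, `|x - a| < d -> `|f x - f a| <= e) ->
  {for a, continuous f}.
Proof.
move=> H; apply/cvgrPdist_le => e e0; have [d d0 Hd] := H e e0.
by apply: filterS (near_dist_lt a d0) => x /Hd; rewrite distrC.
Qed.

Lemma sdiff_continuous (V W : normedModType R) (f : V -> W) a L : sdiff f a L ->
  {for a, continuous f}.
Proof.
move=> /sdiff_lipschitz[K K0 [d d0 H]]; apply: continuous_estimate => e e0.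
exists (Num.min d (e / K)); first by rewrite lt_min d0 divr_gt0.
move=> x; rewrite lt_min => /andP[xd xe].
rewrite (le_trans (H x a xd _)) ?subrr ?normr0 //.
by rewrite mulrC -ler_pdivlMr // ltW.
Qed.

Lemma bounded_linear_comp (U V W : normedModType R) (L : U -> V) (M : V -> W) :
  bounded_linear L -> bounded_linear M -> bounded_linear (M \o L).
Proof.
move=> [lL [K K0 KL]] [lM [K' K'0 KM]]; split; first by move=> a x y /=; rewrite lL lM.
exists (K' * K); first exact: mulr_gt0.
move=> x /=; by apply: le_trans (KM _) _; rewrite -mulrA ler_pM2l.
Qed.

Lemma sdiff_comp (U V W : normedModType R) (f : U -> V) (g : V -> W) a L M :
  sdiff f a L -> sdiff g (f a) M -> sdiff (g \o f) a (M \o L).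
Proof.
move=> sf sg; have [bL _] := sf; have [bM _] := sg.
have [_ [K' K'0 KM]] := bM.
split; first exact: bounded_linear_comp.
move=> e e0; have [K K0 [d1 d10 H1]] := sdiff_lipschitz sf.
have [d2 d20 H2] := sg.2 (e / 2 / K) (divr_gt0 (divr_gt0 e0 (ltr0Sn R 1)) K0).
have [d3 d30 H3] := sf.2 (e / 2 / K') (divr_gt0 (divr_gt0 e0 (ltr0Sn R 1)) K'0).
exists (Num.min (Num.min d1 d3) (d2 / K)).
  by rewrite !lt_min d10 d30 divr_gt0.
move=> x y; rewrite !lt_min => /andP[/andP[x1 x3] x2] /andP[/andP[y1 y3] y2].
have a1 : `|a - a| < d1 by rewrite subrr normr0.
have fx : `|f x - f a| < d2.
  by apply: le_lt_trans (H1 x a x1 a1) _; rewrite mulrC -ltr_pdivlMr.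
have fy : `|f y - f a| < d2.
  by apply: le_lt_trans (H1 y a y1 a1) _; rewrite mulrC -ltr_pdivlMr.
have -> : (g \o f) x - (g \o f) y - (M \o L) (x - y)
   = (g (f x) - g (f y) - M (f x - f y)) + M (f x - f y - L (x - y)).
  by rewrite /= [in RHS](blinB bM (f x - f y)) addrA subrK.
apply: le_trans (ler_normD _ _) _; rewrite [e]splitr mulrDl; apply: lerD.
  apply: le_trans (H2 _ _ fx fy) _.
  rewrite -mulrA ler_pM2l ?divr_gt0 // ler_pdivrMl //; exact: H1.
apply: le_trans (KM _) _; rewrite mulrC -ler_pdivlMr // mulrAC; exact: H3.
Qed.

(** The mean value theorem on the restriction to a line, measured against a constant slope c. *)
Lemma segment_mean_value (V : normedModType R) (f : V -> R) (z v : V) (s c e : R) :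
  (forall t, `|t| <= `|s| -> derivable f (t *: v + z) v /\
     `|'D_v f (t *: v + z) - c| <= e) ->
  `|f (s *: v + z) - f z - s * c| <= e * `|s|.
Proof.
move=> H; pose g (t : R) := f (t *: v + z).
have dg (t : R) : `|t| <= `|s| -> is_derive t 1 g ('D_v f (t *: v + z)).
  move=> ts; have [df _] := H t ts.
  have E : (fun h => h^-1 *: ((g \o shift t) (h *: (1 : R)) - g t)) =
           (fun h => h^-1 *: ((f \o shift (t *: v + z)) (h *: v) - f (t *: v + z))).
    apply/funext => h /=; rewrite /g [h *: 1]mulr1 scalerDl addrA.
    by [].
  by split; rewrite /derivable /derive E.
have cg (t : R) : `|t| <= `|s| -> {for t, continuous g}.
  move=> ts; apply: differentiable_continuous; apply/derivable1_diffP.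
  by have [] := dg t ts.
have est (a b : R) : a <= b -> (forall t, a <= t <= b -> `|t| <= `|s|) ->
    exists2 t, `|t| <= `|s| & g b - g a = 'D_v f (t *: v + z) * (b - a).
  move=> ab Hab; have [||t tab ->] := @MVT_segment R g (fun t => 'D_v f (t *: v + z)) a b ab.
  - by move=> x; rewrite in_itv /= => /andP[ax xb]; apply/dg/Hab; rewrite !ltW.
  - apply: continuous_in_subspaceT => x; rewrite inE /= in_itv /= => xab.
    by apply/cg/Hab.
  by exists t => //; apply: Hab; move: tab; rewrite in_itv.
have -> : f (s *: v + z) - f z - s * c = g s - g 0 - c * (s - 0).
  by rewrite /g scale0r add0r subr0 mulrC.
have [s0|s0] := leP 0 s.
  have [|t ts ->] := est 0 s s0.
    by move=> t /andP[t0 ts]; rewrite !ger0_norm.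
  rewrite -mulrBl normrM subr0 ler_wpM2r //; exact: (H t ts).2.
have [|t ts gE] := est s 0 (ltW s0).
  by move=> t /andP[st t0]; rewrite !ler0_norm ?lerN2 // ltW.
rewrite -[g s - _]opprB gE -mulrN opprB -mulrBl normrM subr0 ler_wpM2r //.
exact: (H t ts).2.
Qed.

(** [Ck_on] provides only directional derivatives, so even their linearity in the direction must be
    proved. Homogeneity, additivity and the final estimate all come from the mean value theorem
    along segments and continuity of the derivatives. *)
Lemma C1_sdiff_scalar (V : normedModType R) (A : set V) (f : V -> R) (a : V) :
  fdim V -> open A -> A a ->
  (forall x v, A x -> derivable f x v) ->
  (forall x v, A x -> {for x, continuous (fun y => 'D_v f y)}) ->
  sdiff f a (fun v => 'D_v f a).
Proof.
move=> [m [b [phi [lphi bphi phiE]]]] oA Aa df cf.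
have near_ball x (e : R) v : A x -> 0 < e -> exists2 d, 0 < d & forall y, `|y - x| < d ->
    A y /\ `|'D_v f y - 'D_v f x| <= e.
  move=> Ax e0.
  have : \forall y \near x, A y /\ `|'D_v f y - 'D_v f x| <= e.
    apply: filterI; first exact: open_nbhs_nbhs.
    have /cvgrPdist_le/(_ e e0) := cf x v Ax.
    by apply: filterS => y; rewrite distrC.
  move=> /nbhs_ballP[d /= d0 Hd]; exists d => // y yd; apply: Hd.
  by rewrite -ball_normE /= distrC.
have hom (x v : V) (s : R) : A x -> 'D_(s *: v) f x = s * 'D_v f x.
  move=> Ax; apply: (derive_estimate (l := s * 'D_v f x) _).2 => e e0.
  have s0 : 0 < `|s| + 1 by rewrite ltr_wpDl.
  have v0 : 0 < `|v| + 1 by rewrite ltr_wpDl.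
  have [d d0 Hd] := near_ball x (e / (`|s| + 1)) v Ax (divr_gt0 e0 s0).
  exists (d / (`|v| + 1) / (`|s| + 1)); first by rewrite !divr_gt0.
  move=> t td; rewrite scalerA -[t *: _]/(t * _) mulrA.
  apply: le_trans (segment_mean_value (e := e / (`|s| + 1)) _) _.
    move=> u us; have /Hd[Au ?] : `|u *: v + x - x| < d; last by split=> //; exact: df.
    rewrite addrK normrZ; apply: le_lt_trans (_ : (`|t| * (`|s| + 1)) * (`|v| + 1) < d).
      rewrite ler_pM // ?lerDl //; apply: le_trans us _.
      by rewrite normrM ler_wpM2l // lerDl.
    by rewrite -ltr_pdivlMr // -ltr_pdivlMr.
  rewrite normrM -mulrA ler_pM2l // ler_pdivrMl // mulrC.
  by rewrite ler_wpM2r // lerDl.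
have add x u v : A x -> 'D_(u + v) f x = 'D_u f x + 'D_v f x.
  move=> Ax; apply: (derive_estimate (l := 'D_u f x + 'D_v f x) _).2 => e e0.
  have u0 : 0 < `|u| + `|v| + 1 by rewrite ltr_wpDl // addr_ge0.
  have [d1 d10 H1] := near_ball x (e / 2) u Ax (divr_gt0 e0 (ltr0Sn R 1)).
  have [d2 d20 H2] := near_ball x (e / 2) v Ax (divr_gt0 e0 (ltr0Sn R 1)).
  exists (Num.min d1 d2 / (`|u| + `|v| + 1)); first by rewrite divr_gt0 // lt_min d10.
  move=> t; rewrite ltr_pdivlMr // lt_min => /andP[t1 t2].
  have -> : f (t *: (u + v) + x) - f x - t *: ('D_u f x + 'D_v f x)
    = (f (t *: v + (t *: u + x)) - f (t *: u + x) - t * 'D_v f x)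
      + (f (t *: u + x) - f x - t * 'D_u f x).
    have -> : t *: (u + v) + x = t *: v + (t *: u + x).
      by rewrite scalerDr addrA; congr (_ + _); exact: addrC.
    by rewrite -[t *: ('D_u f x + _)]/(t * _); ring.
  apply: le_trans (ler_normD _ _) _; rewrite [e]splitr mulrDl; apply: lerD.
    apply: segment_mean_value => r rt.
    have /H2[Ay ?] : `|r *: v + (t *: u + x) - x| < d2; last by split=> //; exact: df.
    rewrite addrA addrK; apply: le_lt_trans t2; apply: le_trans (ler_normD _ _) _.
    rewrite !normrZ; apply: le_trans (_ : `|t| * `|v| + `|t| * `|u| <= _).
      by rewrite lerD2r ler_wpM2r.
    by rewrite -mulrDr ler_wpM2l // addrC lerDl.
  apply: segment_mean_value => r rt.
  have /H1[Ay ?] : `|r *: u + x - x| < d1; last by split=> //; exact: df.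
  rewrite addrK; apply: le_lt_trans t1; rewrite normrZ ler_pM //.
  by rewrite -addrA lerDl addr_ge0.
have DE x w : A x -> 'D_w f x = \sum_i phi i w * 'D_(b i) f x.
  move=> Ax; rewrite {1}(phiE w); elim/big_rec2: _ => [|i y1 y2 _ <-].
    by rewrite derive0.
  by rewrite add // hom.
pose K i := s2val (cid2 (bphi i)).
have K0 i : 0 < K i by rewrite /K; case: cid2.
have KP i x : `|phi i x| <= K i * `|x| by rewrite /K; case: cid2.
split.
  split=> [s x y|]; first by rewrite add // hom.
  exists (1 + \sum_i K i * `|'D_(b i) f a|).
    by rewrite ltr_pwDl // sumr_ge0 // => i _; rewrite mulr_ge0 // ltW.
  move=> x; rewrite DE // (le_trans (ler_norm_sum _ _ _)) //.
  apply: le_trans (_ : (\sum_i K i * `|'D_(b i) f a|) * `|x| <= _).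
    by rewrite mulr_suml ler_sum // => i _; rewrite normrM mulrAC ler_wpM2r.
  by rewrite ler_wpM2r // lerDr.
move=> e e0; pose S := 1 + \sum_i K i.
have S0 : 0 < S by rewrite ltr_pwDl // sumr_ge0 // => i _; rewrite ltW.
have [d d0 Hd] : exists2 d, 0 < d & forall i y, `|y - a| < d ->
    A y /\ `|'D_(b i) f y - 'D_(b i) f a| <= e / S.
  pose D i := s2val (cid2 (near_ball a (e / S) (b i) Aa (divr_gt0 e0 S0))).
  have D0 i : 0 < D i by rewrite /D; case: cid2.
  have DP i y : `|y - a| < D i -> A y /\ `|'D_(b i) f y - 'D_(b i) f a| <= e / S.
    by rewrite /D; case: cid2 => ? ? H; exact: H.
  exists (\big[Num.min/1]_i D i).
    by elim/big_ind: _ => // x y x0 y0; rewrite lt_min x0.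
  move=> i y yd; apply: DP; apply: lt_le_trans yd _.
  by rewrite (bigD1 i) //= ge_min lexx.
have [d' d'0 Hd'] := near_ball a 1 0 Aa ltr01.
(* With a third of the radius, the segment joining two points near a stays in the larger ball. *)
pose r := Num.min d d' / 3.
have r0 : 0 < r by rewrite divr_gt0 // lt_min d0.
exists r => // x y xr yr.
have near_a t : `|t| <= `|1 : R| -> `|t *: (x - y) + y - a| < Num.min d d'.
  rewrite normr1 => t1; rewrite -addrA; apply: le_lt_trans (ler_normD _ _) _.
  have xy : `|x - y| < r + r.
    rewrite -(subrKA a); apply: le_lt_trans (ler_normD _ _) _.
    by apply: ltrD => //; rewrite distrC.
  have -> : Num.min d d' = (r + r) + r by rewrite /r; field.
  apply: ler_ltD => //; rewrite normrZ; apply: le_trans (ltW xy).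
  by rewrite -[leRHS]mul1r ler_wpM2r.
have := @segment_mean_value V f y (x - y) 1 ('D_(x - y) f a) (e * `|x - y|).
rewrite scale1r subrK mul1r normr1 mulr1; apply=> t t1.
have := near_a t; rewrite normr1 => /(_ t1); rewrite lt_min => /andP[td td'].
have Ay := (Hd' _ td').1; split; first exact: df.
rewrite !DE // -sumrB; apply: le_trans (ler_norm_sum _ _ _) _.
apply: le_trans (_ : \sum_i (K i * `|x - y|) * (e / S) <= _).
  apply: ler_sum => i _; rewrite -mulrBr normrM ler_pM //; exact: (Hd i _ td).2.
rewrite -mulr_suml -mulr_suml mulrAC ler_wpM2r // mulrCA -[leRHS]mulr1 ler_pM2l //.
by rewrite ler_pdivrMr // mul1r /S lerDr.
Qed.

End StrictDifferentiability.

Section FiniteDimension.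
Variable R : realType.

Lemma norm_coord n (x : 'rV[R]_n) i : `|x 0 i| <= `|x|.
Proof.
rewrite [leRHS]/Num.Def.normr /= mx_normrE.
exact: (le_bigmax _ (fun ij : 'I_1 * 'I_n => `|x ij.1 ij.2|) (0, i)).
Qed.

Lemma fdim_rV n : fdim ('rV[R]_n : normedModType R).
Proof.
exists 'I_n, (fun i => delta_mx 0 i), (fun i (x : 'rV[R]_n) => x 0 i); split.
- by move=> i a x y; rewrite !mxE.
- by move=> i; exists 1 => // x; rewrite mul1r norm_coord.
- exact: row_sum_delta.
Qed.

Lemma bounded_linear_coord n (i : 'I_n) : bounded_linear (fun x : 'rV[R]_n => x 0 i).
Proof.
split=> [s x y|]; first by rewrite !mxE.
by exists 1 => // x; rewrite mul1r norm_coord.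
Qed.

Lemma linear_bounded n (W : normedModType R) (f : 'rV[R]_n -> W) :
  linear f -> bounded_linear f.
Proof.
move=> lf; split=> //.
pose g := HB.pack_for {linear 'rV[R]_n -> W} f (GRing.isLinear.Build _ _ _ _ _ lf).
exists (1 + \sum_i `|f (delta_mx 0 i)|); first by rewrite ltr_pwDl // sumr_ge0.
move=> x; rewrite {1}(row_sum_delta x) -[f]/(g : _ -> _) linear_sum.
apply: le_trans (ler_norm_sum _ _ _) _; rewrite mulrDl mul1r mulr_suml.
apply: le_trans (_ : \sum_i `|f (delta_mx 0 i)| * `|x| <= _); last by rewrite lerDr.
by apply: ler_sum => i _; rewrite linearZ normrZ mulrC ler_wpM2l // norm_coord.
Qed.

Lemma bounded_linear_fst (V W : normedModType R) :
  bounded_linear (fst : (V * W)%type -> V).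
Proof. by split=> //; exists 1 => // -[x y]; rewrite mul1r prod_normE le_max lexx. Qed.

Lemma bounded_linear_snd (V W : normedModType R) :
  bounded_linear (snd : (V * W)%type -> W).
Proof. by split=> //; exists 1 => // -[x y]; rewrite mul1r prod_normE le_max lexx orbT. Qed.

Lemma bounded_linear_inl (V W : normedModType R) :
  bounded_linear (fun x : V => (x, 0 : W) : V * W).
Proof.
split=> [a x y|]; first by congr pair; rewrite /= ?scaler0 ?addr0.
by exists 1 => // x; rewrite mul1r prod_normE ge_max lexx normr0 normr_ge0.
Qed.

Lemma bounded_linear_inr (V W : normedModType R) :
  bounded_linear (fun y : W => (0 : V, y) : V * W).
Proof.
split=> [a x y|]; first by congr pair; rewrite /= ?scaler0 ?addr0.
by exists 1 => // x; rewrite mul1r prod_normE ge_max lexx normr0 normr_ge0.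
Qed.

Lemma bounded_linear_scalel (V : normedModType R) (v : V) :
  bounded_linear (fun r : R => r *: v).
Proof.
split=> [a x y|]; first by rewrite scalerDl scalerA.
exists (`|v| + 1); first by rewrite ltr_wpDl.
by move=> r; rewrite normrZ mulrC ler_wpM2r // lerDl.
Qed.

Lemma fdim_prod (V W : normedModType R) :
  fdim V -> fdim W -> fdim ((V * W)%type : normedModType R).
Proof.
move=> [I [e [phi [lphi bphi phiE]]]] [J [e' [phi' [lphi' bphi' phiE']]]].
exists (I + J)%type, (fun k => match k with inl i => (e i, 0) | inr j => (0, e' j) end),
  (fun k x => match k with inl i => phi i x.1 | inr j => phi' j x.2 end); split.
- by case=> [i|j] a x y /=; rewrite ?lphi ?lphi'.
- case=> [i|j].
    have [K K0 KP] := bphi i; exists K => // -[x y] /=; apply: le_trans (KP x) _.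
    by rewrite ler_pM2l // prod_normE le_max lexx.
  have [K K0 KP] := bphi' j; exists K => // -[x y] /=; apply: le_trans (KP y) _.
  by rewrite ler_pM2l // prod_normE le_max lexx orbT.
move=> [x y]; rewrite big_sumType /=.
have -> : \sum_i phi i x *: ((e i, 0) : V * W) = (x, 0).
  rewrite [in RHS](phiE x) (blin_sum (bounded_linear_inl V W)).
  by apply: eq_bigr => i _; rewrite -(blinZ (bounded_linear_inl V W)).
have -> : \sum_i phi' i y *: ((0, e' i) : V * W) = (0, y).
  rewrite [in RHS](phiE' y) (blin_sum (bounded_linear_inr V W)).
  by apply: eq_bigr => i _; rewrite -(blinZ (bounded_linear_inr V W)).
by congr pair; rewrite /= ?addr0 ?add0r.
Qed.

End FiniteDimension.

(** * Stability of C^k maps *)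

Section CkCalculus.
Variable R : realType.

Lemma derive_blin (U V W : normedModType R) (f : U -> V) (L : V -> W) x v :
  bounded_linear L -> derivable f x v ->
  derivable (L \o f) x v /\ 'D_v (L \o f) x = L ('D_v f x).
Proof.
move=> bL df.
have cv : (fun h => h^-1 *: (((L \o f) \o shift x) (h *: v) - (L \o f) x)) @ 0^'
    --> L ('D_v f x).
  have -> : (fun h => h^-1 *: (((L \o f) \o shift x) (h *: v) - (L \o f) x))
      = L \o (fun h => h^-1 *: ((f \o shift x) (h *: v) - f x)).
    by apply/funext => h /=; rewrite (blinZ bL) (blinB bL).
  by apply: continuous_cvg; [exact: (sdiff_continuous (blin_sdiff _ bL))|exact: df].
by split; [apply/cvg_ex; eexists; exact: cv|apply/cvg_lim].
Qed.

Lemma sdiffD (V W : normedModType R) (f g : V -> W) a L M :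
  sdiff f a L -> sdiff g a M -> sdiff (fun x => f x + g x) a (fun x => L x + M x).
Proof.
move=> [[lL [K K0 KL]] sL] [[lM [K' K'0 KM]] sM]; split.
  split=> [c x y|]; first by rewrite lL lM scalerDr addrACA.
  exists (K + K'); first exact: addr_gt0.
  by move=> x; rewrite mulrDl (le_trans (ler_normD _ _)) // lerD.
move=> e e0; have [d d0 H] := sL (e / 2) (divr_gt0 e0 (ltr0Sn R 1)).
have [d' d'0 H'] := sM (e / 2) (divr_gt0 e0 (ltr0Sn R 1)).
exists (Num.min d d'); first by rewrite lt_min d0.
move=> x y; rewrite !lt_min => /andP[x1 x2] /andP[y1 y2].
have -> : f x + g x - (f y + g y) - (L (x - y) + M (x - y))
   = (f x - f y - L (x - y)) + (g x - g y - M (x - y)).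
  by rewrite !opprD (addrACA (f x)) [LHS]addrACA.
by rewrite [e]splitr mulrDl (le_trans (ler_normD _ _)) // lerD // ?H ?H'.
Qed.

Lemma sdiff0 (V W : normedModType R) (a : V) : sdiff (fun _ : V => 0 : W) a (fun=> 0).
Proof.
apply: blin_sdiff; split; first by move=> c x y; rewrite scaler0 addr0.
by exists 1 => // x; rewrite normr0 mul1r.
Qed.

Lemma sdiff_sum (V W : normedModType R) I (r : seq I) (f : I -> V -> W) a L :
  (forall i, sdiff (f i) a (L i)) ->
  sdiff (fun x => \sum_(i <- r) f i x) a (fun x => \sum_(i <- r) L i x).
Proof.
move=> H; elim: r => [|i r IH].
  under eq_fun do rewrite big_nil.
  by under [X in sdiff _ _ X]eq_fun do rewrite big_nil; exact: sdiff0.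
under eq_fun do rewrite big_cons.
by under [X in sdiff _ _ X]eq_fun do rewrite big_cons; exact: sdiffD.
Qed.

Lemma C1_sdiff (V W : normedModType R) (A : set V) (f : V -> W) (a : V) :
  fdim V -> fdim W -> open A -> A a -> Ck_on 1 A f ->
  sdiff f a (fun v => 'D_v f a).
Proof.
move=> fV [I [e [phi [lphi bphi phiE]]]] oA Aa [_ Cf].
have bl i : bounded_linear (phi i) by split; [exact: lphi|exact: bphi].
have df x v : A x -> derivable f x v by move=> Ax; exact: (Cf v).1.
have H i : sdiff (fun x => phi i (f x) *: e i) a (fun v => phi i ('D_v f a) *: e i).
  have -> : (fun v => phi i ('D_v f a) *: e i)
     = (fun r : R => r *: e i) \o (fun v => 'D_v (phi i \o f) a).
    by apply/funext => v /=; rewrite (derive_blin (bl i) (df a v Aa)).2.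
  apply: (@sdiff_comp _ _ _ _ (phi i \o f) (fun r : R => r *: e i)); last first.
    exact/blin_sdiff/bounded_linear_scalel.
  apply: (C1_sdiff_scalar fV oA Aa) => x v Ax.
    exact: (derive_blin (bl i) (df x v Ax)).1.
  have E : {near x, (phi i \o 'D_v f) =1 (fun y => 'D_v (phi i \o f) y)}.
    have : \forall y \near x, A y by exact: open_nbhs_nbhs.
    by apply: filterS => y Ay /=; rewrite (derive_blin (bl i) (df y v Ay)).2.
  apply: (cvg_trans (near_eq_cvg E)).
  rewrite (derive_blin (bl i) (df x v Ax)).2; apply: continuous_comp.
    exact: ((Cf v).2.1 x Ax).
  exact: (sdiff_continuous (blin_sdiff _ (bl i))).
have := sdiff_sum (index_enum I) H.
rewrite (_ : (fun x => \sum_i _) = f); last by apply/funext => x; rewrite -phiE.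
by rewrite (_ : (fun x => \sum_i _) = (fun v => 'D_v f a)) //; apply/funext => x; rewrite -phiE.
Qed.

Lemma Ck_onS (V W : normedModType R) k (A B : set V) (f : V -> W) :
  B `<=` A -> Ck_on k A f -> Ck_on k B f.
Proof.
move=> BA; elim: k f => [|k IH] f [cf Cf]; split=> //.
- by move=> x /BA; exact: cf.
- by move=> x /BA; exact: cf.
- move=> v; have [df Df] := Cf v; split; last exact: IH.
  by move=> x /BA; exact: df.
Qed.

Lemma Ck_on_cover (V W : normedModType R) k (A : set V) (f : V -> W) :
  (forall x, A x -> exists2 B, B x & Ck_on k B f) -> Ck_on k A f.
Proof.
elim: k f => [|k IH] f H; split=> //.
- by move=> x /H[B Bx [cf _]]; exact: cf.
- by move=> x /H[B Bx [cf _]]; exact: cf.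
- move=> v; split; first by move=> x /H[B Bx [_ Cf]]; exact: (Cf v).1.
  by apply: IH => x /H[B Bx [_ Cf]]; exists B => //; exact: (Cf v).2.
Qed.

Lemma Ck_onW (V W : normedModType R) k (A : set V) (f : V -> W) :
  Ck_on k.+1 A f -> Ck_on k A f.
Proof.
elim: k f => [|k IH] f [cf Cf]; split=> // v; have [df Df] := Cf v.
by split=> //; exact: IH.
Qed.

Lemma Ck_on_eq (V W : normedModType R) k (A : set V) (f g : V -> W) :
  open A -> (forall x, A x -> f x = g x) -> Ck_on k A f -> Ck_on k A g.
Proof.
move=> oA; elim: k f g => [|k IH] f g fg [cf Cf].
all: have near_fg x : A x -> {near x, f =1 g}
  by move=> Ax; have : \forall y \near x, A y; [exact: open_nbhs_nbhs|exact: filterS].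
all: split=> //.
all: try (by move=> x Ax; apply: (cvg_trans (near_eq_cvg (near_fg x Ax)));
  rewrite -fg //; exact: cf).
move=> v; have [df Df] := Cf v; split.
  by move=> x Ax; apply: near_eq_derivable (near_fg x Ax) _; exact: df.
apply: IH Df => x Ax; exact: near_eq_derive (near_fg x Ax).
Qed.

Lemma Ck_on_cst (V W : normedModType R) k (A : set V) (c : W) : Ck_on k A (fun _ : V => c).
Proof.
elim: k c => [|k IH] c; split=> //.
- by move=> x _; exact: cvg_cst.
- by move=> x _; exact: cvg_cst.
- move=> v; split; first by move=> x _; exact: derivable_cst.
  by under eq_fun do rewrite derive_cst; exact: IH.
Qed.

Lemma Ck_on_blin (V W : normedModType R) k (A : set V) (L : V -> W) :
  bounded_linear L -> Ck_on k A L.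
Proof.
move=> bL; case: k => [|k]; split=> //.
- by move=> x _; exact: (sdiff_continuous (blin_sdiff _ bL)).
- by move=> x _; exact: (sdiff_continuous (blin_sdiff _ bL)).
- move=> v; split; first by move=> x _; exact: (sdiff_derive v (blin_sdiff x bL)).1.
  rewrite (_ : (fun x => 'D_v L x) = fun=> L v); first exact: Ck_on_cst.
  by apply/funext => x; exact: (sdiff_derive v (blin_sdiff x bL)).2.
Qed.

Lemma Ck_on_blin_comp (U V W : normedModType R) k (A : set U) (f : U -> V) (L : V -> W) :
  open A -> bounded_linear L -> Ck_on k A f -> Ck_on k A (fun x => L (f x)).
Proof.
move=> oA bL; elim: k f => [|k IH] f [cf Cf]; split=> //.
1,2: move=> x Ax; apply: continuous_comp; first exact: cf;
  exact: (sdiff_continuous (blin_sdiff _ bL)).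
move=> v; have [df Df] := Cf v; split.
  by move=> x Ax; exact: (derive_blin bL (df x Ax)).1.
apply: (Ck_on_eq oA _ (IH _ Df)) => x Ax.
by rewrite -(derive_blin bL (df x Ax)).2.
Qed.

Lemma Ck_onD (V W : normedModType R) k (A : set V) (f g : V -> W) :
  open A -> Ck_on k A f -> Ck_on k A g -> Ck_on k A (fun x => f x + g x).
Proof.
move=> oA; elim: k f g => [|k IH] f g [cf Cf] [cg Cg]; split=> //.
1,2: by move=> x Ax; apply: cvgD; [exact: cf|exact: cg].
move=> v; have [df Df] := Cf v; have [dg Dg] := Cg v; split.
  by move=> x Ax; apply: derivableD; [exact: df|exact: dg].
apply: (Ck_on_eq oA _ (IH _ _ Df Dg)) => x Ax.
by rewrite -deriveD //; [exact: df|exact: dg].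
Qed.

Lemma Ck_on_sum (V W : normedModType R) k (A : set V) I (r : seq I) (f : I -> V -> W) :
  open A -> (forall i, Ck_on k A (f i)) -> Ck_on k A (fun x => \sum_(i <- r) f i x).
Proof.
move=> oA H; elim: r => [|i r IH].
  by under eq_fun do rewrite big_nil; exact: Ck_on_cst.
by under eq_fun do rewrite big_cons; exact: Ck_onD.
Qed.

Lemma derive_scale (V W : normedModType R) (r : V -> R) (f : V -> W) x v :
  {for x, continuous f} -> derivable r x v -> derivable f x v ->
  derivable (fun y => r y *: f y) x v /\
  'D_v (fun y => r y *: f y) x = 'D_v r x *: f x + r x *: 'D_v f x.
Proof.
move=> cf dr df.
have cl : (fun h : R => f (h *: v + x)) @ 0^' --> f x.
  have E : (fun h : R => h *: v + x) @ 0^' --> x.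
    rewrite -[X in _ --> X]add0r -[in X in _ --> X](scale0r v).
    apply: cvgD; last exact: cvg_cst.
    apply: cvgZr_tmp; apply: cvg_within_filter; exact: cvg_id.
  exact: (cvg_comp _ _ E cf).
have cv : (fun h => h^-1 *: (((fun y => r y *: f y) \o shift x) (h *: v) - r x *: f x)) @ 0^'
    --> 'D_v r x *: f x + r x *: 'D_v f x.
  have -> : (fun h => h^-1 *: (((fun y => r y *: f y) \o shift x) (h *: v) - r x *: f x))
    = (fun h => (h^-1 * (r (h *: v + x) - r x)) *: f (h *: v + x)
         + r x *: (h^-1 *: (f (h *: v + x) - f x))).
    apply/funext => h /=; rewrite scalerA [r x * _]mulrC -!scalerA -scalerDr; congr (_ *: _).
    by rewrite scalerBl scalerBr addrA subrK.
  apply: cvgD; first by apply: cvgZ => //; exact: dr.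
  by apply: cvgZl_tmp; exact: df.
by split; [apply/cvg_ex; eexists; exact: cv|apply/cvg_lim].
Qed.

Lemma Ck_on_scale (V W : normedModType R) k (A : set V) (r : V -> R) (f : V -> W) :
  open A -> Ck_on k A r -> Ck_on k A f -> Ck_on k A (fun x => r x *: f x).
Proof.
move=> oA; elim: k r f => [|k IH] r f Cr Cf; have [cr dr] := Cr; have [cf df] := Cf; split=> //.
1,2: by move=> x Ax; apply: cvgZ; [exact: cr|exact: cf].
move=> v; have [dr' Dr] := dr v; have [df' Df] := df v; split.
  by move=> x Ax; exact: (derive_scale (cf x Ax) (dr' x Ax) (df' x Ax)).1.
have := Ck_onD oA (IH _ _ Dr (Ck_onW Cf)) (IH _ _ (Ck_onW Cr) Df).
apply: Ck_on_eq => // x Ax.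
by rewrite (derive_scale (cf x Ax) (dr' x Ax) (df' x Ax)).2.
Qed.

(** The chain rule writes the derivative of the composite as a sum of coordinates of ['D_v g] times
    ['D_(e i) f] composed with g, to which the induction applies. *)
Lemma Ck_on_comp (U V W : normedModType R) k (A : set U) (B : set V) (g : U -> V) (f : V -> W) :
  fdim U -> fdim V -> fdim W -> open A -> open B -> (forall x, A x -> B (g x)) ->
  Ck_on k A g -> Ck_on k B f -> Ck_on k A (f \o g).
Proof.
move=> fU fV fW oA oB AB; elim: k f g AB => [|k IH] f g AB Cg Cf;
  have [cg dg] := Cg; have [cf df] := Cf; split=> //.
1,2: by move=> x Ax; apply: continuous_comp; [exact: cg|exact/cf/AB].
move=> v; have [dg' Dg] := dg v.
have C1 j (X Y : normedModType R) (C : set X) (h : X -> Y) : Ck_on j.+1 C h -> Ck_on 1 C h.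
  by elim: j => // j IHj /Ck_onW.
have sg x : A x -> sdiff g x (fun v => 'D_v g x) by move=> Ax; exact: (C1_sdiff fU fV oA Ax (C1 _ _ _ _ _ Cg)).
have sf x : A x -> sdiff f (g x) (fun v => 'D_v f (g x)).
  by move=> Ax; exact: (C1_sdiff fV fW oB (AB x Ax) (C1 _ _ _ _ _ Cf)).
have sfg x Ax := sdiff_derive v (sdiff_comp (sg x Ax) (sf x Ax)).
split; first by move=> x Ax; exact: (sfg x Ax).1.
have [I [e [phi [lphi bphi phiE]]]] := fV.
have bl i : bounded_linear (phi i) by split; [exact: lphi|exact: bphi].
have := Ck_on_sum (index_enum I) oA (fun i => Ck_on_scale oA (Ck_on_blin_comp oA (bl i) Dg)
   (IH _ g AB (Ck_onW Cg) (df (e i)).2)).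
apply: Ck_on_eq => // x Ax; rewrite (sfg x Ax).2 /=.
have [bL _] := sf x Ax.
rewrite [in RHS](phiE ('D_v g x)) (blin_sum bL).
by apply: eq_bigr => i _; rewrite (blinZ bL).
Qed.

End CkCalculus.

Section LocalSurjectivity.
Variable R : realType.

(* Instead of iterating Newton's method, minimise |y - f (a + K w)| over a
   compact ball: a nonzero residual r could be decreased by moving w to w + r. *)
Lemma local_surjectivity (V : normedModType R) p (f : V -> 'rV[R]_p) (a : V)
    (L : V -> 'rV[R]_p) (K : 'rV[R]_p -> V) :
  sdiff f a L -> bounded_linear K -> (forall w, L (K w) = w) ->
  forall e, 0 < e -> exists2 d, 0 < d & forall y, `|y - f a| < d ->
    exists2 w, `|w| <= e & f (a + K w) = y.
Proof.
move=> [bL sL] bK LK e e0; have [lK [C C0 KC]] := bK.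
have C20 : 0 < (2 * C)^-1 by rewrite invr_gt0 mulr_gt0.
have [dl dl0 Hd] := sL _ C20.
pose g w := f (a + K w).
have gE w w' : `|w| < dl / C -> `|w'| < dl / C ->
    `|g w - g w' - (w - w')| <= `|w - w'| / 2.
  have small u : `|u| < dl / C -> `|a + K u - a| < dl.
    by move=> uC; rewrite addrC addKr; apply: le_lt_trans (KC u) _; rewrite mulrC -ltr_pdivlMr.
  move=> /small wd /small wd'; have := Hd _ _ wd wd'.
  rewrite opprD addrACA subrr add0r -(blinB bK) LK => /le_trans; apply.
  apply: le_trans (_ : (2 * C)^-1 * (C * `|w - w'|) <= _); first by rewrite ler_pM2l.
  by rewrite invfM mulrA divfK ?gt_eqF // mulrC.
pose e' := Num.min e (dl / C / 2).
have e'0 : 0 < e' by rewrite lt_min e0 !divr_gt0.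
have e'd : e' < dl / C.
  rewrite (@le_lt_trans _ _ (dl / C / 2)) ?ge_min ?lexx ?orbT //.
  by rewrite ltr_pdivrMr // ltr_pMr ?divr_gt0 // ltr1n.
(* The residual at the minimiser is at most e' / 8, which forces |w0| <= e' / 2, so w0 + r is still
   in the ball. *)
exists (e' / 8); first by rewrite divr_gt0.
move=> y ya; have g0 : g 0 = f a by rewrite /g (blin0 bK) addr0.
pose A := [set w : 'rV[R]_p | `|w| <= e'].
have A0 : A !=set0 by exists 0; rewrite /A /= normr0 ltW.
have cA : compact A.
  apply: bounded_closed_compact.
    exists e'; split; first exact: num_real.
    by move=> x ex w /= /le_trans; apply; exact: ltW.
  rewrite (_ : A = closed_ball_ Num.norm 0 e'); first exact: closed_closed_ball_.
  by apply/funext => w; rewrite /A /closed_ball_ /= sub0r normrN.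
have cg w : A w -> {for w, continuous (fun u => `|y - g u|)}.
  move=> /= wA; have wd := le_lt_trans wA e'd.
  apply: continuous_estimate => eps eps0.
  have r0 : 0 < Num.min (dl / C - `|w|) (eps / 2).
    by rewrite lt_min subr_gt0 wd divr_gt0.
  exists (Num.min (dl / C - `|w|) (eps / 2)) => // u; rewrite lt_min => /andP[uw1 uw2].
  have ud : `|u| < dl / C.
    by rewrite -(subrK w u); apply: le_lt_trans (ler_normD _ _) _; rewrite -ltrBrDr.
  apply: le_trans (ler_dist_dist _ _) _; rewrite opprB addrC addrA subrK distrC.
  rewrite -[g u - g w](subrK (u - w)); apply: le_trans (ler_normD _ _) _.
  have := gE u w ud wd; move: uw2; set q := `|u - w|; set s := `|_ - _ - _|.
  have : 0 <= q by exact: normr_ge0.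
  by lra.
have [w0 w0A Hw0] : exists2 c, c \in A & forall t, t \in A -> `|y - g c| <= `|y - g t|.
  apply: (@EVT_min_rV R p (fun w => `|y - g w|) A A0 cA).
  apply: continuous_in_subspaceT => w /set_mem wA.
  exact: cg.
have := w0A; rewrite inE /A /= => w0e.
exists w0; first by rewrite (le_trans w0e) // ge_min lexx.
apply/eqP; rewrite -/(g w0) eq_sym -subr_eq0 -normr_eq0; set r := y - g w0.
have in0 : `|0 : 'rV[R]_p| < dl / C by rewrite normr0 divr_gt0.
have hr : `|r| <= `|y - f a|.
  by rewrite -g0; apply: Hw0; rewrite inE /A /= normr0 ltW.
have w0s : `|w0| <= e' / 2.
  have := gE w0 0 (le_lt_trans w0e e'd) in0; rewrite subr0 g0 => H.
  have H1 : `|w0| <= `|g w0 - f a - w0| + `|g w0 - f a|.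
    have E : w0 = (g w0 - f a) - (g w0 - f a - w0) by rewrite subKr.
    by rewrite {1}E (le_trans (ler_normB _ _)) // addrC.
  have H2 : `|g w0 - f a| <= `|r| + `|y - f a|.
    have -> : g w0 - f a = (y - f a) - r by rewrite /r opprB [RHS]addrC addrA subrK.
    by rewrite (le_trans (ler_normB _ _)) // addrC.
  by lra.
have w1A : `|w0 + r| <= e'.
  by apply: le_trans (ler_normD _ _) _; lra.
have := gE _ _ (le_lt_trans w1A e'd) (le_lt_trans w0e e'd).
rewrite [w0 + r]addrC addrK => H3.
have : `|r| <= `|r| / 2.
  apply: le_trans (Hw0 (w0 + r) _) _; first by rewrite inE.
  have -> : y - g (w0 + r) = - (g (r + w0) - g w0 - r).
    have rg : r + g w0 = y by rewrite /r subrK.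
    by rewrite -rg [RHS]opprB opprB [RHS]addrA [w0 + r]addrC.
  by rewrite normrN.
by have := normr_ge0 r; rewrite eq_le; lra.
Qed.

End LocalSurjectivity.

Section SmoothAt.
Variable R : realType.

(** The neighbourhood is hidden, so that composites through charts need not carry their domains
    along. *)
Definition smooth_at (V W : normedModType R) (f : V -> W) (a : V) :=
  exists A : set V, [/\ open A, A a & smooth_on A f].

Lemma smooth_at_eq (V W : normedModType R) (f g : V -> W) a :
  {near a, f =1 g} -> smooth_at f a -> smooth_at g a.
Proof.
move=> fg [A [oA Aa sA]]; pose B := [set x | f x = g x]^° `&` A.
have oB : open B by apply: openI => //; exact: open_interior.
exists B; split=> // k; apply: (Ck_on_eq oB (f := f)).
  by move=> x [/interior_subset].
by apply: Ck_onS (sA k) => x [].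
Qed.

Lemma smooth_at_comp (U V W : normedModType R) (g : U -> V) (f : V -> W) a :
  fdim U -> fdim V -> fdim W -> smooth_at g a -> smooth_at f (g a) ->
  smooth_at (f \o g) a.
Proof.
move=> fU fV fW [A [oA Aa sA]] [B [oB Bga sB]].
pose C := A `&` g @^-1` B.
have oC : open C.
  rewrite openE => x [Ax Bgx]; apply: filterI; first exact: open_nbhs_nbhs.
  by apply: ((sA 0%N).1 x Ax); exact: open_nbhs_nbhs.
exists C; split=> // k; apply: (@Ck_on_comp _ _ _ _ _ C B) => //.
- by move=> x [].
- by apply: Ck_onS (sA k) => x [].
Qed.

Lemma smooth_at_blin (V W : normedModType R) (L : V -> W) a :
  bounded_linear L -> smooth_at L a.
Proof. by move=> bL; exists setT; split=> [||k]; [exact: openT| |exact: Ck_on_blin]. Qed.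

Lemma smooth_at_cst (V W : normedModType R) (c : W) (a : V) :
  smooth_at (fun=> c) a.
Proof. by exists setT; split=> [||k]; [exact: openT| |exact: Ck_on_cst]. Qed.

Lemma smooth_at_pair (U V W : normedModType R) (f : U -> V) (g : U -> W) a :
  smooth_at f a -> smooth_at g a -> smooth_at (fun x => (f x, g x)) a.
Proof.
move=> [A [oA Aa sA]] [B [oB Ba sB]]; have oC := openI oA oB.
exists (A `&` B); split=> // k.
have := Ck_onD oC
  (Ck_on_blin_comp oC (bounded_linear_inl V W) (Ck_onS (@subIsetl _ A B) (sA k)))
  (Ck_on_blin_comp oC (bounded_linear_inr V W) (Ck_onS (@subIsetr _ A B) (sB k))).
by apply: Ck_on_eq => // x _; congr pair; rewrite /= ?addr0 ?add0r.
Qed.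

Lemma smooth_at_derive (V W : normedModType R) (f : V -> W) a v :
  smooth_at f a -> smooth_at (fun x => 'D_v f x) a.
Proof. by move=> [A [oA Aa sA]]; exists A; split=> // k; exact: ((sA k.+1).2 v).2. Qed.

Lemma smooth_at_sdiff (V W : normedModType R) (f : V -> W) a :
  fdim V -> fdim W -> smooth_at f a -> sdiff f a (fun v => 'D_v f a).
Proof. by move=> fV fW [A [oA Aa sA]]; exact: C1_sdiff (sA 1%N). Qed.

Lemma smooth_at_cont (V W : normedModType R) (f : V -> W) a :
  smooth_at f a -> {for a, continuous f}.
Proof. by move=> [A [oA Aa sA]]; exact: (sA 0%N).1. Qed.

End SmoothAt.

(** * The adjoint representation of a Lie group *)

Section GroupValuedMaps.
Variable R : realType.
Local Open Scope group_scope.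

(** Smoothness into G, tested in every chart around the value; products and inverses can then be
    formed without choosing charts. *)
Definition gsmooth (U : normedModType R) n (G : lieGroup R n) (F : U -> G) (a : U) :=
  {for a, continuous F} /\
  forall d, atlas (l := G) d -> cdom d (F a) -> smooth_at (cmap d \o F) a.

Lemma near_cdom (T : topologicalType) n (G : lieGroup R n) (d : chart R n G) (F : T -> G) a :
  {for a, continuous F} -> cdom d (F a) -> \forall x \near a, cdom d (F x).
Proof. by move=> cF dFa; apply: cF; apply: open_nbhs_nbhs; split=> //; exact: cdom_open. Qed.

Lemma cimg_cmap n (G : lieGroup R n) (d : chart R n G) x : cdom d x -> cimg d (cmap d x).
Proof. by move=> dx; exists x. Qed.

Lemma cinvK n (G : lieGroup R n) (d : chart R n G) y : cimg d y -> cmap d (cinv d y) = y.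
Proof. by move=> [x dx <-]; rewrite cmapK. Qed.

Lemma near_cimg n (G : lieGroup R n) (d : chart R n G) y : cimg d y -> \forall z \near y, cimg d z.
Proof. by move=> dy; apply: open_nbhs_nbhs; split=> //; exact: cimg_open. Qed.

Lemma smooth_in_charts_at m n (M : lieGroup R m) (N : lieGroup R n)
    (c : chart R m M) (d : chart R n N) (f : M -> N) y :
  continuous f -> smooth_in_charts c d f -> cimg c y -> cdom d (f (cinv c y)) ->
  smooth_at (fun y => cmap d (f (cinv c y))) y.
Proof.
move=> cf sf cy dy.
pose A := cmap c @` (cdom c `&` f @^-1` cdom d).
have AE : A = [set z | cimg c z /\ cdom d (f (cinv c z))].
  apply/seteqP; split=> z; first by move=> [x [cx dx] <-]; split; [exists x|rewrite cmapK].
  by move=> [[x cx <-]]; rewrite cmapK // => dx; exists x.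
exists A; split; last exact: sf; last by rewrite AE.
rewrite openE AE => z [cz dz]; apply: filterI; first exact: near_cimg.
apply: (near_cdom (F := f \o cinv c)) => //.
by apply: continuous_comp; [exact: cinv_continuous|exact: cf].
Qed.

Lemma gcontinuous_mul (T : topologicalType) n (G : lieGroup R n) (F F' : T -> G) a :
  {for a, continuous F} -> {for a, continuous F'} ->
  {for a, continuous (fun z => F z * F' z)}.
Proof.
move=> cF cF'; have H : (fun z => (F z, F' z)) @ a --> (F a, F' a) by exact: cvg_pair.
exact: (cvg_comp _ _ H (@lg_mul_continuous _ _ G (F a, F' a))).
Qed.

Lemma gcontinuous_inv (T : topologicalType) n (G : lieGroup R n) (F : T -> G) a :
  {for a, continuous F} -> {for a, continuous (fun z => (F z)^-1)}.
Proof. by move=> cF; exact: (cvg_comp _ _ cF (@lg_inv_continuous _ _ G (F a))). Qed.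

Lemma mul_in_charts_at n (G : lieGroup R n) (b c d : chart R n G) (x y : G) :
  atlas b -> atlas c -> atlas d -> cdom b x -> cdom c y -> cdom d (x * y) ->
  smooth_at (fun z => cmap d (cinv b z.1 * cinv c z.2)) (cmap b x, cmap c y).
Proof.
move=> ab ac ad bx cy dxy.
pose A := [set z : 'rV[R]_n * 'rV[R]_n |
  [/\ cimg b z.1, cimg c z.2 & cdom d (cinv b z.1 * cinv c z.2)]].
exists A; split; last 1 first.
- exact: (@lg_mul_smooth _ _ G b c d ab ac ad).
- rewrite openE => -[u v] [/= bu cv duv].
  have fstc : {for (u, v), continuous (fst : 'rV[R]_n * 'rV[R]_n -> _)} by exact: cvg_fst.
  have sndc : {for (u, v), continuous (snd : 'rV[R]_n * 'rV[R]_n -> _)} by exact: cvg_snd.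
  have H1 : \forall z \near (u, v), cimg b z.1 by apply: fstc; exact: near_cimg.
  have H2 : \forall z \near (u, v), cimg c z.2 by apply: sndc; exact: near_cimg.
  have H3 : \forall z \near (u, v), cdom d (cinv b z.1 * cinv c z.2).
    apply: (near_cdom (F := fun z => cinv b z.1 * cinv c z.2)) => //.
    apply: gcontinuous_mul.
      by apply: (continuous_comp fstc); exact: cinv_continuous.
    by apply: (continuous_comp sndc); exact: cinv_continuous.
  by apply: filterS (filterI H1 (filterI H2 H3)) => z [? [? ?]].
- by rewrite /A /= !cmapK //; split=> //; exact: cimg_cmap.
Qed.

Section Maps.
Variables (U : normedModType R) (fU : fdim U) (n : nat) (G : lieGroup R n).

Lemma gsmooth_mul (F F' : U -> G) a :
  gsmooth F a -> gsmooth F' a -> gsmooth (fun z => F z * F' z) a.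
Proof.
move=> [cF sF] [cF' sF']; split; first exact: gcontinuous_mul.
move=> d ad dF; have [b ab bF] := atlas_cover (F a); have [c ac cFa] := atlas_cover (F' a).
have := @smooth_at_comp R U _ _ (fun z => (cmap b (F z), cmap c (F' z)))
  (fun z => cmap d (cinv b z.1 * cinv c z.2)) a fU (fdim_prod (fdim_rV R n) (fdim_rV R n))
  (fdim_rV R n) (smooth_at_pair (sF b ab bF) (sF' c ac cFa))
  (mul_in_charts_at ab ac ad bF cFa dF).
apply: smooth_at_eq.
apply: filterS (filterI (near_cdom cF bF) (near_cdom cF' cFa)) => z [bz cz] /=.
by rewrite !cmapK.
Qed.

Lemma gsmooth_hom m (M : lieGroup R m) (f : G -> M) (F : U -> G) a :
  lg_smooth f -> gsmooth F a -> gsmooth (f \o F) a.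
Proof.
move=> [cf sf] [cF sF]; split; first exact: (cvg_comp _ _ cF (cf (F a))).
move=> d ad dF; have [b ab bF] := atlas_cover (F a).
have sfb := sf b d ab ad.
have := @smooth_at_comp R U _ _ (cmap b \o F) (fun y => cmap d (f (cinv b y))) a fU
  (fdim_rV R n) (fdim_rV R m) (sF b ab bF).
have /= := smooth_in_charts_at cf sfb (cimg_cmap bF); rewrite cmapK // => /(_ dF) H /(_ H).
apply: smooth_at_eq; apply: filterS (near_cdom cF bF) => z bz /=.
by rewrite cmapK.
Qed.

Lemma gsmooth_inv (F : U -> G) a : gsmooth F a -> gsmooth (fun z => (F z)^-1) a.
Proof.
apply: (@gsmooth_hom n G (fun x => x^-1)); split; first exact: lg_inv_continuous.
exact: lg_inv_smooth.
Qed.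

Lemma gsmooth_cst (x : G) (a : U) : gsmooth (fun=> x) a.
Proof.
by split=> [|d ad dx]; [exact: cvg_cst|exact: (smooth_at_cst (cmap d x) a)].
Qed.

Lemma gsmooth_cinv (c : chart R n G) y :
  atlas c -> cimg c y -> gsmooth (cinv c : 'rV[R]_n -> G) y.
Proof.
move=> ac cy; split; first exact: cinv_continuous.
move=> d ad dy; apply: (@smooth_in_charts_at _ _ G G c d id) => //; last exact: atlas_smooth.
by move=> x; exact: cvg_id.
Qed.

Lemma gsmooth_comp (V : normedModType R) (F : V -> G) (h : U -> V) a :
  fdim V -> smooth_at h a -> gsmooth F (h a) -> gsmooth (F \o h) a.
Proof.
move=> fV sh [cF sF]; split.
  exact: (cvg_comp _ _ (smooth_at_cont sh) cF).
move=> d ad dF; apply: (@smooth_at_comp _ _ _ _ h (cmap d \o F)) => //; first exact: fdim_rV.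
exact: sF.
Qed.

End Maps.

Lemma gsmooth_lg_smooth m n (M : lieGroup R m) (G : lieGroup R n) (f : M -> G) :
  (forall (c : chart R m M) y, atlas c -> cimg c y -> gsmooth (f \o cinv c) y) -> lg_smooth f.
Proof.
move=> H; split=> [x|c d ac ad].
  have [c ac cx] := atlas_cover x.
  have [Hc _] := H c (cmap c x) ac (cimg_cmap cx).
  have E : (f \o cinv c) (cmap c x) = f x by rewrite /= cmapK.
  have Hx := cvg_comp _ _ (@cmap_continuous _ _ _ c x cx) Hc.
  rewrite E in Hx; apply: (cvg_trans _ Hx).
  apply: near_eq_cvg; have : \forall z \near x, cdom c z.
    by apply: (near_cdom (F := id)) => //; exact: cvg_id.
  by apply: filterS => z cz /=; rewrite cmapK.
rewrite /smooth_in_charts /smooth_on => k; apply: Ck_on_cover => y [x [cx dx] <-].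
have [_ /(_ d ad)] := H c (cmap c x) ac (cimg_cmap cx).
rewrite /= cmapK // => /(_ dx)[A [oA Aa sA]].
by exists A => //; exact: sA.
Qed.

End GroupValuedMaps.

(** * Ad and the Lie bracket *)

Section Adjoint.
Variables (R : realType) (n : nat) (G : lieGroup R n).
Variables (c : chart R n G) (c_atlas : atlas (l := G) c) (c_unit : cdom c (1%g : G)).
Local Notation V := 'rV[R]_n.
Local Notation e := (cmap c 1%g).
Local Notation Ad := (Ad c).
Local Notation br := (lie_br c).

Lemma cinv_unit : cinv c e = 1%g.
Proof. exact: cmapK. Qed.

Definition conj_chart (x : G) (y : V) : V := cmap c (x * cinv c y * x^-1)%g.

Lemma AdE x v : Ad x v = 'D_v (conj_chart x) e.
Proof. by []. Qed.

Lemma conj_chart_unit x : conj_chart x e = e.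
Proof. by rewrite /conj_chart cinv_unit mulg1 mulgV. Qed.

Lemma gsmooth_conj x : gsmooth (fun y => x * cinv c y * x^-1)%g e.
Proof.
have fV := fdim_rV R n.
apply: (gsmooth_mul fV); last exact: gsmooth_cst.
apply: (gsmooth_mul fV); first exact: gsmooth_cst.
by apply: gsmooth_cinv => //; exact: cimg_cmap.
Qed.

Lemma smooth_conj_chart x : smooth_at (conj_chart x) e.
Proof. by apply: (gsmooth_conj x).2 => //; rewrite cinv_unit mulg1 mulgV. Qed.

Lemma sdiff_conj_chart x : sdiff (conj_chart x) e (Ad x).
Proof. exact: (smooth_at_sdiff (fdim_rV R n) (fdim_rV R n) (smooth_conj_chart x)). Qed.

Lemma bounded_linear_Ad x : bounded_linear (Ad x).
Proof. by case: (sdiff_conj_chart x). Qed.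

Lemma near_conj_chart x : \forall y \near e,
  cinv c (conj_chart x y) = (x * cinv c y * x^-1)%g.
Proof.
have dc : cdom c (x * cinv c e * x^-1)%g by rewrite cinv_unit mulg1 mulgV.
by apply: filterS (near_cdom (gsmooth_conj x).1 dc) => y cy; rewrite cmapK.
Qed.

Lemma AdM x y v : Ad (x * y)%g v = Ad x (Ad y v).
Proof.
have sx : sdiff (conj_chart x) (conj_chart y e) (Ad x).
  by rewrite conj_chart_unit; exact: sdiff_conj_chart.
have := (sdiff_derive v (sdiff_comp (sdiff_conj_chart y) sx)).2 => /= <-.
apply: near_eq_derive; apply: filterS (near_conj_chart y) => z E.
by rewrite /= /conj_chart -/(conj_chart y z) E invgM !mulgA.
Qed.

Lemma Ad1 v : Ad 1%g v = v.
Proof.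
rewrite AdE -[RHS](derive_id e v); apply: near_eq_derive.
apply: filterS (near_cimg (cimg_cmap c_unit)) => y cy.
by rewrite /conj_chart mul1g invg1 mulg1 cinvK.
Qed.

Definition Ad_chart (v : V) (x : V) : V := Ad (cinv c x) v.

Lemma Ad_chart_unit v : Ad_chart v e = v.
Proof. by rewrite /Ad_chart cinv_unit Ad1. Qed.

Lemma lie_brE u v : br u v = 'D_u (Ad_chart v) e.
Proof. by []. Qed.

(** Ad x v is a partial derivative at the unit, in the second variable, of the smooth map (x, y) ->
    x y x^-1. *)
Lemma smooth_Ad_chart v : smooth_at (Ad_chart v) e.
Proof.
pose f (z : V * V) : V := cmap c (cinv c z.1 * cinv c z.2 * (cinv c z.1)^-1)%g.
have fV := fdim_rV R n; have fVV := fdim_prod fV fV.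
have g1 : gsmooth (fun z : V * V => cinv c z.1) (e, e).
  apply: (@gsmooth_comp _ _ fVV _ G _ (cinv c) fst) => //.
    exact/smooth_at_blin/bounded_linear_fst.
  by apply: gsmooth_cinv => //; exact: cimg_cmap.
have g2 : gsmooth (fun z : V * V => cinv c z.2) (e, e).
  apply: (@gsmooth_comp _ _ fVV _ G _ (cinv c) snd) => //.
    exact/smooth_at_blin/bounded_linear_snd.
  by apply: gsmooth_cinv => //; exact: cimg_cmap.
have [_ sf] : gsmooth (fun z : V * V => cinv c z.1 * cinv c z.2 * (cinv c z.1)^-1)%g (e, e).
  by apply: (gsmooth_mul fVV); [exact: (gsmooth_mul fVV)|exact: (gsmooth_inv fVV)].
have {}sf : smooth_at f (e, e) by apply: (sf c) => //=; rewrite cinv_unit mulg1 mulgV.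
have -> : Ad_chart v = (fun z => 'D_(0, v) f z) \o (fun x => (x, e)).
  apply/funext => x; rewrite /Ad_chart AdE /derive.
  have -> : (fun h : R => h^-1 *: ((conj_chart (cinv c x) \o shift e) (h *: v)
      - conj_chart (cinv c x) e)) =
    (fun h : R => h^-1 *: ((f \o shift (x, e)) (h *: (0, v) : V * V) - f (x, e))).
    by apply/funext => h; rewrite /f /= scaler0 add0r.
  by [].
apply: (smooth_at_comp fV fVV fV); last exact: smooth_at_derive.
apply: smooth_at_pair; last exact: smooth_at_cst.
apply: (@smooth_at_blin _ _ _ (fun x : V => x)); split=> //.
by exists 1 => // x; rewrite mul1r.
Qed.

Lemma sdiff_Ad_chart v : sdiff (Ad_chart v) e (br^~ v).
Proof. exact: (smooth_at_sdiff (fdim_rV R n) (fdim_rV R n) (smooth_Ad_chart v)). Qed.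

Lemma bounded_linear_lie_br v : bounded_linear (br^~ v).
Proof. by case: (sdiff_Ad_chart v). Qed.

Lemma linear_lie_br u : linear (br u).
Proof.
move=> s v w.
have dA z := (sdiff_derive u (sdiff_Ad_chart z)).1.
have -> : br u (s *: v + w) = 'D_u (s *: Ad_chart v + Ad_chart w) e.
  rewrite lie_brE; congr ('D_u _ e); apply/funext => x.
  by rewrite /Ad_chart (bounded_linear_Ad _).1.
by rewrite deriveD ?deriveZ //; exact: derivableZ.
Qed.

Lemma Ad_continuous v : continuous (Ad^~ v).
Proof.
have c1 : {for (1%g : G), continuous (Ad^~ v)}.
  have H := cvg_comp _ _ (@cmap_continuous _ _ _ c _ c_unit) (smooth_at_cont (smooth_Ad_chart v)).
  rewrite Ad_chart_unit in H; change (Ad^~ v @ (1%g : G) --> Ad 1%g v); rewrite Ad1.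
  apply: (cvg_trans _ H); apply: near_eq_cvg.
  have nc : \forall z \near (1%g : G), cdom c z.
    by apply: (near_cdom (F := id)) => //; exact: cvg_id.
  by apply: filterS nc => z cz /=; rewrite /Ad_chart cmapK.
move=> x; have E : Ad^~ v = Ad x \o ((Ad^~ v) \o (fun z => x^-1 * z)%g).
  by apply/funext => z /=; rewrite -AdM mulVKg.
have H1 : (fun z => x^-1 * z)%g @ x --> (1%g : G).
  have H : (fun z => x^-1 * z)%g @ x --> (x^-1 * x)%g.
    by apply: (@gcontinuous_mul R G n G (fun=> x^-1)%g id x); [exact: cvg_cst|exact: cvg_id].
  by rewrite mulVg in H.
have H2 := cvg_comp _ _ H1 c1; rewrite Ad1 in H2.
have := cvg_comp _ _ H2 (sdiff_continuous (blin_sdiff v (bounded_linear_Ad x))).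
by rewrite -E.
Qed.

(** Differentiate Ad (x z x^-1) (Ad x v) = Ad x (Ad z v) in z at the unit. *)
Lemma Ad_lie_br x u v : Ad x (br u v) = br (Ad x u) (Ad x v).
Proof.
have s1 : sdiff (Ad_chart (Ad x v)) (conj_chart x e) (br^~ (Ad x v)).
  by rewrite conj_chart_unit; exact: sdiff_Ad_chart.
have /= <- := (sdiff_derive u (sdiff_comp (sdiff_conj_chart x) s1)).2.
have bA := blin_sdiff (Ad_chart v e) (bounded_linear_Ad x).
have /= <- := (sdiff_derive u (sdiff_comp (sdiff_Ad_chart v) bA)).2.
apply: near_eq_derive; apply: filterS (near_conj_chart x) => z E /=.
by rewrite /Ad_chart E -!AdM mulgVK.
Qed.

(** Differentiate Ad z [v, w] = [Ad z v, Ad z w] in z at the unit; expanding w in coordinates turns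
    the bilinear product rule into one for scalar multiples. *)
Lemma lie_br_leibniz u v w : br u (br v w) = br (br u v) w + br v (br u w).
Proof.
have dA z := sdiff_derive u (sdiff_Ad_chart z).
rewrite [LHS]lie_brE.
have lw (p q : V) : br p q = \sum_i q 0 i *: br p (delta_mx 0 i).
  have lb := linear_lie_br p.
  pose f := HB.pack_for {linear V -> V} (br p) (GRing.isLinear.Build _ _ _ _ _ lb).
  rewrite {1}(row_sum_delta q) -[br p]/(f : V -> V) linear_sum.
  by apply: eq_bigr => i _; rewrite linearZ.
have -> : Ad_chart (br v w) = (fun z => \sum_i (Ad_chart w z 0 i) *: br (Ad_chart v z) (delta_mx 0 i)).
  by apply/funext => z; rewrite /Ad_chart Ad_lie_br -lw.
have D i : derivable (fun z => (Ad_chart w z 0 i) *: br (Ad_chart v z) (delta_mx 0 i)) e u /\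
    'D_u (fun z => (Ad_chart w z 0 i) *: br (Ad_chart v z) (delta_mx 0 i)) e
     = (br u w) 0 i *: br v (delta_mx 0 i) + w 0 i *: br (br u v) (delta_mx 0 i).
  have [d1 D1] := derive_blin (bounded_linear_coord R i) (dA w).1.
  have [d2 D2] := derive_blin (bounded_linear_lie_br (delta_mx 0 i)) (dA v).1.
  have sv : sdiff (br^~ (delta_mx 0 i) \o Ad_chart v) e _ :=
    sdiff_comp (sdiff_Ad_chart v) (blin_sdiff _ (bounded_linear_lie_br _)).
  have [d3 D3] := derive_scale (sdiff_continuous sv) d1 d2.
  split; first exact: d3.
  rewrite D3 D1 D2 (dA w).2 (dA v).2 /= !Ad_chart_unit.
  by move: (br u w 0 i) (br v _) (w 0 i) (br (br u v) _).
have -> : (fun z => \sum_i (Ad_chart w z 0 i) *: br (Ad_chart v z) (delta_mx 0 i)) =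
    \sum_i (fun z => (Ad_chart w z 0 i) *: br (Ad_chart v z) (delta_mx 0 i)).
  by apply/funext => z; rewrite fct_sumE.
rewrite derive_sum => [|i]; last exact: (D i).1.
under eq_bigr => i _ do rewrite (D i).2.
rewrite (lw (br u v) w) (lw v (br u w)).
move: (br u w) (br v) (br (br u v)) => p f g.
by rewrite addrC -big_split.
Qed.

(** Skew-symmetry comes from semisimplicity here, instead of a second-order expansion of the group
    law. *)
Lemma lie_bracket_of_semisimple : lie_semisimple br -> lie_bracket br.
Proof.
apply: lie_bracket_of_leibniz; [exact: linear_lie_br| |exact: lie_br_leibniz].
by move=> v s x y; rewrite (bounded_linear_lie_br v).1.
Qed.

Lemma Ad_bounded : compact [set: G] -> exists2 C, 0 < C & forall x v, `|Ad x v| <= C * `|v|.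
Proof.
move=> cG.
have bd (v : V) : exists M, forall x, `|Ad x v| <= M.
  have [||x _ H] := @compact_EVT_max G R (fun x => `|Ad x v|) setT _ cG.
  - by exists 1%g.
  - apply: continuous_subspaceT => x.
    exact: (cvg_norm (@Ad_continuous v x)).
  - by exists `|Ad x v| => y; apply: H; rewrite inE.
pose M i := sval (cid (bd (delta_mx 0 i))).
have MP i x : `|Ad x (delta_mx 0 i)| <= M i by rewrite /M; case: cid.
have M0 i : 0 <= M i by apply: le_trans (MP i 1%g).
exists (1 + \sum_i M i); first by rewrite ltr_pwDl // sumr_ge0.
move=> x v; rewrite {1}(row_sum_delta v) (blin_sum (bounded_linear_Ad x)).
apply: le_trans (ler_norm_sum _ _ _) _.
apply: le_trans (_ : (\sum_i M i) * `|v| <= _); last by rewrite ler_wpM2r // lerDr.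
rewrite mulr_suml ler_sum // => i _; rewrite (blinZ (bounded_linear_Ad x)) normrZ mulrC.
by rewrite ler_pM // norm_coord.
Qed.

Lemma Ad_estimate u w eps : 0 < eps -> exists2 d, 0 < d & forall t : R, `|t| < d ->
  `|Ad (cinv c (t *: u + e)) w - w - t *: br u w| <= eps * `|t|.
Proof.
move=> eps0; have [bl sA] := sdiff_Ad_chart w.
have u0 : 0 < `|u| + 1 by rewrite ltr_wpDl.
have [d d0 H] := sA (eps / (`|u| + 1)) (divr_gt0 eps0 u0).
exists (d / (`|u| + 1)); first exact: divr_gt0.
move=> t td; have tu : `|t *: u| <= `|t| * (`|u| + 1) by rewrite normrZ ler_wpM2l // lerDl.
have := H (t *: u + e) e; rewrite addrK subrr normr0 (blinZ bl) Ad_chart_unit => /(_ _ d0) H'.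
apply: le_trans (H' _) _; first by apply: le_lt_trans tu _; rewrite -ltr_pdivlMr.
by rewrite -mulrA ler_pM2l // ler_pdivrMl // mulrC.
Qed.

End Adjoint.

(** * One-parameter subgroups as limits of powers *)

Lemma is_derive_estimate (R : realType) (f : R -> R) (df : R) : is_derive (0 : R) 1 f df ->
  forall e, 0 < e -> exists2 d, 0 < d & forall t, `|t| < d -> `|f t - f 0 - t * df| <= e * `|t|.
Proof.
move=> [Df <-] e e0.
have /cvgrPdist_le /(_ e e0) : (fun h => h^-1 *: ((f \o shift 0) (h *: 1) - f 0)) @ 0^' --> 'D_1 f (0 : R).
  exact: Df.
move=> /nbhs_ballP[d /= d0 H]; exists d => // t td.
have [->|tn0] := eqVneq t 0; first by rewrite subrr mul0r subr0 normr0 mulr0.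
have := H t; rewrite /ball /= sub0r normrN => /(_ td tn0).
rewrite /= addr0 /GRing.scale /= mulr1 distrC => H'.
have -> : f t - f 0 - t * 'D_1 f (0:R) = t * (t^-1 * (f t - f 0) - 'D_1 f (0:R)).
  by rewrite mulrBr mulrA mulfV // mul1r.
by rewrite normrM mulrC ler_pM2r // normr_gt0.
Qed.

Lemma bounded_linear_iter (R : realType) (V : normedModType R) (P : V -> V) m :
  bounded_linear P -> bounded_linear (iter m P).
Proof.
move=> bP; elim: m => [|m IH]; last exact: (bounded_linear_comp IH bP).
by split=> //; exists 1 => // x; rewrite mul1r.
Qed.

(** The error bound of Euler's method: since all powers of P are bounded by C, the N one-step errors
    add up without being amplified further. *)
Lemma telescope (R : realType) (V : normedModType R) (P : V -> V) (C eta : R) (Gam : nat -> V) N :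
  bounded_linear P -> 0 <= C -> (forall j y, `|iter j P y| <= C * `|y|) ->
  (forall j, (j < N)%N -> `|Gam j.+1 - P (Gam j)| <= eta) ->
  `|Gam N - iter N P (Gam 0%N)| <= N%:R * (C * eta).
Proof.
move=> bP C0 PC H.
suff /(_ N 0%N (leqnn N)) : forall k m, (k <= N)%N ->
  `|iter m P (Gam k) - iter (m + k) P (Gam 0%N)| <= k%:R * (C * eta) by [].
elim=> [|k IH] m kN; first by rewrite addn0 subrr normr0 mul0r.
have bPm := bounded_linear_iter m bP.
rewrite -[iter m P (Gam k.+1)](subrK (iter m P (P (Gam k)))) -addrA -blinB // -iterSr.
rewrite -addSnnS -natr1 mulrDl mul1r addrC; apply: le_trans (ler_normD _ _) _.
rewrite lerD ?IH //; first exact: ltnW.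
by apply: le_trans (PC _ _) _; rewrite ler_wpM2l // H.
Qed.

(** The real and imaginary parts of exp (s (a + i b)), differentiated at s = 0. *)
Lemma is_derive_spiral (R : realType) (a b : R) :
  is_derive (0 : R) 1 (fun s => expR (s * a) * cos (s * b)) a /\
  is_derive (0 : R) 1 (fun s => expR (s * a) * sin (s * b)) b.
Proof.
have Dm (r : R) : is_derive (0 : R) 1 (fun s => s * r) r.
  by apply: is_derive_eq; rewrite scaler0 add0r /GRing.scale /= mulr1.
have De : is_derive (0 : R) 1 (expR \o (fun s => s * a)) a.
  by apply: is_derive_eq (is_derive1_comp (is_derive_expR _) (Dm a)) _; rewrite mul0r expR0 mul1r.
have Dc : is_derive (0 : R) 1 (cos \o (fun s => s * b)) 0.
  by apply: is_derive_eq (is_derive1_comp (is_derive_cos _) (Dm b)) _; rewrite mul0r sin0 oppr0 mul0r.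
have Ds : is_derive (0 : R) 1 (sin \o (fun s => s * b)) b.
  by apply: is_derive_eq (is_derive1_comp (is_derive_sin _) (Dm b)) _; rewrite mul0r cos0 mul1r.
split.
  apply: is_derive_eq (is_deriveM De Dc) _.
  by rewrite /= /GRing.scale /= !mul0r cos0 mulr0 add0r mul1r.
apply: is_derive_eq (is_deriveM De Ds) _.
by rewrite /= /GRing.scale /= !mul0r sin0 expR0 mul0r addr0 mul1r.
Qed.

Section Orbits.
Variables (R : realType) (n : nat) (G : lieGroup R n).
Hypothesis G_compact : compact [set: G].
Variables (c : chart R n G) (c_atlas : atlas (l := G) c) (c_unit : cdom c (1%g : G)).
Local Notation V := 'rV[R]_n.
Local Notation e := (cmap c 1%g).
Local Notation Ad := (Ad c).
Local Notation br := (lie_br c).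

Lemma bounded_linear_lie_br_r u : bounded_linear (br u).
Proof. exact/linear_bounded/linear_lie_br. Qed.

Lemma Ad_uniform_estimate u eps : 0 < eps -> exists2 d, 0 < d & forall (t : R) w, `|t| < d ->
  `|Ad (cinv c (t *: u + e)) w - w - t *: br u w| <= eps * `|t| * `|w|.
Proof.
move=> eps0; pose eps' := eps / n.+1%:R.
have eps'0 : 0 < eps' by rewrite divr_gt0 ?ltr0n.
pose D i := @Ad_estimate R n G c c_atlas c_unit u (delta_mx 0 i) eps' eps'0.
pose d i := s2val (cid2 (D i)).
have d0 i : 0 < d i by rewrite /d; case: cid2.
have dP i t : `|t| < d i -> `|Ad (cinv c (t *: u + e)) (delta_mx 0 i) - delta_mx 0 i
    - t *: br u (delta_mx 0 i)| <= eps' * `|t|.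
  by move: t; rewrite /d; case: cid2.
exists (\big[Num.min/1]_i d i).
  by elim/big_ind: _ => // x y x0 y0; rewrite lt_min x0.
move=> t w td; have td' i : `|t| < d i.
  by apply: lt_le_trans td _; exact: bigmin_le_cond.
have lin := bounded_linear_lie_br_r u.
have -> : Ad (cinv c (t *: u + e)) w - w - t *: br u w =
  \sum_i w 0 i *: (Ad (cinv c (t *: u + e)) (delta_mx 0 i) - delta_mx 0 i
    - t *: br u (delta_mx 0 i)).
  rewrite {1 2 3}(row_sum_delta w) (blin_sum (bounded_linear_Ad c_atlas c_unit _)).
  rewrite (blin_sum lin) scaler_sumr -!sumrB; apply: eq_bigr => i _.
  rewrite (blinZ (bounded_linear_Ad c_atlas c_unit _)) (blinZ lin) !scalerBr.
  by rewrite !scalerA (mulrC t).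
apply: le_trans (ler_norm_sum _ _ _) _.
apply: le_trans (_ : \sum_(i < n) eps' * `|t| * `|w| <= _).
  apply: ler_sum => i _; rewrite normrZ mulrC ler_pM ?norm_coord //; exact: dP.
rewrite sumr_const card_ord -mulr_natl /eps' !mulrA ler_wpM2r // ler_wpM2r //.
by rewrite ler_pdivrMr ?ltr0n // mulrC ler_pM2l // ler_nat.
Qed.

Definition flow_pt u N : G := (cinv c (N%:R^-1 *: u + e) ^+ N)%g.

(* Solutions on [0, 1] of Gam' = [u, Gam], up to second order. *)
Definition is_orbit_curve u (Gam : R -> V) :=
  (exists M, forall s, 0 <= s <= 1 -> `|Gam s| <= M) /\
  forall eps, 0 < eps -> exists2 d, 0 < d & forall s t, 0 <= s <= 1 -> `|t| < d ->
    `|Gam (s + t) - Gam s - t *: br u (Gam s)| <= eps * `|t|.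

Lemma Ad_expg x k v : Ad (x ^+ k)%g v = iter k (Ad x) v.
Proof.
elim: k => [|k IH]; first by rewrite expg0 Ad1.
by rewrite expgS AdM // IH.
Qed.

(** One factor of the power follows the curve for time 1 / N up to o(1 / N), and boundedness of Ad
    on the compact group keeps the total error small. *)
Lemma orbit_curve_flow u Gam : is_orbit_curve u Gam ->
  forall eps, 0 < eps -> \forall N \near \oo, `|Gam 1 - Ad (flow_pt u N) (Gam 0)| <= eps.
Proof.
move=> [[M HM] H] eps eps0; have [C C0 HC] := Ad_bounded c_atlas c_unit G_compact.
have M0 : 0 <= M by apply: le_trans (HM 0 _); rewrite ?lexx ?ler01.
(* One step costs [e'] t from the curve and at most [e'] t M from Ad; N steps with N t = 1,
   amplified by C, cost eps. *)
pose e' := eps / (C * (1 + M)); have e'0 : 0 < e' by rewrite divr_gt0 // mulr_gt0 // ltr_pwDl.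
have [d1 d10 H1] := H e' e'0; have [d2 d20 H2] := Ad_uniform_estimate u e'0.
have H3 : \forall N \near \oo, `|N.+1%:R^-1 : R| < Num.min d1 d2.
  have /cvgrPdist_lt /(_ (Num.min d1 d2)) := @cvg_harmonic R; rewrite lt_min d10 d20 => /(_ isT).
  by apply: filterS => N; rewrite /= sub0r normrN.
have {H3} : \forall N \near \oo, (0 < N)%N /\ `|N%:R^-1 : R| < Num.min d1 d2.
  case: H3 => N0 _ HN; exists N0.+1 => // -[|N] //= N0N; split=> //; exact: HN.
apply: filterS => N [N0]; rewrite lt_min => /andP[Nd1 Nd2].
set t := N%:R^-1 in Nd1 Nd2; have t0 : 0 < t by rewrite invr_gt0 ltr0n.
set P := Ad (cinv c (t *: u + e)).
have := @telescope R V P C (e' * t * (1 + M)) (fun j => Gam (j%:R * t)) N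
  (bounded_linear_Ad c_atlas c_unit _) (ltW C0).
have Nt : N%:R * t = 1 by rewrite mulfV // pnatr_eq0 -lt0n.
rewrite mul0r Nt /flow_pt Ad_expg -/t -/P => /(_ _ _)/le_trans; apply.
- by move=> j y; rewrite /P -Ad_expg; exact: HC.
- move=> j jN; have jt : 0 <= j%:R * t <= 1.
    apply/andP; split; first by rewrite mulr_ge0 ?ler0n // ltW.
    by rewrite -[leRHS]Nt ler_wpM2r ?(ltW t0) // ler_nat ltnW.
  have := H1 _ _ jt Nd1; have := H2 _ (Gam (j%:R * t)) Nd2.
  rewrite -natr1 mulrDl mul1r -/P (gtr0_norm t0) => E2 E1.
  set x := Gam (j%:R * t + t) in E1 *; set y := Gam (j%:R * t) in E1 E2 *.
  have -> : x - P y = (x - y - t *: br u y) - (P y - y - t *: br u y).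
    by apply/rowP => i; rewrite !mxE; ring.
  apply: le_trans (ler_normB _ _) _; rewrite mulrDr mulr1 lerD //.
  by apply: le_trans E2 _; rewrite ler_wpM2l ?HM // mulr_ge0 ?ltW.
- rewrite mulrCA (_ : N%:R * (e' * t * (1 + M)) = e' * (1 + M)); last first.
    by rewrite -[RHS]mul1r -[in X in _ = X * _]Nt; ring.
  rewrite /e' mulrCA mulrA -mulrA -mulrA mulVf ?mulr1 //.
  by rewrite mulf_neq0 // gt_eqF // ltr_pwDl.
Qed.

(** The constant is independent of u, so replacing u by its multiples bounds an orbit at all
    times. *)
Lemma orbit_curve_bound : exists2 C, 0 < C & forall u Gam, is_orbit_curve u Gam ->
  `|Gam 1| <= C * `|Gam 0|.
Proof.
have [C C0 HC] := Ad_bounded c_atlas c_unit G_compact; exists C => // u Gam oG.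
apply/ler_addgt0Pl => eps eps0; have [N _ /(_ N (leqnn _)) H] := orbit_curve_flow oG eps0.
rewrite -[Gam 1](subrK (Ad (flow_pt u N) (Gam 0))).
by apply: le_trans (ler_normD _ _) _; rewrite lerD.
Qed.

(** The cluster point is chosen before the curve, so a single g serves all of them: each
    [Ad (flow_pt u N) (Gam 0)] converges, and continuity of Ad identifies its limit. *)
Lemma flow_limit u : exists g : G, forall Gam, is_orbit_curve u Gam -> Ad g (Gam 0) = Gam 1.
Proof.
have [g [_ cg]] : exists g, [set: G] g /\ cluster (flow_pt u @ \oo) g.
  by apply: G_compact; exact: filterT.
exists g => Gam oG; apply/eqP; rewrite -subr_eq0 -normr_le0; apply/ler_addgt0Pl => eps eps0.
rewrite addr0; have eps2 : 0 < eps / 2 by rewrite divr_gt0.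
have A1 := orbit_curve_flow oG eps2.
have /cvgrPdist_le /(_ _ eps2) A2 := @Ad_continuous R n G c c_atlas c_unit (Gam 0) g.
have [x [/= X1 X2]] := cg [set x | `|Gam 1 - Ad x (Gam 0)| <= eps / 2] _ A1 A2.
have -> : Ad g (Gam 0) - Gam 1 = (Ad g (Gam 0) - Ad x (Gam 0)) - (Gam 1 - Ad x (Gam 0)).
  by apply/rowP => i; rewrite !mxE; ring.
by rewrite [eps]splitr; apply: le_trans (ler_normB _ _) _; rewrite lerD.
Qed.

(* The curve is the real part of exp (s z) (v + i w), where v + i w is an
   eigenvector of ad u for the eigenvalue z = a + i b. *)
Lemma linear_orbit_curve u v w (a b : R) :
  br u v = a *: v - b *: w -> br u w = b *: v + a *: w ->
  is_orbit_curve u (fun s => (expR (s * a) * cos (s * b)) *: v - (expR (s * a) * sin (s * b)) *: w).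
Proof.
move=> Ev Ew; pose f s := expR (s * a) * cos (s * b); pose g s := expR (s * a) * sin (s * b).
have fg s : `|f s| <= expR (s * a) /\ `|g s| <= expR (s * a).
  rewrite !normrM (gtr0_norm (expR_gt0 _)); split; rewrite ler_piMr ?expR_ge0 // ler_norml.
    by rewrite cos_geN1 cos_le1.
  by rewrite sin_geN1 sin_le1.
have expa s : 0 <= s <= 1 -> expR (s * a) <= expR `|a|.
  move=> /andP[s0 s1]; rewrite ler_expR; apply: le_trans (ler_norm _) _.
  by rewrite normrM (ger0_norm s0) ler_piMl.
have bd s (x y : V) : 0 <= s <= 1 -> `|f s *: x - g s *: y| <= expR `|a| * (`|x| + `|y|).
  move=> s01; have [fs gs] := fg s; have es := expa s s01.
  apply: le_trans (ler_normB _ _) _; rewrite (normrZ (f s)) (normrZ (g s)) mulrDr.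
  by apply: lerD; apply: ler_wpM2r => //; [exact: (le_trans fs)|exact: (le_trans gs)].
split; first by exists (expR `|a| * (`|v| + `|w|)) => s s01; exact: bd.
move=> eps eps0; pose M := expR `|a| * (`|v| + `|w|) + 1.
have M0 : 0 < M by rewrite ltr_wpDl // mulr_ge0 ?expR_ge0 // addr_ge0.
pose e' := eps / (M + M); have e'0 : 0 < e' by rewrite divr_gt0 // addr_gt0.
have [Df Dg] := is_derive_spiral a b.
have [d1 d10 H1] := is_derive_estimate Df e'0.
have [d2 d20 H2] := is_derive_estimate Dg e'0.
exists (Num.min d1 d2); first by rewrite lt_min d10.
move=> s t s01; rewrite lt_min => /andP[/H1 {}H1 /H2 {}H2].
have {}H1 : `|f t - 1 - t * a| <= e' * `|t|.
  by move: H1; rewrite -/(f t) !mul0r expR0 cos0 mulr1.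
have {}H2 : `|g t - t * b| <= e' * `|t|.
  by move: H2; rewrite -/(g t) !mul0r sin0 mulr0 subr0.
rewrite -/(f (s + t)) -/(g (s + t)) -/(f s) -/(g s).
have fD : f (s + t) = f s * f t - g s * g t.
  by rewrite /f /g !mulrDl expRD cosD; ring.
have gD : g (s + t) = g s * f t + f s * g t.
  by rewrite /f /g !mulrDl expRD sinD; ring.
have brE x y : br u (x *: v - y *: w) = x *: br u v - y *: br u w.
  have lin := bounded_linear_lie_br_r u.
  by rewrite (blinB lin) !(blinZ lin).
rewrite fD gD brE Ev Ew; set X := f s *: v - g s *: w; set Y := f s *: w + g s *: v.
have -> : (f s * f t - g s * g t) *: v - (g s * f t + f s * g t) *: w - (f s *: v - g s *: w) -
  t *: (f s *: (a *: v - b *: w) - g s *: (b *: v + a *: w)) =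
  (f t - 1 - t * a) *: X - (g t - t * b) *: Y.
  by apply/rowP => i; rewrite !mxE; ring.
have XM : `|X| <= M by apply: le_trans (bd s v w s01) _; rewrite lerDl.
have YM : `|Y| <= M.
  have := bd s w (- v) s01; rewrite scalerN opprK normrN (addrC `|w|) => /le_trans; apply.
  by rewrite lerDl.
apply: le_trans (ler_normB _ _) _; rewrite (normrZ (f t - 1 - t * a)) (normrZ (g t - t * b)).
apply: le_trans (_ : e' * `|t| * M + e' * `|t| * M <= _).
  by apply: lerD; apply: ler_pM.
rewrite -mulrDr /e' mulrAC divfK //.
by rewrite gt_eqF // addr_gt0.
Qed.

End Orbits.

(** * Consequences of compactness for ad u *)

Section Spectrum.
Variables (R : realType) (n : nat) (G : lieGroup R n).
Hypothesis G_compact : compact [set: G].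
Variables (c : chart R n G) (c_atlas : atlas (l := G) c) (c_unit : cdom c (1%g : G)).
Local Notation V := 'rV[R]_n.
Local Notation Ad := (Ad c).
Local Notation br := (lie_br c).

(** Apply the bound to s u. Combining the curves that start at v and w with weights cos (s b) and
    sin (s b) undoes the rotation and leaves exp (s a) v. *)
Lemma spiral_growth : exists2 C, 0 < C & forall u v w (a b s : R),
  br u v = a *: v - b *: w -> br u w = b *: v + a *: w ->
  expR (s * a) * `|v| <= C * (`|v| + `|w|).
Proof.
have [C C0 HC] := orbit_curve_bound G_compact c_atlas c_unit; exists C => // u v w a b s Ev Ew.
have key v' w' : br u v' = a *: v' - b *: w' -> br u w' = b *: v' + a *: w' ->
    `|(expR (s * a) * cos (s * b)) *: v' - (expR (s * a) * sin (s * b)) *: w'| <= C * `|v'|.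
  move=> Ev' Ew'; have bl x := bounded_linear_lie_br c_atlas c_unit x.
  have := @linear_orbit_curve R n G c c_atlas c_unit (s *: u) v' w' (s * a) (s * b).
  rewrite (blinZ (bl v')) (blinZ (bl w')) Ev' Ew' scalerBr scalerDr !scalerA => /(_ erefl erefl).
  by move=> /HC; rewrite !mul1r !mul0r expR0 cos0 sin0 mulr1 mulr0 scale1r scale0r subr0.
have k1 := key v w Ev Ew; have := key w (- v); rewrite !scalerN !opprK.
have bu := bounded_linear_lie_br_r c_atlas c_unit u.
rewrite (blinN bu) Ev Ew opprB => /(_ (addrC _ _) erefl) k2.
have -> : expR (s * a) * `|v| = `|cos (s * b) *: ((expR (s * a) * cos (s * b)) *: v - (expR (s * a) * sin (s * b)) *: w)
   + sin (s * b) *: ((expR (s * a) * cos (s * b)) *: w + (expR (s * a) * sin (s * b)) *: v)|.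
  rewrite -[LHS](_ : `|expR (s * a) *: v| = _); last by rewrite normrZ gtr0_norm ?expR_gt0.
  congr (`| _ |); rewrite -[v in LHS]scale1r -(cos2Dsin2 (s * b)).
  by apply/rowP => i; rewrite !mxE; ring.
apply: le_trans (ler_normD _ _) _; rewrite !normrZ mulrDr; apply: lerD.
  by apply: le_trans k1; rewrite ler_piMl // ler_norml cos_geN1 cos_le1.
by apply: le_trans k2; rewrite ler_piMl // ler_norml sin_geN1 sin_le1.
Qed.

Lemma spiral_growth0 u v w (a b : R) :
  br u v = a *: v - b *: w -> br u w = b *: v + a *: w -> a != 0 -> v = 0.
Proof.
move=> Ev Ew a0; apply/eqP; apply: contraT; rewrite -normr_gt0 => v0.
have [C C0 /(_ u v w a b _ Ev Ew) H] := spiral_growth.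
(* For this s, exp (s a) >= 1 + s a exceeds C (|v| + |w|) / |v|. *)
have := H (C * (`|v| + `|w|) / `|v| / a); rewrite divfK // -ler_pdivlMr //.
by rewrite leNgt (lt_le_trans _ (expR_ge1Dx _)) // ltr_pwDl.
Qed.

Lemma eigenvalue_imaginary u v w (a b : R) :
  br u v = a *: v - b *: w -> br u w = b *: v + a *: w ->
  a = 0 \/ (v = 0 /\ w = 0).
Proof.
move=> Ev Ew; have [->|a0] := eqVneq a 0; [by left|right; split].
  exact: (spiral_growth0 Ev Ew).
apply: (@spiral_growth0 u w (- v) a b) => //; first by rewrite scalerN opprK Ew addrC.
have bu := bounded_linear_lie_br_r c_atlas c_unit u.
by rewrite (blinN bu) Ev opprB scalerN.
Qed.

(** Here the orbit of w is the affine line w + s [u, w], which is bounded only if [u, w] = 0. *)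
Lemma lie_br_square0 u w : br u (br u w) = 0 -> br u w = 0.
Proof.
move=> E; apply/eqP; rewrite -normr_le0.
have [C C0 HC] := orbit_curve_bound G_compact c_atlas c_unit.
have bl x := bounded_linear_lie_br c_atlas c_unit x.
have bu x := bounded_linear_lie_br_r c_atlas c_unit x.
have key (k : R) : `|w + k *: br u w| <= C * `|w|.
  have : is_orbit_curve c (k *: u) (fun s => w + s *: (k *: br u w)).
    split.
      exists (`|w| + `|k *: br u w|) => s /andP[s0 s1].
      apply: le_trans (ler_normD _ _) _; rewrite lerD // normrZ ger0_norm //.
      by rewrite ler_piMl.
    move=> eps eps0; exists 1 => // s t _ _.
    rewrite (blinD (bu _)) !(blinZ (bu _)) !(blinZ (bl _)) E !scaler0 addr0.
    rewrite (_ : _ - _ = 0) ?normr0 ?mulr_ge0 // 1?ltW //.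
    by apply/rowP => i; rewrite !mxE; ring.
  by move=> /HC; rewrite scale1r scale0r addr0.
rewrite leNgt; apply/negP => b0.
(* With this factor the multiple of [u, w] has norm (C + 1) |w| + 1, too long for its sum with w to
   have norm at most C |w|. *)
have K0 : 0 < ((C + 1) * `|w| + 1) / `|br u w|.
  by rewrite divr_gt0 // ltr_wpDl // mulr_ge0 // addr_ge0 // ltW.
have := key (((C + 1) * `|w| + 1) / `|br u w|).
rewrite leNgt => /negP; apply.
have H : `|(((C + 1) * `|w| + 1) / `|br u w|) *: br u w| = (C + 1) * `|w| + 1.
  by rewrite normrZ gtr0_norm // divfK // gt_eqF.
have := ler_normB (w + (((C + 1) * `|w| + 1) / `|br u w|) *: br u w) w.
rewrite addrAC subrr add0r H => H'.
by move: H'; rewrite mulrDl mul1r; set x := `|_ + _|; lra.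
Qed.

Lemma flow_rotation u : exists g : G, forall v w (b : R),
  br u v = - (b *: w) -> br u w = b *: v ->
  Ad g v = cos b *: v - sin b *: w.
Proof.
have [g Hg] := flow_limit G_compact c_atlas c_unit u; exists g => v w b Ev Ew.
have := @linear_orbit_curve R n G c c_atlas c_unit u v w 0 b.
rewrite Ev Ew scale0r sub0r scale0r addr0 => /(_ erefl erefl) /Hg.
by rewrite !mul0r !mul1r expR0 cos0 sin0 mulr1 mulr0 scale1r scale0r subr0 !mul1r.
Qed.

End Spectrum.

(** * The complexified Lie algebra *)

Lemma trig_det0 (F : fieldType) n (A : 'M[F]_n) i : is_trig_mx A ->
  \det (A - (A i i)%:M) = 0.
Proof.
move=> /is_trig_mxP tA; rewrite det_trig.
  by rewrite (bigD1 i) //= !mxE eqxx mulr1n subrr mul0r.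
apply/is_trig_mxP => j k jk; rewrite !mxE tA //.
by rewrite -(inj_eq val_inj) ltn_eqF // mulr0n subr0.
Qed.

Section ComplexVectors.
Variables (R : realType) (n : nat).
Local Notation VR := 'rV[R]_n.
Local Notation VC := 'rV[R[i]]_n.
Implicit Types (X Y : VC) (u v : VR) (z : R[i]).

Lemma reV_add X Y : reV (X + Y) = reV X + reV Y.
Proof. by apply/rowP => i; rewrite !mxE; case: (X 0 i) (Y 0 i) => ? ? []. Qed.

Lemma imV_add X Y : imV (X + Y) = imV X + imV Y.
Proof. by apply/rowP => i; rewrite !mxE; case: (X 0 i) (Y 0 i) => ? ? []. Qed.

Lemma reV_opp X : reV (- X) = - reV X.
Proof. by apply/rowP => i; rewrite !mxE; case: (X 0 i). Qed.

Lemma imV_opp X : imV (- X) = - imV X.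
Proof. by apply/rowP => i; rewrite !mxE; case: (X 0 i). Qed.

Lemma reV_scale z X : reV (z *: X) = complex.Re z *: reV X - complex.Im z *: imV X.
Proof. by apply/rowP => i; rewrite !mxE; case: z (X 0 i) => ? ? []. Qed.

Lemma imV_scale z X : imV (z *: X) = complex.Re z *: imV X + complex.Im z *: reV X.
Proof. by apply/rowP => i; rewrite !mxE; case: z (X 0 i) => ? ? [] ? ? /=; rewrite addrC mulrC. Qed.

Lemma reV_toC u : reV (toC u) = u.
Proof. by apply/rowP => i; rewrite !mxE. Qed.

Lemma imV_toC u : imV (toC u) = 0.
Proof. by apply/rowP => i; rewrite !mxE. Qed.

Lemma reV_conj X : reV (conjV X) = reV X.
Proof. by apply/rowP => i; rewrite !mxE; case: (X 0 i). Qed.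

Lemma imV_conj X : imV (conjV X) = - imV X.
Proof. by apply/rowP => i; rewrite !mxE; case: (X 0 i). Qed.

Lemma reV_iC X : reV (iC R *: X) = - imV X.
Proof. by rewrite reV_scale /= scale0r scale1r sub0r. Qed.

Lemma imV_iC X : imV (iC R *: X) = reV X.
Proof. by rewrite imV_scale /= scale0r scale1r add0r. Qed.

Lemma reim_inj X Y : reV X = reV Y -> imV X = imV Y -> X = Y.
Proof.
move=> /rowP H /rowP K; apply/rowP => i; move: (H i) (K i); rewrite !mxE.
by case: (X 0 i) (Y 0 i) => ? ? [? ?] /= -> ->.
Qed.

Lemma reV_pair u v : reV (toC u + iC R *: toC v) = u.
Proof. by rewrite reV_add reV_iC reV_toC imV_toC oppr0 addr0. Qed.

Lemma imV_pair u v : imV (toC u + iC R *: toC v) = v.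
Proof. by rewrite imV_add imV_iC reV_toC imV_toC add0r. Qed.

Lemma toC_reim X : X = toC (reV X) + iC R *: toC (imV X).
Proof. by apply: reim_inj; rewrite ?reV_pair ?imV_pair. Qed.

Lemma conjVE X : conjV X = map_mx Num.conj X.
Proof. by []. Qed.

Lemma iCE : iC R = 'i%R.
Proof. exact: complexiE. Qed.

Lemma conj_fixed X : conjV X = X -> X = toC (reV X).
Proof.
move=> XX; apply: reim_inj; rewrite ?reV_toC ?imV_toC //.
have : imV X = - imV X by rewrite -imV_conj XX.
by move=> /eqP; rewrite -addr_eq0 -mulr2n -scaler_nat scaler_eq0 pnatr_eq0 /= => /eqP.
Qed.

Lemma toCD u v : toC (u + v) = toC u + toC v.
Proof. exact: map_mxD. Qed.

Lemma toC0 : toC (0 : VR) = 0.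
Proof. exact: map_mx0. Qed.

Definition reimE := (reV_add, imV_add, reV_opp, imV_opp, reV_iC, imV_iC,
  reV_toC, imV_toC, reV_conj, imV_conj, reV_pair, imV_pair).

End ComplexVectors.

Section ComplexBracket.
Variables (R : realType) (n : nat).
Local Notation VR := 'rV[R]_n.
Local Notation VC := 'rV[R[i]]_n.
Variable br : VR -> VR -> VR.
Hypothesis brL : lie_bracket br.
Local Notation cbr := (cplx_br br).
Local Notation cj := (map_mx Num.conj).

Lemma reV_cbr X Y : reV (cbr X Y) = br (reV X) (reV Y) - br (imV X) (imV Y).
Proof. by rewrite reV_pair. Qed.

Lemma imV_cbr X Y : imV (cbr X Y) = br (reV X) (imV Y) + br (imV X) (reV Y).
Proof. by rewrite imV_pair. Qed.

Lemma cbr_toC u v : cbr (toC u) (toC v) = toC (br u v).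
Proof.
by apply: reim_inj; rewrite ?reV_cbr ?imV_cbr !reimE !(lie_br0 brL, lie_0br brL) ?subr0 ?addr0.
Qed.

Let brE := (lie_brDl brL, lie_brDr brL, lie_brZl brL, lie_brZr brL, lie_brNl brL, lie_brNr brL).

Lemma cplx_br_lie : lie_bracket cbr.
Proof.
split.
- move=> X z Y Z; apply: reim_inj; rewrite !(reV_cbr, imV_cbr, reimE, reV_scale, imV_scale) !brE.
    by apply/rowP => i; rewrite !mxE; ring.
  by apply/rowP => i; rewrite !mxE; ring.
- move=> X z Y Z; apply: reim_inj; rewrite !(reV_cbr, imV_cbr, reimE, reV_scale, imV_scale) !brE.
    by apply/rowP => i; rewrite !mxE; ring.
  by apply/rowP => i; rewrite !mxE; ring.
- move=> X Y; apply: reim_inj; rewrite !(reV_cbr, imV_cbr, reimE).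
    rewrite (lie_brC brL (reV Y)) (lie_brC brL (imV Y)); apply/rowP => i; rewrite !mxE; ring.
  rewrite (lie_brC brL (reV Y)) (lie_brC brL (imV Y)); apply/rowP => i; rewrite !mxE; ring.
- move=> X Y Z; apply: reim_inj; rewrite !(reV_cbr, imV_cbr, reimE) !brE.
    rewrite !(lie_jacobi brL (reV X)) !(lie_jacobi brL (imV X)).
    by apply/rowP => i; rewrite !mxE; ring.
  rewrite !(lie_jacobi brL (reV X)) !(lie_jacobi brL (imV X)).
  by apply/rowP => i; rewrite !mxE; ring.
Qed.

Lemma conj_cbr X Y : conjV (cbr X Y) = cbr (conjV X) (conjV Y).
Proof.
apply: reim_inj; rewrite !(reV_cbr, imV_cbr, reimE) !brE ?opprK //.
by rewrite -opprD.
Qed.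

Lemma adm_toC u : adm cbr (toC u) = map_mx (real_complex R) (adm br u).
Proof.
have E i : delta_mx 0 i = toC (delta_mx 0 i : VR).
  by apply/rowP => j; rewrite !mxE; case: (_ && _).
apply/row_matrixP => i; rewrite !rowE (mul_adm cplx_br_lie) E cbr_toC.
by rewrite -(mul_adm brL) /toC map_mxM.
Qed.

Hypothesis imaginary : forall u v w (a b : R),
  br u v = a *: v - b *: w -> br u w = b *: v + a *: w -> a = 0 \/ (v = 0 /\ w = 0).
Hypothesis square0 : forall u w, br u (br u w) = 0 -> br u w = 0.
Hypothesis semisimple : lie_semisimple br.

Lemma centre0 u : (forall y, br u y = 0) -> u = 0.
Proof.
move=> uZ; apply/eqP; rewrite -memv0.
have <- : (<[u]> = 0)%VS; last exact: memv_line.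
have H (U : {vspace VR}) : lie_brv br U <[u]> = 0%VS.
  apply/eqP; rewrite -subv0; apply/(lie_brvP brL) => x y _ /vlineP[k ->].
  by rewrite (lie_brC brL) (lie_brZl brL) uZ scaler0 oppr0 mem0v.
by apply: semisimple; [split; rewrite ?subvf ?H ?sub0v|exists 1%N; rewrite /= H].
Qed.

(** [square0] lowers the order of nilpotency step by step to ad u = 0, and a semisimple algebra has
    no centre. *)
Lemma nilpotent_centre0 u k : adm cbr (toC u) ^+ k = 0 -> u = 0.
Proof.
move=> Ak; apply: centre0; have {}Ak w : iter k (br u) w = 0.
  have H j (X : VC) : X *m adm cbr (toC u) ^+ j = iter j (cbr (toC u)) X.
    elim: j X => [|j IH] X; first by rewrite expr0 mulmx1.
    by rewrite exprSr mulmxA IH (mul_adm cplx_br_lie).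
  have := H k (toC w); rewrite Ak mulmx0.
  have -> : iter k (cbr (toC u)) (toC w) = toC (iter k (br u) w).
    by elim: {H Ak} k => //= k ->; rewrite cbr_toC.
  by move=> /(congr1 (@reV _ _)); rewrite -(toC0 R n) !reV_toC.
elim: k Ak => [|[|k] IH] Ak y //; first by rewrite [y]Ak (lie_br0 brL).
  exact: (Ak y).
by apply: IH => w; apply: square0; exact: (Ak w).
Qed.

Lemma eigenvalue_imaginaryC u (X : VC) (z : R[i]) :
  cbr (toC u) X = z *: X -> X != 0 -> complex.Re z = 0.
Proof.
move=> E X0; have E1 := congr1 (@reV _ _) E; have E2 := congr1 (@imV _ _) E.
move: E1 E2; rewrite reV_cbr imV_cbr !reimE !(lie_0br brL) subr0 addr0 reV_scale imV_scale.
move=> E1; rewrite addrC => E2; case: (imaginary E1 E2) => // -[x0 y0].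
by move: X0; rewrite (toC_reim X) x0 y0 toC0 scaler0 addr0 eqxx.
Qed.

Lemma killing_toC u v : killing cbr (toC u) (toC v) = real_complex R (killing br u v).
Proof. by rewrite !killingE !adm_toC -map_mxM trace_map_mx. Qed.

(** In triangular form the trace of (ad u)^2 is minus the sum of the squares of the imaginary parts
    of the eigenvalues. If it is zero, all eigenvalues vanish and ad u is nilpotent. *)
Lemma killing_negative u : u != 0 -> killing br u u < 0.
Proof.
move=> u0; rewrite -ltcR -killing_toC killingE.
set A := adm cbr (toC u); have [P uP tP] := trigonal_form A.
set T := P *m A *m invmx P in tP.
have [tT dT] := trig_expr 2 tP; rewrite -(mxtrace_conj _ uP) -[A *m A](_ : A ^+ 2 = _) //.
rewrite -expr_conj // -/T.
have dI i : complex.Re (T i i) = 0.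
  have : eigenvalue A (T i i).
    rewrite /eigenvalue /eigenspace kermx_eq0 row_free_unit unitmxE unitfE negbK.
    have : \det (P *m (A - (T i i)%:M) *m invmx P) = 0.
      have -> : P *m (A - (T i i)%:M) *m invmx P = T - (T i i)%:M.
        by rewrite mulmxBr mulmxBl scalar_mxC mulmxK.
      exact: trig_det0.
    by rewrite !det_mulmx mulrAC -det_mulmx mulmxV // det1 mul1r => ->.
  move=> /eigenvalueP[X]; rewrite (mul_adm cplx_br_lie).
  exact: eigenvalue_imaginaryC.
have d2 i : (T ^+ 2) i i = real_complex R (- (complex.Im (T i i)) ^+ 2).
  rewrite dT; move: (dI i); case: (T i i) => a b /= ->.
  by rewrite expr2; congr Complex; ring.
rewrite /mxtrace (eq_bigr _ (fun i _ => d2 i)) -rmorph_sum ltcR sumrN oppr_lt0.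
rewrite lt_neqAle sumr_ge0 ?andbT => [|i _]; last exact: sqr_ge0.
apply: contra_neq u0 => /esym/eqP; rewrite psumr_eq0 => [/allP H|i _]; last exact: sqr_ge0.
apply: (@nilpotent_centre0 u n); rewrite -/A.
have T0 : T ^+ n = 0.
  apply: trig_diag0_nilpotent => // i; have /eqP := H i (mem_index_enum _).
  by move=> /eqP; rewrite sqrf_eq0 => /eqP im0; move: (dI i) im0; case: (T i i) => a b /= -> ->.
have := expr_conj A n uP; rewrite -/T T0 => /(congr1 (fun M => invmx P *m M *m P)).
by rewrite mulmx0 mul0mx !mulmxA mulVmx // mul1mx mulmxKV // => ->.
Qed.

Lemma herm_pos (X : VC) : X != 0 -> 0 < - killing cbr X (cj X).
Proof.
move=> X0; have cL := cplx_br_lie.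
have E : - killing cbr X (cj X) =
    real_complex R (- killing br (reV X) (reV X) - killing br (imV X) (imV X)).
  have -> : cj X = toC (reV X) + iC R *: toC (- imV X).
    by rewrite -conjVE; apply: reim_inj; rewrite !reimE ?oppr0 ?addr0 ?add0r.
  rewrite {1}(toC_reim X) !(killingDl cL, killingDr cL, killingZl cL, killingZr cL).
  rewrite !killing_toC ![killing br _ (- _)]killingC !(killingNl brL).
  rewrite (killingC br (imV X) (reV X)).
  by apply/eqP; rewrite eq_complex /=; apply/andP; split; apply/eqP; ring.
rewrite E ltcR -opprD oppr_gt0.
have [x0|x0] := eqVneq (reV X) 0.
  rewrite x0 (killing0l brL) add0r killing_negative //.
  by apply: contra_neq X0 => y0; rewrite (toC_reim X) x0 y0 toC0 scaler0 addr0.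
rewrite ltr_wnDr // ?killing_negative //.
by have [->|/killing_negative/ltW //] := eqVneq (imV X) 0; rewrite (killing0l brL).
Qed.

End ComplexBracket.

(** * Cube roots of unity *)

Section Rotations.
Variable R : realType.

Definition expi (t : R) : R[i] := Complex (cos t) (sin t).

Lemma expiD s t : expi (s + t) = expi s * expi t.
Proof. by rewrite /expi cosD sinD; congr Complex; exact: addrC. Qed.

Lemma expi0 : expi 0 = 1.
Proof. by rewrite /expi cos0 sin0. Qed.

Lemma expi_2pi_nat m : expi (2 * pi * m%:R) = 1.
Proof.
elim: m => [|m IH]; first by rewrite mulr0 expi0.
rewrite -(natr1 m) mulrDr mulr1 expiD IH mul1r /expi.
by rewrite mulrC mulr_natr cos2pi sin2pi.
Qed.

Lemma expi_2pi (m : int) : expi (2 * pi * m%:~R) = 1.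
Proof.
case: m => m; first exact: expi_2pi_nat.
rewrite NegzE mulrNz mulrN -[LHS]mul1r -(expi_2pi_nat m.+1) -expiD.
by rewrite -[m.+1%:~R]/(m.+1%:R) subrr expi0 expi_2pi_nat.
Qed.

Lemma omega3E : omega3 R = expi (2 * pi / 3). Proof. by []. Qed.

Lemma expi_third (m : int) r : expi (2 * pi / 3 * (3 * m + r%:Z)%:~R) = omega3 R ^+ r.
Proof.
have -> : 2 * pi / 3 * (3 * m + r%:Z)%:~R = 2 * pi * m%:~R + 2 * pi / 3 * r%:R :> R.
  by rewrite rmorphD rmorphM /=; field.
rewrite expiD expi_2pi mul1r omega3E; elim: r => [|r IH]; first by rewrite mulr0 expi0.
by rewrite -(natr1 r) mulrDr mulr1 expiD IH exprSr.
Qed.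

Lemma sin_third_gt0 : 0 < sin (2 * pi / 3 : R).
Proof.
have p0 := pi_gt0 R; by apply: sin_gt0_pi; apply/andP; split; lra.
Qed.

Lemma omega3_exp3 : omega3 R ^+ 3 = 1.
Proof.
rewrite -(expi_third 0 3) mulr0 add0r; transitivity (expi (2 * pi * 1%:~R)).
  by congr expi; rewrite -[3%:Z%:~R]/(3%:R) divfK ?mulr1 // pnatr_eq0.
exact: expi_2pi.
Qed.

Lemma omega3_neq1 : omega3 R != 1.
Proof.
by apply/eqP => /(congr1 (@complex.Im R)) /= /eqP; rewrite gt_eqF // sin_third_gt0.
Qed.

Lemma omega3_sum : omega3 R ^+ 2 + omega3 R + 1 = 0.
Proof.
have /eqP : (omega3 R - 1) * (omega3 R ^+ 2 + omega3 R + 1) = 0.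
  by transitivity (omega3 R ^+ 3 - 1); [ring|rewrite omega3_exp3 subrr].
by rewrite mulf_eq0 subr_eq0 (negbTE omega3_neq1) => /eqP.
Qed.

(** Read off the imaginary part of omega^2 + omega + 1 = 0, after division by the nonzero sine. *)
Lemma cos_third : cos (2 * pi / 3 : R) = - (2^-1).
Proof.
have := congr1 (@complex.Im R) omega3_sum; rewrite /= => /eqP.
set s := sin _; set c := cos _ => /eqP E.
have {}E : s * (2 * c + 1) = 0 by rewrite -[RHS]E /=; ring.
have s0 : s != 0 by rewrite gt_eqF // sin_third_gt0.
by move/eqP: E; rewrite mulf_eq0 (negbTE s0) /= => /eqP E; lra.
Qed.

Lemma sin_third : sin (2 * pi / 3 : R) = Num.sqrt 3 / 2.
Proof.
have s0 := sin_third_gt0; rewrite -[LHS]gtr0_norm // -sqrtr_sqr sin2cos2 cos_third.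
have -> : 1 - (- (2^-1)) ^+ 2 = 3 * (2^-1) ^+ 2 :> R by field.
by rewrite sqrtrM // sqrtr_sqr ger0_norm.
Qed.

End Rotations.

Section ComplexLinear.
Variables (R : realType) (n : nat).
Local Notation VR := 'rV[R]_n.
Local Notation VC := 'rV[R[i]]_n.
Variable A : VR -> VR.
Hypothesis linA : linear A.
Local Notation sigma := (cplx_map A).

Lemma reV_cplx_map X : reV (sigma X) = A (reV X).
Proof. by rewrite reV_pair. Qed.

Lemma imV_cplx_map X : imV (sigma X) = A (imV X).
Proof. by rewrite imV_pair. Qed.

Lemma linear_cplx_map : linear sigma.
Proof.
pose f := HB.pack_for {linear VR -> VR} A (GRing.isLinear.Build _ _ _ _ _ linA).
move=> z X Y; rewrite -[A]/(f : VR -> VR).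
apply: reim_inj; rewrite !(reV_cplx_map, imV_cplx_map, reimE, reV_scale, imV_scale).
  by rewrite -[A]/(f : VR -> VR) linearD linearB !linearZ.
by rewrite -[A]/(f : VR -> VR) !linearD !linearZ.
Qed.

Lemma cplx_map_toC u : sigma (toC u) = toC (A u).
Proof.
pose f := HB.pack_for {linear VR -> VR} A (GRing.isLinear.Build _ _ _ _ _ linA).
apply: reim_inj; rewrite !(reV_cplx_map, imV_cplx_map, reimE) //.
by rewrite -[A]/(f : VR -> VR) linear0.
Qed.

End ComplexLinear.

Lemma int_sum_range (R : realType) n (W : int -> set 'rV[R[i]]_n) M (z : 'I_M -> 'rV[R[i]]_n) (a : int) :
  (forall k, W k 0) -> (forall i : 'I_M, W ((i : nat)%:Z + a) (z i)) -> int_sum W (\sum_i z i).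
Proof.
move=> W0 Wz.
pose f (k : int) := oapp z 0 (insub `|k - a|%N : option 'I_M).
(* The sign test in [g] separates a + i from a - i, which [f] cannot tell apart; outside the range
   the value is 0. *)
exists [seq (i : nat)%:Z + a | i <- iota 0 M]; pose g k := if 0 <= k - a then f k else 0.
exists g; split.
- by rewrite map_inj_uniq ?iota_uniq // => i j /addIr [].
- move=> k; rewrite /g; case: ifP => // ka; rewrite /f; case: insubP => // i _ ik.
  by have := Wz i; rewrite ik gez0_abs // subrK.
- rewrite big_map -[M in iota 0 M]subn0 -/(index_iota 0 M) big_mkord.
  apply: eq_bigr => i _; rewrite /g addrK /= /f addrK absz_nat.
  by rewrite insubT //= => iM; congr z; apply: val_inj.
Qed.

(** Orthogonality of the characters of Z/3. The exponent 3 - r stands for -r. *)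
Lemma omega3_filter (R : realType) r s : (r < 3)%N -> (s < 3)%N ->
  1 + omega3 R ^+ (3 - r) * omega3 R ^+ s + (omega3 R ^+ (3 - r) * omega3 R ^+ s) ^+ 2
  = if s == r then 3 else 0.
Proof.
have w3 := omega3_exp3 R; have ws := omega3_sum R; rewrite -exprD.
have w4 : omega3 R ^+ 4 = omega3 R by rewrite exprSr w3 mul1r.
have w5 : omega3 R ^+ 5 = omega3 R ^+ 2 by rewrite (exprD _ 3 2) w3 mul1r.
have ws' : 1 + omega3 R + omega3 R ^+ 2 = 0 by rewrite -ws; ring.
have ws2 : 1 + omega3 R ^+ 2 + omega3 R ^+ 2 ^+ 2 = 0 by rewrite -exprM w4 -ws; ring.
case: r => [|[|[|]]] //; case: s => [|[|[|]]] //= _ _;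
  by rewrite ?(w3, w4, w5, expr1n, expr1); first [exact: ws' | exact: ws2 | ring].
Qed.

(** * The canonical rotation and its three eigenspaces *)

Section CanonicalRotation.
Variables (R : realType) (n : nat).
Local Notation VR := 'rV[R]_n.
Local Notation VC := 'rV[R[i]]_n.
Variable br : VR -> VR -> VR.
Hypothesis brL : lie_bracket br.
Hypothesis imaginary : forall u v w (a b : R),
  br u v = a *: v - b *: w -> br u w = b *: v + a *: w -> a = 0 \/ (v = 0 /\ w = 0).
Hypothesis square0 : forall u w, br u (br u w) = 0 -> br u w = 0.
Hypothesis semisimple : lie_semisimple br.
Variables p lplus : {vspace VC}.
Hypothesis p_parabolic : lie_parabolic (cplx_br br) p.
Hypothesis lplus_nilradical : lie_nilradical (cplx_br br) lplus p.
Local Notation cbr := (cplx_br br).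
Local Notation gs := (gseries cbr p lplus).

Let cL := cplx_br_lie brL.
Let hpos := herm_pos brL imaginary square0 semisimple.

Lemma second_seriesE k : second_series br p lplus k = [set` gs k].
Proof.
have H i : series_pos br lplus i.+1 = [set` gpos cbr lplus i].
  apply/seteqP; split=> X /=; rewrite memv_cap.
    move=> [-> XP]; apply/(hperpP cL) => Y /XP /eqP.
    by rewrite oppr_eq0 => /eqP.
  move=> /andP[Xm /(hperpP cL) XP]; split=> // Y /XP.
  by rewrite /herm conjVE => ->; rewrite oppr0.
have memcj (U : {vspace VC}) X : (conjV X \in U) = (X \in cjv U) by rewrite mem_cjv.
case: k => [[|i]|i]; last 2 first.
- exact: H.
- rewrite /= H; apply/seteqP; split=> X /=.
    by move=> [Y /= Yg <-]; rewrite -memcj conjVE cjK.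
  by rewrite -memcj => Xg; exists (conjV X) => //; rewrite !conjVE cjK.
(* Degree 0: X and conj X both lie in p exactly when the real and imaginary parts of X do. *)
apply/seteqP; split=> X /=; rewrite memv_cap -memcj.
  move=> [/= Xr Xi]; rewrite [X in X \in _]toC_reim memvD ?rpredZ //=.
  have -> : conjV X = toC (reV X) - iC R *: toC (imV X).
    by rewrite -scalerN; apply: reim_inj; rewrite !reimE ?oppr0 ?addr0 ?add0r.
  by rewrite memvB ?rpredZ.
move=> /andP[X1 X2]; split; rewrite /real_points /=.
  have -> : toC (reV X) = 2^-1 *: (X + conjV X).
    apply: (@scalerI _ _ 2); first by rewrite pnatr_eq0.
    rewrite scalerA mulfV ?pnatr_eq0 // scale1r scaler_nat mulr2n.
    by apply: reim_inj; rewrite !reimE ?addr0 ?subrr.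
  by rewrite rpredZ // memvD.
have -> : toC (imV X) = (2^-1 * - iC R) *: (X - conjV X).
  rewrite -scalerA scaleNr; apply: (@scalerI _ _ 2); first by rewrite pnatr_eq0.
  rewrite [RHS]scalerA mulfV ?pnatr_eq0 // scale1r scaler_nat mulr2n.
  by apply: reim_inj; rewrite !reimE ?addr0 ?subrr ?opprK ?oppr0 ?opprD ?opprK.
by rewrite rpredZ // memvB.
Qed.

Lemma canonical_real : exists x0 : VR, forall k X, X \in gs k ->
  br x0 (reV X) = - (k%:~R *: imV X) /\ br x0 (imV X) = k%:~R *: reV X.
Proof.
have [xi cxi H] := canonical_element cL (conj_cbr brL) hpos p_parabolic lplus_nilradical.
exists (reV xi) => k X /H; rewrite (conj_fixed cxi) reV_toC -iCE => E.
have zr : (k%:~R : R[i]) = real_complex R k%:~R by rewrite rmorph_int.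
rewrite zr -scalerA in E.
have := congr1 (@reV _ _) E; have := congr1 (@imV _ _) E.
rewrite reV_cbr imV_cbr !reimE !(lie_0br brL) subr0 addr0 reV_scale imV_scale /= => -> ->.
by rewrite !scale0r addr0 subr0.
Qed.

Lemma gseries_eventually0 : exists N : nat, forall k : int, (N < `|k|)%N -> gs k = 0%VS.
Proof.
have [_ [i0 li0] _] := lplus_nilradical; exists i0.+1.
have z0 U : lie_brv cbr U 0 = 0%VS.
  apply/eqP; rewrite -subv0; apply/(lie_brvP cL) => x y _; rewrite memv0 => /eqP->.
  by rewrite (lie_br0 cL) mem0v.
have mi i : (i0 <= i)%N -> iter i (lie_brv cbr lplus) lplus = 0%VS.
  move=> /(leq_trans (leq_pred _))/subnK <-; rewrite iterD -[iter i0.-1 _ _]/(lower_central cbr lplus i0) li0.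
  by elim: (i - _)%N => //= j ->; rewrite z0.
have gi i : (i0 <= i)%N -> gpos cbr lplus i = 0%VS.
  by move=> /mi E; rewrite /gpos E; apply/eqP; rewrite -subv0 capvSl.
case=> [[|i]|i] //= ki; first by rewrite gi //; lia.
apply/eqP; rewrite -subv0; apply/subvP => x; rewrite mem_cjv gi; last by lia.
by rewrite !memv0 => /eqP E; rewrite -[x]cjK E cj0.
Qed.

(** Writing degrees as 3 q + s with s < 3 prepares the regrouping by residue; only finitely many q
    occur because the series vanishes in large degree. *)
Lemma gseries_decomposition : exists (M : nat) (a : int), forall X : VC,
  exists2 z : 'I_M -> 'I_3 -> VC, forall i s, z i s \in gs (3 * (i%:Z + a) + s%:Z) &
    X = \sum_i \sum_s z i s.
Proof.
have [N gN] := gseries_eventually0; exists (N + N).+1, (- N%:Z) => X.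
pose W := (\sum_(q : 'I_(N + N).+1 * 'I_3) gs (3 * ((q.1 : nat)%:Z - N%:Z) + (q.2 : nat)%:Z))%VS.
have : X \in W.
  rewrite (gseries_full cL (conj_cbr brL) hpos p_parabolic lplus_nilradical (W := W)) ?memvf // => k.
  have [kN|kN] := leqP `|k|%N N; last by rewrite gN // sub0v.
  have kE := divz_eq k 3; have k0 := modz_ge0 k (isT : 3 != 0 :> int).
  have k3 := ltz_pmod k (isT : 0 < 3 :> int).
  set q := (k %/ 3)%Z in kE; set r := (k %% 3)%Z in kE k0 k3.
  have rr : (`|r| < 3)%N by lia.
  have qq : (`|(q + N%:Z)%R| < (N + N).+1)%N by lia.
  have := @sumv_sup _ _ _ (Ordinal qq, Ordinal rr) xpredT (gs k)
    (fun q => gs (3 * ((q.1 : nat)%:Z - N%:Z) + (q.2 : nat)%:Z)); apply => //=.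
  by rewrite (_ : 3 * _ + _ = k) //; lia.
move=> /memv_sumP[z zP ->]; exists (fun i s => z (i, s)) => [i s|]; first exact: (zP (i, s)).
by rewrite pair_bigA; apply: eq_bigr => -[].
Qed.

Variable x0 : VR.
Hypothesis x0P : forall k X, X \in gs k ->
  br x0 (reV X) = - (k%:~R *: imV X) /\ br x0 (imV X) = k%:~R *: reV X.
Variable A : VR -> VR.
Hypothesis linA : linear A.
Hypothesis rotA : forall v w b, br ((2 * pi / 3) *: x0) v = - (b *: w) ->
  br ((2 * pi / 3) *: x0) w = b *: v -> A v = cos b *: v - sin b *: w.
Local Notation sigma := (cplx_map A).
Local Notation w := (omega3 R).

(** Both (Re X, Im X) and (Im X, -Re X) satisfy the hypotheses of [rotA], which gives the two halves
    of sigma X. *)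
Lemma sigma_gseries k X : X \in gs k -> sigma X = expi (2 * pi / 3 * k%:~R) *: X.
Proof.
move=> Xk; have [E1 E2] := x0P Xk.
have r1 := rotA (v := reV X) (w := imV X) (b := 2 * pi / 3 * k%:~R).
have r2 := rotA (v := imV X) (w := - reV X) (b := 2 * pi / 3 * k%:~R).
apply: reim_inj; rewrite !(reV_cplx_map, imV_cplx_map, reV_scale, imV_scale) /=.
  apply: r1; rewrite (lie_brZl brL).
    by rewrite E1 scalerN scalerA.
  by rewrite E2 scalerA.
rewrite r2 ?scalerN ?opprK // (lie_brZl brL).
  by rewrite E2 scalerA.
by rewrite (lie_brNr brL) E1 opprK scalerA.
Qed.

Lemma sigma_component (X : VC) (m : int) (r : nat) : X \in gs (3 * m + r%:Z) ->
  sigma X = w ^+ r *: X.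
Proof. by move/sigma_gseries => ->; rewrite expi_third. Qed.

Let linS := linear_cplx_map linA.
Let sg := HB.pack_for {linear VC -> VC} sigma (GRing.isLinear.Build _ _ _ _ _ linS).
Let sE X : sigma X = sg X. Proof. by []. Qed.

Let sZ z X : sigma (z *: X) = z *: sigma X. Proof. by rewrite sE linearZ. Qed.

Let third_neq0 : (3 : R[i]) != 0. Proof. by rewrite pnatr_eq0. Qed.

Lemma sigma_decomposition X : exists Y : 'I_3 -> VC,
  [/\ X = \sum_s Y s, forall s : 'I_3, sigma (Y s) = w ^+ s *: Y s &
      forall s : 'I_3, int_sum (fun i => [set` gs (3 * i + (s : nat)%:Z)]) (Y s)].
Proof.
have [M [a /(_ X)[z zP XE]]] := gseries_decomposition.
exists (fun s => \sum_i z i s); split.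
- by rewrite exchange_big.
- move=> s; rewrite sE linear_sum scaler_sumr; apply: eq_bigr => i _.
  by rewrite -sE; apply: sigma_component (zP i s).
- move=> s; apply: (@int_sum_range _ _ (fun i => [set` gs (3 * i + (s : nat)%:Z)]) M (z^~ s) a).
    by move=> k /=; rewrite mem0v.
  by move=> i; exact: zP.
Qed.

Lemma sigma_order3 X : sigma (sigma (sigma X)) = X.
Proof.
have [Y [-> H _]] := sigma_decomposition X; rewrite 3!sE !linear_sum; apply: eq_bigr => s _.
rewrite -!sE !(H, sZ) !scalerA.
by rewrite -!exprD addnn -muln2 -mulnSr mulnC exprM omega3_exp3 expr1n scale1r.
Qed.

(** For the converse, split X by residues. With tau = omega^(-r) sigma, the operator 1 + tau + tau^2
    is 3 on the component of residue r and 0 on the others; on X itself it is 3 by assumption. *)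
Lemma int_sum_sigma (r : nat) X : (r < 3)%N ->
  int_sum (fun i => [set` gs (3 * i + r%:Z)]) X <-> sigma X = w ^+ r *: X.
Proof.
move=> r3; split.
  move=> [s [f [_ fP ->]]]; rewrite sE linear_sum scaler_sumr; apply: eq_bigr => i _.
  by rewrite -sE; exact: sigma_component (fP i).
have [Y [XE H YP]] := sigma_decomposition X => SX.
suff -> : X = Y (Ordinal r3) by exact: (YP (Ordinal r3)).
pose c (s : nat) : R[i] := w ^+ (3 - r) * w ^+ s.
have E1 : \sum_(s : 'I_3) (1 + c s + c s ^+ 2) *: Y s = 3 *: Y (Ordinal r3).
  rewrite (bigD1 (Ordinal r3)) //= omega3_filter // eqxx big1 ?addr0 // => s sr.
  by rewrite omega3_filter // (negbTE (sr : (s : nat) != r)) scale0r.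
have SY : \sum_(s : 'I_3) c s *: Y s = w ^+ (3 - r) *: sigma X.
  rewrite {1}XE sE (linear_sum sg) scaler_sumr; apply: eq_bigr => s _.
  by rewrite -sE H scalerA.
have SYY : \sum_(s : 'I_3) c s ^+ 2 *: Y s = w ^+ (3 - r) *: (w ^+ (3 - r) *: sigma (sigma X)).
  rewrite {1}XE 2!sE !(linear_sum sg) !scaler_sumr; apply: eq_bigr => s _.
  by rewrite -!sE !(H, sZ) !scalerA /c; congr (_ *: _); ring.
have wr : w ^+ (3 - r) * w ^+ r = 1 by rewrite -exprD subnK ?omega3_exp3 // ltnW.
apply: (scalerI third_neq0); rewrite -E1.
under eq_bigr => s _ do rewrite !scalerDl scale1r.
rewrite !big_split /= -XE SY SYY !(SX, sZ) !scalerA.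
have -> : w ^+ (3 - r) * w ^+ (3 - r) * w ^+ r * w ^+ r = (w ^+ (3 - r) * w ^+ r) ^+ 2 by ring.
by rewrite wr expr1n !scale1r scaler_nat !mulrSr mulr0n add0r.
Qed.

Lemma mplusE : mplus br p lplus = [set X | sigma X = w *: X].
Proof.
rewrite /mplus; under [X in int_sum X]eq_fun do rewrite second_seriesE.
by apply/seteqP; split=> X /=; rewrite -[w]expr1; move/(int_sum_sigma X (isT : 1 < 3)%N).
Qed.

Lemma mminusE : mminus br p lplus = [set X | sigma X = w ^+ 2 *: X].
Proof.
rewrite /mminus; under [X in int_sum X]eq_fun do rewrite second_seriesE.
by apply/seteqP; split=> X /=; move/(int_sum_sigma X (isT : 2 < 3)%N).
Qed.

Lemma hR_fixed u : hR br p lplus u <-> A u = u.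
Proof.
have -> : hR br p lplus u <-> sigma (toC u) = w ^+ 0 *: toC u.
  rewrite -(int_sum_sigma (toC u) (isT : 0 < 3)%N) /hR /real_points /hC /=.
  by under [X in int_sum X]eq_fun do rewrite second_seriesE -[X in gs X]addr0.
rewrite expr0 scale1r (cplx_map_toC linA); split=> [/(congr1 (@reV _ _))|->//].
by rewrite !reV_toC.
Qed.

(** A^2 + A + 1 is the real polynomial in A whose complex roots are omega and omega^2, so its kernel
    describes m without complexifying. *)
Lemma mR_fixed u : mR br p lplus u <-> A (A u) + A u + u = 0.
Proof.
have -> : A (A u) + A u + u = 0 <-> sigma (sigma (toC u)) + sigma (toC u) + toC u = 0.
  rewrite !(cplx_map_toC linA) -!toCD -(toC0 R n).
  by split=> [->//|/(congr1 (@reV _ _))]; rewrite !reV_toC.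
have w3 := omega3_exp3 R; have ws := omega3_sum R.
rewrite /mR /real_points /sum_set /= mplusE mminusE; split.
  move=> [X [Y [/= EX EY ->]]].
  have sD X' Y' : sigma (X' + Y') = sigma X' + sigma Y' by rewrite sE linearD.
  rewrite !(sD, EX, EY, sZ) !scalerA.
  have E1 : 1 + w + w * w = 0 by rewrite -ws; ring.
  have E2 : 1 + w ^+ 2 + w ^+ 2 * w ^+ 2 = 0.
    have -> : w ^+ 2 * w ^+ 2 = w ^+ 3 * w by ring.
    by rewrite w3 mul1r -ws; ring.
  transitivity ((1 + w + w * w) *: X + (1 + w ^+ 2 + w ^+ 2 * w ^+ 2) *: Y).
    by apply/rowP => i; rewrite !mxE; ring.
  by rewrite E1 E2 !scale0r addr0.
set X := toC u => E; have [Y [XE H YP]] := sigma_decomposition X.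
exists (Y (inord 1)), (Y (inord 2)); split.
- by rewrite /= H inordK ?expr1.
- by rewrite /= H inordK.
(* Applying the polynomial kills the other two components and multiplies this one by 3. *)
have Y0 : Y ord0 = 0.
  have := E; have : sigma (sigma X) + sigma X + X = 3 *: Y ord0.
    have F (s : 'I_3) : sigma (sigma (Y s)) + sigma (Y s) + Y s = if s == ord0 then 3 *: Y s else 0.
      rewrite !(H, sZ) scalerA -scalerDl -[X in _ + X]scale1r -scalerDl.
      have := @omega3_filter R 0 s isT (ltn_ord s); rewrite w3 mul1r.
      rewrite (_ : 1 + _ + _ = w ^+ s * w ^+ s + w ^+ s + 1); last by ring.
      move=> ->.
      by rewrite -[(s : nat) == 0]/(s == ord0); case: (s == ord0); rewrite ?scale0r.
    rewrite {1 2 3}XE 2!sE !(linear_sum sg) -!big_split /= (eq_bigr _ (fun s _ => F s)).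
    by rewrite -big_mkcond big_pred1_eq.
  by move=> -> /eqP; rewrite scaler_eq0 (negbTE third_neq0) => /eqP.
rewrite XE !big_ord_recl big_ord0 addr0 Y0 add0r; by congr (Y _ + Y _); apply: val_inj; rewrite [RHS]inordK.
Qed.

End CanonicalRotation.

(** * Homomorphisms of Lie groups and fixed points *)

Lemma sdiff_pair (R : realType) (U V W : normedModType R) (f : U -> V) (g : U -> W) a L M :
  sdiff f a L -> sdiff g a M -> sdiff (fun x => (f x, g x)) a (fun x => (L x, M x)).
Proof.
move=> sf sg.
have := sdiffD (sdiff_comp sf (blin_sdiff (f a) (bounded_linear_inl V W)))
               (sdiff_comp sg (blin_sdiff (g a) (bounded_linear_inr V W))).
rewrite /= (_ : (fun x => _ + _) = fun x => (f x, g x)); last first.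
  by apply/funext => x; congr pair; rewrite /= ?addr0 ?add0r.
rewrite (_ : (fun x => _ + _) = fun x => (L x, M x)) //.
by apply/funext => x; congr pair; rewrite /= ?addr0 ?add0r.
Qed.

Lemma locally_constant (R : realType) (V : normedModType R) n (f : V -> 'rV[R]_n) a :
  (\forall x \near a, sdiff f x (fun=> 0)) -> \forall x \near a, f x = f a.
Proof.
move=> /nbhs_ballP[d /= d0 H]; apply/nbhs_ballP; exists d => // x; rewrite -ball_normE /= => xd.
apply/rowP => i; apply/eqP; rewrite -subr_eq0 -normr_le0.
have := @segment_mean_value R V (fun y => f y 0 i) a (x - a) 1 0 0.
rewrite scale1r subrK mulr0 subr0 mul0r; apply=> t; rewrite normr1 => t1.
have /H sf : ball a d (t *: (x - a) + a).
  rewrite -ball_normE /= opprD addrC subrK normrN normrZ.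
  by apply: le_lt_trans xd; rewrite distrC ler_piMl.
have [df Df] := sdiff_derive (x - a) sf.
have [dc Dc] := derive_blin (bounded_linear_coord R i) df.
by split; [exact: dc|rewrite [X in X - 0]Dc Df mxE subr0 normr0].
Qed.

(** * Subgroups that agree near the unit *)

Section Subgroups.
Variables (R : realType) (n : nat) (G : lieGroup R n).
Local Open Scope group_scope.

Lemma open_translate (U : set G) x : open U -> open [set y | U (x^-1 * y)].
Proof.
move=> oU; have : continuous (fun y : G => x^-1 * y).
  by move=> y; apply: (gcontinuous_mul (F := fun=> x^-1) (F' := id)); [exact: cvg_cst|exact: cvg_id].
by move/continuousP; apply.
Qed.

Variables F H : set G.
Hypotheses (subF : is_subgroup F) (subH : is_subgroup H) (HF : H `<=` F).
Variable U : set G.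
Hypotheses (oU : open U) (U1 : U 1) (FU : F `&` U `<=` H).

Let translate x y : F x -> F y -> U (x^-1 * y) -> H x <-> H y.
Proof.
move=> Fx Fy Uxy; have [_ FM FV] := subF; have [_ HM HV] := subH.
have Hxy : H (x^-1 * y) by apply: FU; split=> //; apply: FM => //; exact: FV.
split=> [Hx|Hy]; first by rewrite -[y](mulVKg x); exact: HM.
have -> : x = y * (x^-1 * y)^-1 by rewrite invgM invgK mulVKg.
by apply: HM => //; exact: HV.
Qed.

(** H fills F near 1, so by translation both H and its complement in F are relatively open; K meets
    H in a set open and closed in K. *)
Lemma connected_sub_subgroup (K : set G) : connected K -> K 1 -> K `<=` F -> K `<=` H.
Proof.
move=> cK K1 KF; have [H1 _ _] := subH.
suff <- : K `&` H = K by move=> x [].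
apply: cK; first by exists 1.
  exists (\bigcup_(x in H) [set y | U (x^-1 * y)]).
    by apply: bigcup_open => x _; exact: open_translate.
  apply/seteqP; split=> y [Ky].
    by move=> Hy; split=> //; exists y => //=; rewrite mulVg.
  by move=> [x Hx /= Uxy]; split=> //; apply/(translate _ _ Uxy) => //; [exact: HF|exact: KF].
exists (~` (\bigcup_(x in F `\` H) [set y | U (x^-1 * y)])).
  by apply: open_closedC; apply: bigcup_open => x _; exact: open_translate.
apply/seteqP; split=> y [Ky].
  by move=> Hy; split=> // -[x [Fx nHx] /= Uxy]; apply/nHx/(translate _ _ Uxy) => //; exact: HF.
move=> nUy; split=> //; apply: contrapT => nHy; apply: nUy.
by exists y; [split=> //; exact: KF|rewrite /= mulVg].
Qed.

Lemma closed_subgroup : closed F -> closed H.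
Proof.
move=> clF x xH; have Fx : F x by apply: clF => A /xH[y [/HF Fy Ay]]; exists y.
have [y [Hy Uxy]] : H `&` [set y | U (x^-1 * y)] !=set0.
  apply: xH; apply: open_nbhs_nbhs; split; first exact: open_translate.
  by rewrite /= mulVg.
by apply/(translate Fx _ Uxy) => //; exact: HF.
Qed.

End Subgroups.

Section ProductDerivative.
Variables (R : realType) (n : nat) (G : lieGroup R n).
Variables (c : chart R n G) (c_atlas : atlas (l := G) c) (c_unit : cdom c (1%g : G)).
Local Notation V := 'rV[R]_n.
Local Notation e := (cmap c 1%g).

Definition mul_chart (z : V * V) : V := cmap c (cinv c z.1 * cinv c z.2)%g.

Lemma mul_chart_unit : mul_chart (e, e) = e.
Proof. by rewrite /mul_chart /= cinv_unit // mulg1. Qed.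

(** The two partial derivatives are identities, because multiplying by 1 on either side is the
    identity. *)
Lemma sdiff_mul_chart : sdiff mul_chart (e, e) (fun z => z.1 + z.2).
Proof.
have fV := fdim_rV R n.
have u1 : cdom c (1 * 1)%g by rewrite mulg1.
have := smooth_at_sdiff (fdim_prod fV fV) fV
  (mul_in_charts_at c_atlas c_atlas c_atlas c_unit c_unit u1).
rewrite -/mul_chart; set L := (fun v => _) => sm.
suff -> : (fun z : V * V => z.1 + z.2) = L by [].
have [bL _] := sm; apply/funext => -[u v] /=.
have -> : (u, v) = (u, 0) + (0, v) :> V * V by congr pair; rewrite /= ?addr0 ?add0r.
rewrite (blinD bL); congr (_ + _).
  rewrite /L -[LHS](derive_id e u); symmetry.
  transitivity ('D_u (fun x => mul_chart (x, e)) e).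
    rewrite /derive.
    have -> : (fun h : R => h^-1 *: ((mul_chart \o shift (e, e)) (h *: (u, 0) : V * V) - mul_chart (e, e))) =
      (fun h : R => h^-1 *: (((fun x => mul_chart (x, e)) \o shift e) (h *: u) - mul_chart (e, e))).
      by apply/funext => h; rewrite /mul_chart /= scaler0 add0r.
    by [].
  apply: near_eq_derive; apply: filterS (near_cimg (cimg_cmap c_unit)) => y cy.
  by rewrite /mul_chart /= cinv_unit // mulg1 cinvK.
rewrite /L -[LHS](derive_id e v); symmetry.
transitivity ('D_v (fun x => mul_chart (e, x)) e).
  rewrite /derive.
  have -> : (fun h : R => h^-1 *: ((mul_chart \o shift (e, e)) (h *: (0, v) : V * V) - mul_chart (e, e))) =
    (fun h : R => h^-1 *: (((fun x => mul_chart (e, x)) \o shift e) (h *: v) - mul_chart (e, e))).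
    by apply/funext => h; rewrite /mul_chart /= scaler0 add0r.
  by [].
apply: near_eq_derive; apply: filterS (near_cimg (cimg_cmap c_unit)) => y cy.
by rewrite /mul_chart /= cinv_unit // mul1g cinvK.
Qed.

End ProductDerivative.

Lemma hom1 (R : realType) m n (L : lieGroup R m) (G : lieGroup R n) (f : L -> G) :
  {morph f : x y / (x * y)%g} -> f 1%g = 1%g.
Proof. by move=> fM; apply: (mulgI (f 1%g)); rewrite -fM !mulg1. Qed.

(** * A homomorphism is determined by its differential *)

Section HomUniqueness.
Variables (R : realType) (m n : nat) (L : lieGroup R m) (G : lieGroup R n).
Variables (d : chart R m L) (d_atlas : atlas (l := L) d) (d_unit : cdom d (1%g : L)).
Variables (c : chart R n G) (c_atlas : atlas (l := G) c) (c_unit : cdom c (1%g : G)).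
Local Notation V := 'rV[R]_m.
Local Notation y0 := (cmap d 1%g).
Local Notation e := (cmap c 1%g).

Definition hom_chart (f : L -> G) (y : V) := cmap c (f (cinv d y)).

Lemma smooth_hom_chart (f : L -> G) : {morph f : x y / (x * y)%g} -> lg_smooth f ->
  smooth_at (hom_chart f) y0.
Proof.
move=> fM sf; apply: (gsmooth_hom (fdim_rV R m) sf (gsmooth_cinv d_atlas (cimg_cmap d_unit))).2 => //=.
by rewrite cinv_unit // (hom1 fM).
Qed.

Lemma sdiff_hom_chart (f : L -> G) : {morph f : x y / (x * y)%g} -> lg_smooth f ->
  sdiff (hom_chart f) y0 (diff1 d c f).
Proof.
move=> fM sf; exact: (smooth_at_sdiff (fdim_rV R m) (fdim_rV R n) (smooth_hom_chart fM sf)).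
Qed.

Variables f1 f2 : L -> G.
Hypotheses (f1M : {morph f1 : x y / (x * y)%g}) (f2M : {morph f2 : x y / (x * y)%g}).
Hypotheses (f1S : lg_smooth f1) (f2S : lg_smooth f2).
Hypothesis diffE : forall v, diff1 d c f1 v = diff1 d c f2 v.

(** The quotient is not a homomorphism, but psi (x z) is a translate of a conjugate of psi z. So its
    vanishing differential at 1 makes it locally constant near 1. *)
Let psi x := (f1 x * (f2 x)^-1)%g.
Let P (y : V) := cmap c (psi (cinv d y)).

Let psi1 : psi 1%g = 1%g. Proof. by rewrite /psi (hom1 f1M) (hom1 f2M) mulgV. Qed.

Let gpsi y : cimg d y -> gsmooth (psi \o cinv d) y.
Proof.
move=> dy; have fV := fdim_rV R m; have gc := gsmooth_cinv d_atlas dy.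
apply: (gsmooth_mul fV); first exact: (gsmooth_hom fV f1S gc).
by apply: (gsmooth_inv fV); exact: (gsmooth_hom fV f2S gc).
Qed.

Let PE y0' : P y0' = cmap c (psi (cinv d y0')). Proof. by []. Qed.

Let P0 : P y0 = e. Proof. by rewrite /P cinv_unit // psi1. Qed.

Let sP : sdiff P y0 (fun=> 0).
Proof.
have fV := fdim_rV R m; have fW := fdim_rV R n.
have g0 := gpsi (cimg_cmap d_unit).
have d0 : cdom c ((psi \o cinv d) y0) by rewrite /= cinv_unit // psi1.
have sP := smooth_at_sdiff fV fW (g0.2 c c_atlas d0).
suff E v : 'D_v P y0 = 0.
  by move: sP; rewrite (_ : (fun v => _) = fun=> 0) //; apply/funext => v; exact: E.
have s2 := sdiff_hom_chart f2M f2S.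
have sm : sdiff (mul_chart c) (P y0, hom_chart f2 y0) (fun z => z.1 + z.2).
  by rewrite P0 /hom_chart cinv_unit // (hom1 f2M); exact: sdiff_mul_chart.
have [_ /=] := sdiff_derive v (sdiff_comp (sdiff_pair sP s2) sm).
have -> : 'D_v (mul_chart c \o (fun x => ((cmap c \o (psi \o cinv d)) x, hom_chart f2 x))) y0 =
    diff1 d c f1 v.
  apply: near_eq_derive.
  have d2 : cdom c ((f2 \o cinv d) y0) by rewrite /= cinv_unit // (hom1 f2M).
  have g2 := gsmooth_hom fV f2S (gsmooth_cinv d_atlas (cimg_cmap d_unit)).
  apply: filterS (filterI (near_cdom g0.1 d0) (near_cdom g2.1 d2)) => y [/= c1 c2].
  by rewrite /mul_chart /hom_chart /= !cmapK // /psi mulgVK.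
by rewrite diffE => /eqP; rewrite eq_sym -subr_eq0 addrK => /eqP.
Qed.

Let near_psi1 : \forall x \near (1%g : L), psi x = 1%g.
Proof.
have fV := fdim_rV R m; have fW := fdim_rV R n.
have g0 := gpsi (cimg_cmap d_unit).
have d0 : cdom c ((psi \o cinv d) y0) by rewrite /= cinv_unit // psi1.
have near_dom : \forall y \near y0, cimg d y /\ cdom c (psi (cinv d y)).
  by apply: filterI; [exact: near_cimg (cimg_cmap d_unit)|exact: near_cdom g0.1 d0].
have Pe : \forall y \near y0, P y = P y0.
  apply: locally_constant; apply: filterS near_dom => y [dy cy].
  pose x := cinv d y; pose zeta y' := cmap d (x^-1 * cinv d y')%g.
  (* From psi (x z) = f1 x * psi z * (f1 x)^-1 * psi x: near y the map P is Q after P after zeta,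
     and P has zero differential at zeta y = y0. *)
  pose Q p := cmap c (f1 x * cinv c p * (f1 x)^-1 * psi x)%g.
  have gz : gsmooth (fun y' => x^-1 * cinv d y')%g y.
    by apply: (gsmooth_mul fV); [exact: gsmooth_cst|exact: gsmooth_cinv].
  have z1 : (x^-1 * cinv d y)%g = 1%g by rewrite mulVg.
  have sz : smooth_at zeta y by apply: (gz.2 d) => //=; rewrite z1.
  have zy : zeta y = y0 by rewrite /zeta z1.
  have gQ : gsmooth (fun p => f1 x * cinv c p * (f1 x)^-1 * psi x)%g e.
    apply: (gsmooth_mul fW); last exact: gsmooth_cst.
    apply: (gsmooth_mul fW); last exact: gsmooth_cst.
    apply: (gsmooth_mul fW); first exact: gsmooth_cst.
    by apply: gsmooth_cinv => //; exact: cimg_cmap.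
  have Qe : (f1 x * cinv c e * (f1 x)^-1 * psi x)%g = psi x.
    by rewrite cinv_unit // mulg1 mulgV mul1g.
  have sQ : smooth_at Q e by apply: (gQ.2 c) => //=; rewrite Qe.
  have sz' := smooth_at_sdiff fV fV sz; have sQ' := smooth_at_sdiff fW fW sQ.
  have [bQ _] := sQ'.
  have sPz : sdiff P (zeta y) (fun=> 0) by rewrite zy.
  have sPz2 := sdiff_comp sz' sPz.
  have sQ2 : sdiff Q ((P \o zeta) y) (fun v => 'D_v Q e) by rewrite /= zy P0.
  have sall := sdiff_comp sPz2 sQ2.
  have sPy := smooth_at_sdiff fV fW ((gpsi dy).2 c c_atlas cy).
  suff E v : 'D_v P y = 0.
    by move: sPy; rewrite (_ : (fun v => _) = fun=> 0) //; apply/funext => v; exact: E.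
  have [_ /= D] := sdiff_derive v sall; rewrite (blin0 bQ) in D; rewrite -[RHS]D.
  apply: near_eq_derive.
  have dz : cdom d (x^-1 * cinv d y)%g by rewrite z1.
  have N1 := near_cdom gz.1 dz.
  have cz : cdom c (psi (x^-1 * cinv d y)%g) by rewrite z1 psi1.
  have N2 : \forall y' \near y, cdom c (psi (x^-1 * cinv d y')%g).
    have psic : continuous psi.
      move=> t; apply: (@gcontinuous_mul R L n G f1 (fun x => (f2 x)^-1)%g t).
        exact: f1S.1.
      by apply: (@gcontinuous_inv R L n G f2 t); exact: f2S.1.
    apply: (near_cdom (F := psi \o (fun y' => x^-1 * cinv d y')%g)) => //.
    exact: (cvg_comp _ _ gz.1 (psic _)).
  apply: filterS (filterI N1 N2) => y' [dy' cy'].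
  rewrite /P /Q /zeta /= !cmapK //; congr cmap.
  have f2V : ((f2 x^-1)^-1)%g = f2 x.
    by apply: (mulIg (f2 x^-1)%g); rewrite mulVg -f2M mulgV (hom1 f2M).
  have f1V : (f1 x^-1)%g = (f1 x)^-1%g.
    by apply: (mulIg (f1 x)); rewrite mulVg -f1M mulVg (hom1 f1M).
  by rewrite /psi f1M f2M f1V invgM f2V !mulgA mulgV mul1g mulgVK mulgK.
have : \forall y \near y0, psi (cinv d y) = 1%g.
  apply: filterS (filterI near_dom Pe) => y [[_ cy]].
  by rewrite /P cinv_unit // psi1 => /(congr1 (cinv c)); rewrite !cmapK.
move=> N; have N' : \forall x \near (1%g : L), psi (cinv d (cmap d x)) = 1%g.
  exact: (@cmap_continuous _ _ _ d _ d_unit _ N).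
have N2 : \forall x \near (1%g : L), cdom d x.
  by apply: (near_cdom (F := id)) => //; exact: cvg_id.
by apply: filterS (filterI N' N2) => x [+ dx]; rewrite cmapK.
Qed.

Lemma hom_unique : connected [set: L] -> f1 =1 f2.
Proof.
move=> cL; pose H := [set x | f1 x = f2 x].
have subH : is_subgroup H.
  rewrite /H; split=> /= [|x y E1 E2|x E]; first by rewrite (hom1 f1M) (hom1 f2M).
    by rewrite f1M f2M E1 E2.
  by apply: (mulIg (f1 x)); rewrite {2}E -f1M -f2M mulVg (hom1 f1M) (hom1 f2M).
have subT : is_subgroup [set: L] by [].
have N : nbhs (1%g : L) [set x | psi x = 1%g] := near_psi1.
move: N; rewrite nbhsE => -[U [oU U1] UH].
have FU : [set: L] `&` U `<=` H.
  by move=> x [_ /UH /=] /(congr1 (fun y => y * f2 x)%g); rewrite /psi mulgVK mul1g.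
move=> x; exact: (@connected_sub_subgroup _ _ L setT H subT subH (@subsetT _ _) U oU U1 FU setT cL).
Qed.

End HomUniqueness.

Lemma near_norm_ball (R : realType) (V : normedModType R) (a : V) (P : set V) :
  (\forall z \near a, P z) -> exists2 r, 0 < r & forall z, `|z - a| < r -> P z.
Proof.
move=> /nbhs_ballP[r /= r0 H]; exists r => // z zr; apply: H.
by rewrite -ball_normE /= distrC.
Qed.

Section OrderThree.
Variables (R : realType) (n : nat).
Local Notation V := 'rV[R]_n.
Variable A : V -> V.
Hypothesis bA : bounded_linear A.
Hypothesis A3 : forall u, A (A (A u)) = u.

Definition fixed_proj w := 3^-1 *: (w + A w + A (A w)).
Local Notation P := fixed_proj.

Lemma fixed_projP w : A (P w) = P w.
Proof.
rewrite /P (blinZ bA) !(blinD bA) A3; congr (_ *: _).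
by rewrite addrC addrA.
Qed.

Lemma fixed_proj_compl w : A (A (w - P w)) + A (w - P w) + (w - P w) = 0.
Proof.
rewrite !(blinB bA) !fixed_projP /P; move: (A w) (A (A w)) => x y.
by apply/rowP => i; rewrite !mxE; field.
Qed.

Lemma fixed_proj_linear : linear P.
Proof.
by move=> a x y; rewrite /P !(blinD bA, blinZ bA); apply/rowP => i; rewrite !mxE; ring.
Qed.

Lemma fixed_compl_linear : linear (fun w => w - P w).
Proof. by move=> a x y; rewrite fixed_proj_linear scalerBr opprD addrACA. Qed.

(* On the complement A^2 + A + 1 = 0, hence (A + 2) (1 - A) = 3. *)
Lemma fixed_compl_estimate C v : (forall u, `|A u| <= C * `|u|) ->
  A (A v) + A v + v = 0 -> 3 * `|v| <= (C + 2) * `|v - A v|.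
Proof.
move=> AC H; rewrite -[3]ger0_norm // -normrZ.
have -> : 3 *: v = A (v - A v) + 2 *: (v - A v).
  move: H; rewrite (blinB bA); move: (A v) (A (A v)) => a b H; rewrite -[LHS]subr0 -H.
  by apply/rowP => i; rewrite !mxE; ring.
rewrite mulrDl; apply: le_trans (ler_normD _ _) _; apply: lerD; first exact: AC.
by rewrite normrZ ger0_norm.
Qed.

End OrderThree.

(** * The automorphism given by conjugation with g0 *)

Section Conjugation.
Variables (R : realType) (n : nat) (G : lieGroup R n).
Hypothesis G_connected : connected [set: G].
Variables (c : chart R n G) (c_atlas : atlas (l := G) c) (c_unit : cdom c (1%g : G)).
Local Notation V := 'rV[R]_n.
Local Notation e := (cmap c 1%g).
Local Notation Ad := (Ad c).

Definition conj_by (g x : G) : G := (g * x * g^-1)%g.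

Lemma conj_byM g : {morph conj_by g : x y / (x * y)%g}.
Proof. by move=> x y; rewrite /conj_by !mulgA mulgVK. Qed.

Lemma conj_by_comp g h x : conj_by g (conj_by h x) = conj_by (g * h)%g x.
Proof. by rewrite /conj_by invgM !mulgA. Qed.

Lemma conj_by1 x : conj_by 1%g x = x.
Proof. by rewrite /conj_by mul1g invg1 mulg1. Qed.

Lemma conj_by_smooth g : lg_smooth (conj_by g).
Proof.
apply: gsmooth_lg_smooth => d y ad dy; have fV := fdim_rV R n.
apply: (gsmooth_mul fV); last exact: gsmooth_cst.
by apply: (gsmooth_mul fV); [exact: gsmooth_cst|exact: gsmooth_cinv].
Qed.

Lemma conj_by_automorphism g : lg_automorphism (conj_by g).
Proof.
have K h : cancel (conj_by h) (conj_by h^-1)%g.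
  by move=> x; rewrite conj_by_comp mulVg conj_by1.
have K' : cancel (conj_by g^-1)%g (conj_by g).
  by move=> x; rewrite conj_by_comp mulgV conj_by1.
split; [exact: conj_byM|by exists (conj_by g^-1)%g|exact: conj_by_smooth|].
move=> t tK _; rewrite (_ : t = conj_by g^-1%g); first exact: conj_by_smooth.
by apply/funext => x; rewrite -{1}(K' x) tK.
Qed.

Lemma id_smooth : lg_smooth (@id G).
Proof. by apply: gsmooth_lg_smooth => d y ad dy; exact: gsmooth_cinv. Qed.

Lemma diff1_conj g : diff1 c c (conj_by g) = Ad g. Proof. by []. Qed.

Variable g0 : G.
Local Notation A := (Ad g0).
Local Notation s := (conj_by g0).
Hypothesis A3 : forall u, A (A (A u)) = u.

(** The cube of g0 need not be 1. Conjugation by it has identity differential, so it is the identity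
    on the connected group G. *)
Lemma conj_by_order3 x : s (s (s x)) = x.
Proof.
rewrite !conj_by_comp.
apply: (@hom_unique R n n G G c c_atlas c_unit c c_atlas c_unit (conj_by (g0 * g0 * g0)%g) id) => //.
- exact: conj_byM.
- exact: conj_by_smooth.
- exact: id_smooth.
- move=> v; rewrite diff1_conj !AdM // A3.
  have E : conj_by 1%g = id by apply/funext => x'; rewrite conj_by1.
  by rewrite -[LHS](Ad1 c_unit v) -diff1_conj E.
Qed.

Lemma linear_Ad : linear A.
Proof. by case: (bounded_linear_Ad c_atlas c_unit g0). Qed.

Lemma fixed_points_subgroup : is_subgroup (fixed_points s).
Proof.
have s1 : s 1%g = 1%g by rewrite /conj_by mulg1 mulgV.
rewrite /fixed_points; split=> //= [x y E E'|x E]; first by rewrite conj_byM E E'.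
by apply: (mulIg x); rewrite mulVg -{2}E -conj_byM mulVg.
Qed.

Lemma fixed_points_closed : closed (fixed_points s).
Proof.
have H := lg_hausdorff (l := G); rewrite /fixed_points => x xF.
apply: H => U W /= Us Wx.
have cs : {for x, continuous s} by exact: (conj_by_smooth g0).1.
have V1 : nbhs x (s @^-1` U) := cs U Us.
have [y [/= Fy [y1 y2]]] := xF _ (filterI V1 Wx).
by exists y; split=> //; rewrite -Fy.
Qed.

Variables (m : nat) (L : lieGroup R m) (d : chart R m L) (iota : L -> G).
Hypotheses (d_atlas : atlas (l := L) d) (d_unit : cdom d (1%g : L)).
Hypothesis L_connected : connected [set: L].
Hypotheses (iotaS : lg_smooth iota) (iotaM : {morph iota : x y / (x * y)%g}).
Hypothesis (diota_range : range (diff1 d c iota) = [set u | A u = u]).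
Local Notation y0 := (cmap d 1%g).
Local Notation di := (diff1 d c iota).

Lemma range_subgroup : is_subgroup (range iota).
Proof.
split; first by exists 1%g => //; exact: (hom1 iotaM).
  by move=> _ _ [x _ <-] [y _ <-]; exists (x * y)%g.
move=> _ [x _ <-]; exists x^-1%g => //; apply: (mulIg (iota x)).
by rewrite mulVg -iotaM mulVg (hom1 iotaM).
Qed.

(** [s \o iota] and [iota] have the same differential at 1, since the image of [di] is fixed by A; L
    is connected. *)
Lemma range_fixed : range iota `<=` fixed_points s.
Proof.
move=> _ [x _ <-]; rewrite /fixed_points /=.
apply: (@hom_unique R m n L G d d_atlas d_unit c c_atlas c_unit (s \o iota) iota) => //.
- by move=> a b /=; rewrite iotaM conj_byM.
- apply: gsmooth_lg_smooth => d' y ad' dy.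
  have fV := fdim_rV R m.
  exact: (gsmooth_hom fV (conj_by_smooth g0) (gsmooth_hom fV iotaS (gsmooth_cinv ad' dy))).
move=> v; have Av : A (di v) = di v.
  by have : range di (di v) by [exists v]; rewrite diota_range.
have si := sdiff_hom_chart d_atlas d_unit c_atlas c_unit iotaM iotaS.
have ie : hom_chart d c iota y0 = e by rewrite /hom_chart cinv_unit // (hom1 iotaM).
have sA : sdiff (conj_chart c g0) (hom_chart d c iota y0) A.
  by rewrite ie; exact: sdiff_conj_chart.
have [_ /=] := sdiff_derive v (sdiff_comp si sA); rewrite Av => <-.
apply: near_eq_derive.
have gi := gsmooth_hom (fdim_rV R m) iotaS (gsmooth_cinv d_atlas (cimg_cmap d_unit)).
have i1 : cdom c ((iota \o cinv d) y0) by rewrite /= cinv_unit // (hom1 iotaM).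
apply: filterS (near_cdom gi.1 i1) => y /= cy.
by rewrite /conj_chart /hom_chart cmapK.
Qed.

Local Notation P := (fixed_proj A).
Let bA := bounded_linear_Ad c_atlas c_unit g0.

(** By local surjectivity an x near 1 is iota l times the point with coordinates e + v, where v lies
    in the complement of the fixed vectors. If s fixes x it fixes the second factor, so A v = v up
    to a small multiple of |v|. As A - 1 is bounded below on the complement, v = 0. *)
Lemma fixed_points_near1 : exists2 U : set G, open U /\ U 1%g & fixed_points s `&` U `<=` range iota.
Proof.
have si := sdiff_hom_chart d_atlas d_unit c_atlas c_unit iotaM iotaS.
have ie : hom_chart d c iota y0 = e by rewrite /hom_chart cinv_unit // (hom1 iotaM).
have [bi _] := si.
pose fi := linfun (HB.pack_for {linear 'rV[R]_m -> 'rV[R]_n} di (GRing.isLinear.Build _ _ _ _ _ bi.1)).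
pose K1 w := (fi^-1)%VF (P w).
have K1P w : di (K1 w) = P w.
  have [v _ Ev] : range di (P w) by rewrite diota_range /=; exact: fixed_projP.
  have := limg_lfunVK (f := fi) (x := P w); rewrite lfunE /=; apply.
  by rewrite -Ev; have := memv_img fi (memvf v); rewrite lfunE.
pose F z := mul_chart c (hom_chart d c iota z.1, z.2).
have sF : sdiff F (y0, e) (fun z => di z.1 + z.2).
  have s1 : sdiff (fun z : 'rV[R]_m * V => (hom_chart d c iota z.1, z.2)) (y0, e) (fun z => (di z.1, z.2)).
    apply: sdiff_pair; last exact: (blin_sdiff _ (bounded_linear_snd _ _)).
    exact: (sdiff_comp (blin_sdiff (y0, e) (bounded_linear_fst _ _)) si).
  have s2 : sdiff (mul_chart c) ((fun z : 'rV[R]_m * V => (hom_chart d c iota z.1, z.2)) (y0, e)) (fun z => z.1 + z.2).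
    by rewrite /= ie; exact: sdiff_mul_chart.
  exact: (sdiff_comp s1 s2).
have linP := fixed_proj_linear bA.
(* A right inverse of the differential of [F]: the fixed part of w is lifted to the Lie algebra of
   L, the rest is kept as transverse displacement. *)
pose K w := (K1 w, w - P w).
have bK : bounded_linear K.
  have lK1 : linear K1 by move=> a x y; rewrite /K1 linP linearP.
  apply: linear_bounded => a x y; congr pair; [exact: lK1|exact: (fixed_compl_linear bA)].
have LK w : di (K w).1 + (K w).2 = w by rewrite /K /= K1P addrC subrK.
have [lK [C C0 KC]] := bK.
have [_ [CA CA0 AC]] := bA.
(* This precision turns |v - A v| into at most |v| / (CA + 2), whereas it is at least 3 |v| / (CA +
   2). *)
have eta0 : 0 < (CA + 2)^-1 by rewrite invr_gt0 addr_gt0.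
have [_ /(_ _ eta0)[d1 d10 H1]] := sdiff_conj_chart c_atlas c_unit g0.
have fV := fdim_rV R m; have fW := fdim_rV R n; have fVW := fdim_prod fV fW.
have gi : gsmooth (fun z : 'rV[R]_m * V => iota (cinv d z.1)) (y0, e).
  apply: (gsmooth_hom fVW iotaS).
  apply: (@gsmooth_comp _ _ fVW _ L _ (cinv d) fst) => //.
    exact/smooth_at_blin/bounded_linear_fst.
  by apply: gsmooth_cinv => //; exact: cimg_cmap.
have gv : gsmooth (fun z : 'rV[R]_m * V => cinv c z.2) (y0, e).
  apply: (@gsmooth_comp _ _ fVW _ G _ (cinv c) snd) => //.
    exact/smooth_at_blin/bounded_linear_snd.
  by apply: gsmooth_cinv => //; exact: cimg_cmap.
have gm := gsmooth_mul fVW gi gv.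
have i1 : iota (cinv d y0) = 1%g by rewrite cinv_unit // (hom1 iotaM).
have ci : cdom c (iota (cinv d (y0, e).1)) by rewrite /= i1.
have cm : cdom c (iota (cinv d (y0, e).1) * cinv c (y0, e).2)%g.
  by rewrite /= i1 mul1g cinv_unit.
have N3 : \forall z \near (y0, e), cimg c z.2.
  have sndc : {for (y0, e), continuous (snd : 'rV[R]_m * V -> _)} by exact: cvg_snd.
  by apply: sndc; exact: near_cimg (cimg_cmap c_unit).
have [r r0 Hr] := near_norm_ball (filterI (near_cdom gi.1 ci) (filterI (near_cdom gm.1 cm) N3)).
pose eps := Num.min d1 r / (2 * C).
have dr0 : 0 < Num.min d1 r by rewrite lt_min d10.
have eps0 : 0 < eps by rewrite divr_gt0 // mulr_gt0.
have [dl dl0 Hs] := local_surjectivity sF bK LK eps0.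
have F0 : F (y0, e) = e by rewrite /F /= ie mul_chart_unit.
have NU : nbhs (1%g : G) [set x | cdom c x /\ `|cmap c x - e| < dl].
  apply: filterI; first by apply: (near_cdom (F := id)) => //; exact: cvg_id.
  exact: (@cmap_continuous _ _ _ c _ c_unit _ (near_dist_lt e dl0)).
move: NU; rewrite nbhsE => -[U [oU U1] UH]; exists U => // x [Fx /UH[cx xdl]].
have [|w weps Fw] := Hs (cmap c x); first by rewrite F0.
set z := (y0, e) + K w in Fw.
have Kw : `|K w| < Num.min d1 r.
  apply: le_lt_trans (KC w) _; apply: le_lt_trans (_ : C * eps < _).
    by rewrite ler_pM2l.
  have -> : C * eps = Num.min d1 r / 2 by rewrite /eps; field; rewrite gt_eqF.
  by rewrite ltr_pdivrMr // ltr_pMr // ltr1n.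
move: Kw; rewrite lt_min => /andP[Kd1 Kr].
have [|c1 [c2 c3]] := Hr z; first by rewrite /z addrC addKr.
have E1 : (iota (cinv d z.1) * cinv c z.2)%g = x.
  have := congr1 (cinv c) Fw; rewrite /F /mul_chart /= /hom_chart (cmapK c1) !cmapK //.
have Fl : s (iota (cinv d z.1)) = iota (cinv d z.1) by apply: range_fixed; exists (cinv d z.1).
have Fq : s (cinv c z.2) = cinv c z.2.
  by apply: (mulgI (iota (cinv d z.1))); rewrite -{1}Fl -conj_byM E1.
pose v := w - P w.
have z2 : z.2 = e + v by [].
have vd : `|v| < d1.
  by apply: le_lt_trans Kd1; rewrite prod_normE le_max lexx orbT.
have zv : z.2 - e = v by rewrite z2 addrC addKr.
have := H1 z.2 e; rewrite zv subrr normr0 => /(_ vd d10).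
have -> : conj_chart c g0 z.2 = z.2 by rewrite /conj_chart -/(s (cinv c z.2)) Fq cinvK.
rewrite conj_chart_unit // zv => Hv.
have v0 : v = 0.
  apply/eqP; rewrite -normr_le0.
  have := fixed_compl_estimate bA AC (fixed_proj_compl bA A3 w).
  have : (CA + 2) * `|v - A v| <= `|v|.
    by rewrite mulrC -ler_pdivlMr ?addr_gt0 // mulrC.
  rewrite -/v; set t := `|v|; set t' := _ * _; lra.
exists (cinv d z.1) => //; rewrite -[LHS]mulg1 -E1; congr (_ * _)%g.
by rewrite z2 v0 addr0 cinv_unit.
Qed.

Lemma conj_by_three_symmetric : three_symmetric (range iota) s.
Proof.
have [U [oU U1] UH] := fixed_points_near1.
have sF := fixed_points_subgroup; have sH := range_subgroup.
split.
- split=> //; exact: (closed_subgroup sF sH range_fixed oU U1 UH fixed_points_closed).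
- exact: conj_by_automorphism.
- exact: conj_by_order3.
- have [F1 _ _] := sF.
  apply: (connected_sub_subgroup sF sH range_fixed oU U1 UH).
  + exact: component_connected.
  + exact: connected_component_refl.
  + exact: connected_component_sub.
- exact: range_fixed.
Qed.

End Conjugation.

(** * The almost complex structure *)

Section AlmostComplex.
Variables (R : realType) (n : nat).
Local Notation V := 'rV[R]_n.
Variables (A : V -> V) (m : set V).
Hypothesis linA : linear A.
Hypothesis mP : forall u, m u <-> A (A u) + A u + u = 0.
Local Notation q := (Num.sqrt 3 : R).

Let bA := linear_bounded linA.
Let q2 : q * q = 3. Proof. by rewrite -expr2 sqr_sqrtr. Qed.
Let q0 : q != 0. Proof. by rewrite sqrtr_eq0 -ltNge. Qed.

(** Solving omega = (-1 + i sqrt 3) / 2 for i gives i = (2 omega + 1) / sqrt 3. The formula is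
    defined on all of V but squares to -1 only on m. *)
Definition acs (u : V) : V := q^-1 *: (2 *: A u + u).

Lemma acs_linear : linear acs.
Proof.
by move=> a x y; rewrite /acs linA; apply/rowP => i; rewrite !mxE; ring.
Qed.

Lemma acs_comm (B : V -> V) : linear B -> (forall u, A (B u) = B (A u)) ->
  forall u, acs (B u) = B (acs u).
Proof.
move=> /linear_bounded bB AB u.
by rewrite /acs (blinZ bB) (blinD bB) (blinZ bB) AB.
Qed.

Lemma commuting_stable (B : V -> V) : linear B -> (forall u, A (B u) = B (A u)) ->
  forall u, m u -> m (B u).
Proof.
move=> /linear_bounded bB AB u /mP mu; apply/mP.
by rewrite !AB -!(blinD bB) mu (blin0 bB).
Qed.

Lemma acs_stable u : m u -> m (acs u).
Proof. by apply: commuting_stable acs_linear _ _ => v; rewrite (acs_comm linA). Qed.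

Lemma acs_square u : m u -> acs (acs u) = - u.
Proof.
move=> /mP mu; have -> : - u = A (A u) + A u.
  by apply/eqP; rewrite eq_sym -addr_eq0 mu.
have -> : acs (acs u) = 3^-1 *: (4 *: A (A u) + 4 *: A u + u).
  rewrite /acs (blinZ bA) (blinD bA) (blinZ bA); move: (A u) (A (A u)) q q0 q2 => a b r r0 <-.
  by apply/rowP => i; rewrite !mxE; field.
move: (A u) (A (A u)) mu => a b /eqP; rewrite addrC addr_eq0 => /eqP ->.
by apply/rowP => i; rewrite !mxE; field.
Qed.

(** The relation between i and omega is affine, so J X = i X and sigma X = omega X are equivalent.
    That X lies in the complexification of m then follows from omega^2 + omega + 1 = 0. *)
Lemma acs_space10E : acs_space10 m acs = [set X | cplx_map A X = omega3 R *: X].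
Proof.
have cE : complex.Re (omega3 R) = - (2^-1) by exact: cos_third.
have sE : complex.Im (omega3 R) = q / 2 by exact: sin_third.
apply/seteqP; split=> X /=.
  move=> [_ E]; have := congr1 (@reV _ _) E; have := congr1 (@imV _ _) E.
  rewrite !(reV_cplx_map, imV_cplx_map, reimE) => Ei Er.
  apply: reim_inj; rewrite !(reV_cplx_map, imV_cplx_map, reV_scale, imV_scale) cE sE.
    rewrite -[imV X]opprK -Er /acs; move: (reV X) (A _) q q0 => x a r r0.
    by apply/rowP => i; rewrite !mxE; field.
  rewrite -Ei /acs; move: (imV X) (A _) q q0 => x a r r0.
  by apply/rowP => i; rewrite !mxE; field.
move=> E; have := congr1 (@reV _ _) E; have := congr1 (@imV _ _) E.
rewrite !(reV_cplx_map, imV_cplx_map, reV_scale, imV_scale) cE sE.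
move=> Ey Ex.
have Jx : acs (reV X) = - imV X.
  rewrite /acs Ex; move: (reV X) (imV X) q q0 => x y r r0.
  by apply/rowP => i; rewrite !mxE; field.
have Jy : acs (imV X) = reV X.
  rewrite /acs Ey; move: (reV X) (imV X) q q0 => x y r r0.
  by apply/rowP => i; rewrite !mxE; field.
split; last by apply: reim_inj; rewrite !(reV_cplx_map, imV_cplx_map, reimE).
split; apply/mP.
  rewrite Ex !(blinB bA, blinD bA, blinZ bA) Ex Ey; move: (reV X) (imV X) q q2 => x y r r2.
  apply/rowP => i; rewrite !mxE; transitivity ((3 - r * r) / 4 * x 0 i); first by field.
  by rewrite r2 subrr !mul0r.
rewrite Ey !(blinB bA, blinD bA, blinZ bA) Ex Ey; move: (reV X) (imV X) q q2 => x y r r2.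
apply/rowP => i; rewrite !mxE; transitivity ((3 - r * r) / 4 * y 0 i); first by field.
by rewrite r2 subrr !mul0r.
Qed.

End AlmostComplex.

Theorem proposition5p9 (R : realType) (n : nat) (G : lieGroup R n)
    (G_compact : compact [set: G]) (G_connected : connected [set: G])
    (c : chart R n G) (c_atlas : atlas (l := G) c) (c_unit : cdom c (1%g : G))
    (g_semisimple : lie_semisimple (lie_br c))
    (p lplus : {vspace 'rV[R[i]]_n})
    (p_parabolic : lie_parabolic (cplx_br (lie_br c)) p)
    (lplus_nilradical : lie_nilradical (cplx_br (lie_br c)) lplus p)
    (H : set G)
    (H_def : connected_lie_subgroup c H (hR (lie_br c) p lplus)) :
  exists s : G -> G,
    three_symmetric H s /\
    reductive_complement c H (hR (lie_br c) p lplus) (mR (lie_br c) p lplus) /\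
    exists J : {linear 'rV[R]_n -> 'rV[R]_n},
      canonical_acs c H (mR (lie_br c) p lplus) s J /\
      acs_space10 (mR (lie_br c) p lplus) J = mplus (lie_br c) p lplus.
Proof.
have brL := lie_bracket_of_semisimple c_atlas c_unit g_semisimple.
have im := eigenvalue_imaginary G_compact c_atlas c_unit.
have sq := lie_br_square0 G_compact c_atlas c_unit.
have [x0 x0P] := canonical_real brL im sq g_semisimple p_parabolic lplus_nilradical.
have [g0 rot] := flow_rotation G_compact c_atlas c_unit ((2 * pi / 3) *: x0).
have linA := linear_Ad c_atlas c_unit g0.
have A3 u : Ad c g0 (Ad c g0 (Ad c g0 u)) = u.
  have := sigma_order3 brL im sq g_semisimple p_parabolic lplus_nilradical x0P linA rot (toC u).
  by rewrite !(cplx_map_toC linA) => /(congr1 (@reV _ _)); rewrite !reV_toC.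
have hP := hR_fixed brL im sq g_semisimple p_parabolic lplus_nilradical x0P linA rot.
have mP := mR_fixed brL im sq g_semisimple p_parabolic lplus_nilradical x0P linA rot.
have pP := mplusE brL im sq g_semisimple p_parabolic lplus_nilradical x0P linA rot.
have hE : hR (lie_br c) p lplus = [set u | Ad c g0 u = u].
  by apply/seteqP; split=> u /hP.
case: H_def => k [L [d [iota [[ad d1 cL] [[iS iM _ _] [<- dr]]]]]].
rewrite hE in dr.
have sym := conj_by_three_symmetric G_connected c_atlas c_unit A3 ad d1 cL iS iM dr.
(* Elements of H are fixed by s, that is, commute with g0. Since m and J are given by polynomials in
   Ad g0, they are Ad-invariant under H. *)
have comm x u : range iota x -> Ad c g0 (Ad c x u) = Ad c x (Ad c g0 u).
  move=> /(range_fixed c_atlas c_unit ad d1 cL iS iM dr).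
  rewrite /fixed_points /= /conj_by => /(congr1 (fun y => y * g0)%g); rewrite mulgVK => E.
  by rewrite -!AdM // E.
have bA := linear_bounded linA.
exists (conj_by g0); split; [exact: sym|split].
  split.
  - move=> u; exists (fixed_proj (Ad c g0) u), (u - fixed_proj (Ad c g0) u); split.
    + by apply/hP; exact: fixed_projP.
    + by apply/mP; exact: fixed_proj_compl.
    + by rewrite addrC subrK.
  - move=> u /hP uh /mP; rewrite !uh -mulr2n -mulrSr -scaler_nat => /eqP.
    by rewrite scaler_eq0 pnatr_eq0 => /eqP.
  - move=> x u xH; apply: (commuting_stable mP) => [|u']; last exact: comm.
    by case: (bounded_linear_Ad c_atlas c_unit x).
pose J := HB.pack_for {linear 'rV[R]_n -> 'rV[R]_n} (acs (Ad c g0))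
  (GRing.isLinear.Build _ _ _ _ _ (acs_linear linA)).
have E10 := acs_space10E linA mP.
exists J; split; last by rewrite pP -E10.
split; last exact: E10.
split; [exact: (acs_stable linA mP)|exact: (acs_square linA mP)|].
move=> x u xH _; apply: acs_comm; first by case: (bounded_linear_Ad c_atlas c_unit x).
by move=> u'; exact: comm.
Qed.
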